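(* The Fourier transform $\mathcal{F}: L^2(\mathbb{A})\to L^2(\mathbb{A})$ on the adèle ring $\mathbb{A}=\mathbb{R}\times\mathbb{A}_f$ of $\mathbb{Q}$ is an isometry, and the Fourier inversion formula and the Parseval–Steklov identity hold on $L^2(\mathbb{A})$: writing $\widehat{f}=\mathcal{F}(f)$, for every $f\in L^2(\mathbb{A})$ one has $f=\mathcal{F}\big[\xi\mapsto\widehat{f}(-\xi)\big]$ in $L^2(\mathbb{A})$, and for all $f,g\in L^2(\mathbb{A})$, $$\int_{\mathbb{A}} f(x)\overline{g(x)}\,dx=\int_{\mathbb{A}}\widehat{f}(\xi)\overline{\widehat{g}(\xi)}\,d\xi .$$
   Context: $\mathbb{A}_f$ is the ring of finite adèles of $\mathbb{Q}$, $\widehat{\mathbb{Z}}=\prod_p\mathbb{Z}_p\subset\mathbb{A}_f$ is its maximal compact open subring. For $x\in\mathbb{A}_f$, the fractional part $\{x\}_{\mathbb{A}_f}$ is the unique rational number in $[0,1)$ with $x-\{x\}_{\mathbb{A}_f}\in\widehat{\mathbb{Z}}$. The canonical characters are $\chi_\infty(x_\infty)=\exp(-2\pi i x_\infty)$ on $\mathbb{R}$, $\chi_f(x_f)=\exp(2\pi i\{x_f\}_{\mathbb{A}_f})$ on $\mathbb{A}_f$, and $\chi(x)=\chi_\infty(x_\infty)\chi_f(x_f)$ on $\mathbb{A}=\mathbb{R}\times\mathbb{A}_f$, $x=(x_\infty,x_f)$. The Haar measure on $\mathbb{A}$ is $dx=dx_\infty\,dx_f$, where $dx_\infty$ is Lebesgue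 measure on $\mathbb{R}$ and $dx_f$ is the Haar measure on $\mathbb{A}_f$ giving $\widehat{\mathbb{Z}}$ mass one. The Fourier transform on $L^2(\mathbb{R})$ is the (unitary) $L^2$-extension $\mathcal{F}_{\mathbb{R}}$ of $\varphi\mapsto\int_{\mathbb{R}}\varphi(x_\infty)\chi_\infty(\xi_\infty x_\infty)\,dx_\infty$ from Schwartz functions. The Fourier transform $\mathcal{F}_{\mathbb{A}_f}$ on $L^2(\mathbb{A}_f)$ is the $L^2$-extension of $\varphi\mapsto\int_{\mathbb{A}_f}\varphi(x_f)\chi_f(\xi_f x_f)\,dx_f$ from locally constant compactly supported functions. With the Hilbert tensor product decomposition $L^2(\mathbb{A})\cong L^2(\mathbb{R})\otimes L^2(\mathbb{A}_f)$, the Fourier transform on $L^2(\mathbb{A})$ is $\mathcal{F}=\mathcal{F}_{\mathbb{R}}\otimes\mathcal{F}_{\mathbb{A}_f}$, the bounded linear operator determined by $\mathcal{F}(\varphi_\infty\otimes\varphi_f)=\mathcal{F}_{\mathbb{R}}(\varphi_\infty)\otimes\mathcal{F}_{\mathbb{A}_f}(\varphi_f)$, where $(\varphi_\infty\otimes\varphi_f)(x)=\varphi_\infty(x_\infty)\varphi_f(x_f)$; it agrees with $\varphi\mapsto\int_{\mathbb{A}}\varphi(x)\chi(\xi x)\,dx$ on finite linear combinations of products of a Schwartz function on $\mathbb{R}$ and a locally constant compactly supported function on $\mathbb{A}_f$. *)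

(* Defs.v *)
From HB Require Import structures.
From mathcomp Require Import all_boot all_order all_algebra.
From mathcomp Require Import generic_quotient ring_quotient.
From mathcomp Require Import complex.
From mathcomp Require Import all_classical all_reals all_analysis.

Set Implicit Arguments.
Unset Strict Implicit.
Unset Printing Implicit Defensive.

Import Order.TTheory GRing.Theory Num.Theory.
Import numFieldNormedType.Exports.

Local Open Scope classical_set_scope.
Local Open Scope ring_scope.
Local Open Scope quotient_scope.

Definition padic_abs (p : nat) (x : rat) : rat :=
  if x == 0 then 0
  else p%:R ^+ logn p `|denq x|%N / p%:R ^+ logn p `|numq x|%N.

Definition prime_nat : Type := {p : nat | prime p}.

Section padic_abs_theory.
Variable p : prime_nat.
Local Notation abs := (padic_abs (sval p)).

Let pp : prime (sval p). Proof. exact: (valP p). Qed.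

Let p_gt0 : 0 < (sval p)%:R :> rat.
Proof. by rewrite ltr0n prime_gt0. Qed.

Lemma padic_abs0 : abs (0) = 0. Proof. by rewrite /padic_abs eqxx. Qed.

Lemma padic_abs_frac (m n : int) : m != 0 -> n != 0 ->
  abs (m%:~R / n%:~R) =
  (sval p)%:R ^+ logn (sval p) `|n|%N / (sval p)%:R ^+ logn (sval p) `|m|%N.
Proof.
move=> m0 n0; set x : rat := m%:~R / n%:~R.
have x0 : x != 0 by rewrite mulf_neq0 ?invr_neq0 ?intr_eq0.
rewrite /padic_abs (negPf x0).
have e : numq x * n = m * denq x.
  apply: (@intr_inj rat); rewrite !intrM.
  have : x = (numq x)%:~R / (denq x)%:~R by rewrite divq_num_den.
  rewrite {1}/x => /eqP; rewrite eqr_div ?intr_eq0 ?denq_neq0// => /eqP.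
  by move=> ->.
have {}e : (`|numq x| * `|n| = `|m| * `|denq x|)%N by rewrite -!abszM e.
have : (logn (sval p) (`|numq x| * `|n|) = logn (sval p) (`|m| * `|denq x|))%N
  by rewrite e.
rewrite !lognM ?absz_gt0 ?numq_eq0 ?denq_neq0// => {}e.
apply/eqP; rewrite eqr_div ?expf_neq0 ?lt0r_neq0// -!exprD.
by rewrite addnC -e addnC.
Qed.

Lemma padic_abs1 : abs (1) = 1.
Proof. by have := @padic_abs_frac 1 1 isT isT; rewrite divr1 logn1 expr0 divr1. Qed.

Lemma padic_abs_ge0 x : 0 <= abs (x).
Proof.
by rewrite /padic_abs; case: ifP => // _; rewrite divr_ge0// exprn_ge0// ltW.
Qed.

Lemma padic_absM x y : abs (x * y) = abs (x) * abs (y).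
Proof.
have [->|x0] := eqVneq x 0; first by rewrite mul0r padic_abs0 mul0r.
have [->|y0] := eqVneq y 0; first by rewrite mulr0 padic_abs0 mulr0.
rewrite -{1}(divq_num_den x) -{1}(divq_num_den y) mulf_div -!intrM.
rewrite padic_abs_frac ?mulf_neq0 ?numq_eq0 ?denq_neq0//.
rewrite /padic_abs (negPf x0) (negPf y0) mulf_div !abszM.
by rewrite !lognM ?absz_gt0 ?numq_eq0 ?denq_neq0// !exprD.
Qed.

Lemma padic_absN x : abs (- x) = abs (x).
Proof. by rewrite /padic_abs oppr_eq0 numqN denqN abszN. Qed.

Lemma padic_absD x y : abs (x + y) <= Num.max (abs (x)) (abs (y)).
Proof.
have [->|x0] := eqVneq x 0; first by rewrite add0r le_max lexx orbT.
have [->|y0] := eqVneq y 0; first by rewrite addr0 le_max lexx.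
have [->|xy0] := eqVneq (x + y) 0.
  by rewrite padic_abs0 le_max padic_abs_ge0.
pose d := denq x * denq y.
pose a := numq x * denq y; pose b := numq y * denq x.
have d0 : d != 0 by rewrite mulf_neq0 ?denq_neq0.
have a0 : a != 0 by rewrite mulf_neq0 ?numq_eq0 ?denq_neq0.
have b0 : b != 0 by rewrite mulf_neq0 ?numq_eq0 ?denq_neq0.
have dr : d%:~R != 0 :> rat by rewrite intr_eq0.
have ex : x = a%:~R / d%:~R.
  rewrite /a /d !intrM -mulf_div divff ?intr_eq0 ?denq_neq0// mulr1.
  by rewrite divq_num_den.
have ey : y = b%:~R / d%:~R.
  rewrite /b /d mulrC !intrM [(denq x)%:~R * _]mulrC mulrC -mulf_div.
  by rewrite divff ?intr_eq0 ?denq_neq0// mulr1 divq_num_den.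
have exy : x + y = (a + b)%:~R / d%:~R by rewrite ex ey intrD mulrDl.
have ab0 : a + b != 0.
  by apply: contraNneq xy0 => e; rewrite exy e mul0r.
rewrite exy {1}ex {1}ey !padic_abs_frac//.
wlog le_ab : a b a0 b0 ab0 {ex ey exy} / (logn (sval p) `|a| <= logn (sval p) `|b|)%N.
  move=> H; case: (leqP (logn (sval p) `|a|) (logn (sval p) `|b|)) => ab.
    exact: H.
  by rewrite maxC addrC; apply: H => //; rewrite 1?addrC// ltnW.
rewrite le_max; apply/orP; left.
rewrite ler_pM2l ?exprn_gt0// lef_pV2 ?posrE ?exprn_gt0//.
rewrite ler_weXn2l// ?ler1n ?prime_gt0//.
rewrite -pfactor_dvdn ?absz_gt0//.
have : ((sval p ^ logn (sval p) `|a|)%N %| a + b)%Z.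
  by apply: rpredD; rewrite dvdzE/= pfactor_dvdn ?absz_gt0.
by rewrite dvdzE.
Qed.

Lemma padic_absD_lt e x y : abs x < e -> abs y < e -> abs (x + y) < e.
Proof.
by move=> xe ye; rewrite (le_lt_trans (padic_absD x y))// gt_max xe ye.
Qed.

Lemma padic_absB_lt e x y : abs x < e -> abs y < e -> abs (x - y) < e.
Proof. by move=> xe ye; rewrite padic_absD_lt// padic_absN. Qed.

Lemma padic_absD_le e x y : abs x <= e -> abs y <= e -> abs (x + y) <= e.
Proof.
by move=> xe ye; rewrite (le_trans (padic_absD x y))// ge_max xe ye.
Qed.

Lemma padic_absB_le e x y : abs x <= e -> abs y <= e -> abs (x - y) <= e.
Proof. by move=> xe ye; rewrite padic_absD_le// padic_absN. Qed.

End padic_abs_theory.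

(* Qp is the completion of the rationals for the p-adic absolute value, built as
   the ring of Cauchy sequences modulo the ideal of null sequences. *)

Definition padic_cauchy (p : prime_nat) : {pred nat -> rat} := fun u =>
  `[< forall eps : rat, 0 < eps -> exists N, forall i j, (N <= i)%N ->
      (N <= j)%N -> padic_abs (sval p) (u i - u j) < eps >].

Section padic_cauchy_ring.
Variable p : prime_nat.
Local Notation abs := (padic_abs (sval p)).

Lemma padic_cauchy_bounded u : u \in padic_cauchy p ->
  exists M : rat, 0 < M /\ exists N, forall i, (N <= i)%N -> abs (u i) < M.
Proof.
move=> /asboolP/(_ 1 ltr01)[N uN]; exists (abs (u N) + 1).
split; first by rewrite ltr_wpDl// padic_abs_ge0.
exists N => i Ni; rewrite -[u i](subrK (u N)).
apply: padic_absD_lt; last by rewrite ltrDl.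
by rewrite (lt_le_trans (uN _ _ Ni (leqnn N)))// lerDr padic_abs_ge0.
Qed.

Lemma padic_cauchy_subring_closed : subring_closed (padic_cauchy p).
Proof.
split => [|u v /asboolP uC /asboolP vC|u v uC vC].
- by apply/asboolP => e e0; exists 0%N => i j _ _; rewrite subrr padic_abs0.
- apply/asboolP => e e0; have [N uN] := uC e e0; have [M vM] := vC e e0.
  exists (maxn N M) => i j; rewrite !geq_max => /andP[Ni Mi] /andP[Nj Mj].
  have -> : (u - v) i - (u - v) j = (u i - u j) - (v i - v j).
    by rewrite !fctE opprD addrACA -opprD.
  by apply: padic_absB_lt; [exact: uN|exact: vM].
- have [a [a0 [A uA]]] := padic_cauchy_bounded uC.
  have [b [b0 [B vB]]] := padic_cauchy_bounded vC.
  move/asboolP: uC => uC; move/asboolP: vC => vC.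
  apply/asboolP => e e0.
  have [N uN] := uC _ (divr_gt0 e0 b0); have [M vM] := vC _ (divr_gt0 e0 a0).
  exists (maxn (maxn A B) (maxn N M)) => i j; rewrite !geq_max.
  move=> /andP[/andP[Ai Bi] /andP[Ni Mi]] /andP[/andP[Aj Bj] /andP[Nj Mj]].
  have -> : (u * v) i - (u * v) j = (u i - u j) * v i + u j * (v i - v j).
    by rewrite mulrBl mulrBr addrA subrK.
  apply: padic_absD_lt; rewrite padic_absM.
    rewrite -(divfK (lt0r_neq0 b0) e); apply: ltr_pM; rewrite ?padic_abs_ge0//.
      exact: uN.
    exact: vB.
  rewrite mulrC -(divfK (lt0r_neq0 a0) e).
  apply: ltr_pM; rewrite ?padic_abs_ge0//; [exact: vM|exact: uA].
Qed.

HB.instance Definition _ :=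
  GRing.isSubringClosed.Build (nat -> rat) (padic_cauchy p)
    padic_cauchy_subring_closed.

Record cauchy_seq : Type := CauchySeq {
  cauchy_val :> nat -> rat ;
  cauchy_valP : cauchy_val \in padic_cauchy p }.

HB.instance Definition _ := [isSub for cauchy_val].
HB.instance Definition _ := [Choice of cauchy_seq by <:].
HB.instance Definition _ := [SubChoice_isSubComNzRing of cauchy_seq by <:].

Definition padic_null : {pred cauchy_seq} := fun u =>
  `[< forall eps : rat, 0 < eps -> exists N, forall i, (N <= i)%N ->
      abs (u i) < eps >].

Lemma padic_null_idealr_closed : idealr_closed padic_null.
Proof.
split.
- by apply/asboolP => e e0; exists 0%N => i _; rewrite padic_abs0.
- apply/asboolPn => /(_ 1 ltr01)[N /(_ N (leqnn N))].
  by rewrite padic_abs1 ltxx.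
- move=> a u v /asboolP uN /asboolP vN; apply/asboolP => e e0.
  have [b [b0 [B aB]]] := padic_cauchy_bounded (cauchy_valP a).
  have [N {}uN] := uN _ (divr_gt0 e0 b0); have [M {}vM] := vN _ e0.
  exists (maxn B (maxn N M)) => i; rewrite !geq_max => /andP[Bi /andP[Ni Mi]].
  have -> : (a * u + v : cauchy_seq) i = a i * u i + v i by [].
  apply: padic_absD_lt; last exact: vM.
  rewrite padic_absM mulrC -(divfK (lt0r_neq0 b0) e).
  by apply: ltr_pM; rewrite ?padic_abs_ge0//; [exact: uN|exact: aB].
Qed.

HB.instance Definition _ :=
  isIdealr.Build cauchy_seq padic_null padic_null_idealr_closed.

End padic_cauchy_ring.

Definition Qp (p : prime_nat) : Type := {ideal_quot (@padic_null p)}.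

HB.instance Definition _ p := GRing.ComNzRing.on (Qp p).

HB.instance Definition _ p := ring_quotient.NzRingQuotient.on (Qp p).

Section Qp_theory.
Variable p : prime_nat.
Local Notation abs := (padic_abs (sval p)).
Implicit Types (x y : Qp p) (u v : cauchy_seq p).

(* The absolute values along a Cauchy sequence representing x are eventually
   constant, unless x = 0; the default value 0 is used for those sequences
   representing 0 for which they are not. *)
Definition Qp_abs x : rat :=
  xget 0 [set r | exists N, forall i, (N <= i)%N -> abs ((repr x : cauchy_seq p) i) = r].

Definition Zp : set (Qp p) := [set x | Qp_abs x <= 1].

Lemma Qp_abs_eventually x e : 0 < e -> exists N, forall i, (N <= i)%N ->
  abs ((repr x : cauchy_seq p) i) = Qp_abs x \/
  Qp_abs x = 0 /\ abs ((repr x : cauchy_seq p) i) < e.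
Proof.
move=> e0; set u : cauchy_seq p := repr x.
have [/asboolP uN|/asboolPn uN] := boolP (u \in @padic_null p).
  have x0 : Qp_abs x = 0.
    rewrite /Qp_abs; case: xgetP => // r _ [N Nr].
    apply/eqP; apply: contraT => r0.
    have rgt0 : 0 < r by rewrite lt0r r0/= -(Nr N (leqnn N)) padic_abs_ge0.
    have [M Mr] := uN _ rgt0.
    by have := Mr _ (leq_maxr N M); rewrite Nr ?leq_maxl// ltxx.
  have [N Ne] := uN e e0; exists N => i Ni; right; split => //; exact: Ne.
have [d /not_implyP[d0 dN]] : exists d : rat,
    ~ (0 < d -> exists N, forall i, (N <= i)%N -> abs (u i) < d).
  exact/existsNP.
have [N Nd] := asboolP _ (cauchy_valP u) d d0.
have [i [Ni di]] : exists i, (N <= i)%N /\ d <= abs (u i).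
  apply: contrapT => H; apply: dN; exists N => i Ni.
  by rewrite ltNge; apply/negP => ?; apply: H; exists i.
have cst j : (N <= j)%N -> abs (u j) = abs (u i).
  move=> Nj; apply/eqP; rewrite eq_le; apply/andP; split.
    rewrite -[u j](subrK (u i)) padic_absD_le// (le_trans _ di)// ltW//.
    exact: Nd.
  rewrite leNgt; apply/negP => ji.
  have : abs (u j + (u i - u j)) < abs (u i).
    by rewrite padic_absD_lt// (lt_le_trans _ di)// Nd.
  by rewrite addrC subrK ltxx.
exists N => j Nj; left.
rewrite /Qp_abs; case: xgetP => [r _ [M Mr]|/(_ (abs (u i)))[]].
  by rewrite -(Mr _ (leq_maxr N M)) !cst// leq_maxl.
by exists N => k /cst.
Qed.

Lemma Qp_abs_le x e : 0 < e -> Qp_abs x <= e <->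
  exists N, forall i, (N <= i)%N -> abs ((repr x : cauchy_seq p) i) <= e.
Proof.
move=> e0; have [N xN] := Qp_abs_eventually x e0.
split=> [xe|[M Me]].
  by exists N => i /xN[->//|[_ /ltW]].
have [<-|[-> _]] := xN _ (leq_maxl N M); last exact: ltW.
by rewrite Me// leq_maxr.
Qed.

Lemma Qp_abs_pi_le u e : 0 < e -> Qp_abs (\pi_(Qp p) u) <= e <->
  exists N, forall i, (N <= i)%N -> abs (u i) <= e.
Proof.
move=> e0; set v : cauchy_seq p := repr (\pi_(Qp p) u).
have /asboolP/(_ _ e0)[K vK] : v - u \in @padic_null p.
  by rewrite Quotient.idealrBE /v reprK.
have vK' i : (K <= i)%N -> abs (v i - u i) <= e.
  by move=> /vK/ltW.
rewrite Qp_abs_le// -/v; split=> -[N Ne]; exists (maxn N K) => i;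
  rewrite geq_max => /andP[Ni Ki].
  by rewrite -(subKr (v i) (u i)) padic_absB_le ?Ne ?vK'.
by rewrite -[v i](subrK (u i)) padic_absD_le ?Ne ?vK'.
Qed.

Lemma Qp_piB u v : \pi_(Qp p) (u - v) = \pi_(Qp p) u - \pi_(Qp p) v.
Proof. exact: (rmorphB \pi_(Qp p)). Qed.

Lemma Qp_piM u v : \pi_(Qp p) (u * v) = \pi_(Qp p) u * \pi_(Qp p) v.
Proof. exact: (rmorphM \pi_(Qp p)). Qed.

Lemma Qp_pi1 : \pi_(Qp p) 1 = 1.
Proof. exact: (rmorph1 \pi_(Qp p)). Qed.

Lemma Qp_absB_le x y e : 0 < e -> Qp_abs x <= e -> Qp_abs y <= e ->
  Qp_abs (x - y) <= e.
Proof.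
move=> e0 /(Qp_abs_le _ e0)[N xN] /(Qp_abs_le _ e0)[M yM].
have -> : x - y = \pi_(Qp p) ((repr x : cauchy_seq p) - repr y).
  by rewrite Qp_piB !reprK.
apply/Qp_abs_pi_le => //; exists (maxn N M) => i.
by rewrite geq_max => /andP[/xN ? /yM ?]; exact: padic_absB_le.
Qed.

Lemma Zp1 : Zp 1.
Proof.
rewrite /Zp/= -Qp_pi1; apply/Qp_abs_pi_le => //.
by exists 0%N => i _; rewrite padic_abs1.
Qed.

Lemma ZpB x y : Zp x -> Zp y -> Zp (x - y).
Proof. exact: Qp_absB_le. Qed.

Lemma ZpM x y : Zp x -> Zp y -> Zp (x * y).
Proof.
move=> /(Qp_abs_le _ ltr01)[N xN] /(Qp_abs_le _ ltr01)[M yM].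
have -> : x * y = \pi_(Qp p) ((repr x : cauchy_seq p) * repr y).
  by rewrite Qp_piM !reprK.
apply/Qp_abs_pi_le => //; exists (maxn N M) => i.
rewrite geq_max => /andP[/xN ? /yM ?].
rewrite -[_ i]/((repr x : cauchy_seq p) i * (repr y : cauchy_seq p) i).
by rewrite padic_absM mulr_ile1 ?padic_abs_ge0.
Qed.

Definition Qp_open (U : set (Qp p)) : Prop :=
  forall x, U x -> exists2 e : rat, 0 < e & forall y, Qp_abs (y - x) < e -> U y.

Lemma Qp_openT : Qp_open setT.
Proof. by move=> x _; exists 1. Qed.

Lemma Qp_openI : setI_closed Qp_open.
Proof.
move=> U V Uo Vo x [/Uo[d d0 dU] /Vo[e e0 eV]].
exists (Num.min d e); first by rewrite lt_min d0 e0.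
by move=> y; rewrite lt_min => /andP[/dU ? /eV].
Qed.

Lemma Qp_open_bigU (I : Type) (f : I -> set (Qp p)) :
  (forall i, Qp_open (f i)) -> Qp_open (\bigcup_i f i).
Proof.
by move=> fo x [i _ /fo[e e0 ei]]; exists e => // y /ei yi; exists i.
Qed.

HB.instance Definition _ :=
  isOpenTopological.Build (Qp p) Qp_openT Qp_openI Qp_open_bigU.

Lemma open_Zp : open Zp.
Proof.
have Z0 : Zp 0 by rewrite -(subrr 1); exact: ZpB Zp1 Zp1.
move=> x Zx; exists 1 => // y /ltW xy.
rewrite -(subKr x y); apply: ZpB => //.
by rewrite -opprB -sub0r; exact: ZpB.
Qed.

Definition Qp_of_rat (q : rat) : Qp p.
Proof.
refine (\pi_(Qp p) (@CauchySeq p (fun=> q) _)).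
by apply/asboolP => e e0; exists 0%N => i j _ _; rewrite subrr padic_abs0.
Defined.

End Qp_theory.

Definition Qp_prod : Type := forall p : prime_nat, Qp p.

HB.instance Definition _ := Choice.on Qp_prod.

Section Qp_prod_ring.
Implicit Types x y z : Qp_prod.

Definition Qp_prod_zero : Qp_prod := fun=> 0.
Definition Qp_prod_opp x : Qp_prod := fun p => - x p.
Definition Qp_prod_add x y : Qp_prod := fun p => x p + y p.
Definition Qp_prod_one : Qp_prod := fun=> 1.
Definition Qp_prod_mul x y : Qp_prod := fun p => x p * y p.

Lemma Qp_prod_addA : associative Qp_prod_add.
Proof. by move=> x y z; apply: functional_extensionality_dep => p; exact: addrA. Qed.
Lemma Qp_prod_addC : commutative Qp_prod_add.
Proof. by move=> x y; apply: functional_extensionality_dep => p; exact: addrC. Qed.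
Lemma Qp_prod_add0 : left_id Qp_prod_zero Qp_prod_add.
Proof. by move=> x; apply: functional_extensionality_dep => p; exact: add0r. Qed.
Lemma Qp_prod_addN : left_inverse Qp_prod_zero Qp_prod_opp Qp_prod_add.
Proof. by move=> x; apply: functional_extensionality_dep => p; exact: addNr. Qed.

HB.instance Definition _ := GRing.isZmodule.Build Qp_prod
  Qp_prod_addA Qp_prod_addC Qp_prod_add0 Qp_prod_addN.

Lemma Qp_prod_mulA : associative Qp_prod_mul.
Proof. by move=> x y z; apply: functional_extensionality_dep => p; exact: mulrA. Qed.
Lemma Qp_prod_mulC : commutative Qp_prod_mul.
Proof. by move=> x y; apply: functional_extensionality_dep => p; exact: mulrC. Qed.
Lemma Qp_prod_mul1 : left_id Qp_prod_one Qp_prod_mul.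
Proof. by move=> x; apply: functional_extensionality_dep => p; exact: mul1r. Qed.
Lemma Qp_prod_mulDl : left_distributive Qp_prod_mul +%R.
Proof. by move=> x y z; apply: functional_extensionality_dep => p; exact: mulrDl. Qed.
Lemma Qp_prod_one_neq0 : Qp_prod_one != 0.
Proof.
apply/eqP => /(congr1 (fun x : Qp_prod => x (exist (fun p => prime p) 2%N isT))).
by move/eqP; rewrite (negPf (oner_neq0 _)).
Qed.

HB.instance Definition _ := GRing.Zmodule_isComNzRing.Build Qp_prod
  Qp_prod_mulA Qp_prod_mulC Qp_prod_mul1 Qp_prod_mulDl Qp_prod_one_neq0.

End Qp_prod_ring.

Lemma finite_setU2 (T : choiceType) (A B : set T) :
  finite_set A -> finite_set B -> finite_set (A `|` B).
Proof. by move=> ? ?; rewrite finite_setU. Qed.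

Definition restricted : {pred Qp_prod} := fun x =>
  `[< finite_set [set p | ~ Zp (x p)] >].

Lemma restricted_subring_closed : subring_closed restricted.
Proof.
split=> [|x y /asboolP xf /asboolP yf|x y /asboolP xf /asboolP yf].
- apply/asboolP; rewrite (_ : [set _ | _] = set0)//.
  by rewrite -subset0 => p; apply; exact: Zp1.
- apply/asboolP; apply: sub_finite_set (finite_setU2 xf yf) => p /= xyp; apply: contrapT => /not_orP[/contrapT xp /contrapT yp].
  by apply: xyp; exact: ZpB.
- apply/asboolP; apply: sub_finite_set (finite_setU2 xf yf) => p /= xyp; apply: contrapT => /not_orP[/contrapT xp /contrapT yp].
  by apply: xyp; exact: ZpM.
Qed.

HB.instance Definition _ :=
  GRing.isSubringClosed.Build Qp_prod restricted restricted_subring_closed.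

(* The finite adeles, as the restricted product of the Qp with respect to the
   Zp. *)
Record Af : Type := MkAf {
  Af_val :> Qp_prod ;
  Af_valP : Af_val \in restricted }.

HB.instance Definition _ := [isSub for Af_val].
HB.instance Definition _ := [Choice of Af by <:].
HB.instance Definition _ := [SubChoice_isSubComNzRing of Af by <:].
HB.instance Definition _ := isPointed.Build Af 0.

Definition Zhat : set Af := [set x | forall p, Zp (Af_val x p)].

Definition Af_open (U : set Af) : Prop := forall x, U x ->
  exists V : forall p, set (Qp p),
    [/\ forall p, open (V p),
        finite_set [set p | V p <> @Zp p],
        forall p, V p (Af_val x p) &
        forall y : Af, (forall p, V p (Af_val y p)) -> U y].

Lemma Af_openT : Af_open setT.
Proof.
move=> x _; exists (fun p => if `[< Zp (Af_val x p) >] then @Zp p else setT).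
split=> [p||p|//]; last by case: asboolP.
  by case: ifP => _; [exact: open_Zp|exact: openT].
have /asboolP := Af_valP x; apply: sub_finite_set => p /= Vp xp.
by apply: Vp; rewrite asboolT.
Qed.

Lemma Af_openI : setI_closed Af_open.
Proof.
move=> U U' Uo Uo' x [/Uo[V [Vo Vf Vx VU]] /Uo'[V' [Vo' Vf' Vx' VU']]].
exists (fun p => V p `&` V' p); split.
- by move=> p; exact: openI.
- apply: sub_finite_set (finite_setU2 Vf Vf') => p /= Hp; apply: contrapT => /not_orP[/contrapT e /contrapT e'].
  by apply: Hp; rewrite e e' setIid.
- by [].
- by move=> y Vy; split; [apply: VU|apply: VU'] => p; have [] := Vy p.
Qed.

Lemma Af_open_bigU (I : Type) (f : I -> set Af) :
  (forall i, Af_open (f i)) -> Af_open (\bigcup_i f i).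
Proof.
move=> fo x [i _ /fo[V [Vo Vf Vx Vi]]].
by exists V; split => // y /Vi ?; exists i.
Qed.

HB.instance Definition _ :=
  isOpenTopological.Build Af Af_openT Af_openI Af_open_bigU.

HB.instance Definition _ := @isMeasurable.Build (sigma_display (@open Af)) Af
  <<s @open Af >> (@sigma_algebra0 _ setT _) (@sigma_algebraC _ _)
  (@sigma_algebra_bigcup _ setT _).

Lemma rat_restricted (q : rat) : (fun p => Qp_of_rat p q) \in restricted.
Proof.
apply/asboolP.
have : finite_set ((fun p : prime_nat => sval p) @^-1` `I_(`|denq q|%N.+1)).
  by apply: finite_preimage; [move=> p p' _ _; exact: val_inj|exact: finite_II].
apply: sub_finite_set => p /= nZ; rewrite ltnS leqNgt; apply/negP => qp.
apply: nZ; apply/Qp_abs_pi_le => //; exists 0%N => i _ /=.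
rewrite /padic_abs; case: ifP => // _.
rewrite logn_coprime; last first.
  rewrite prime_coprime ?(valP p)//; apply/negP => /dvdn_leq.
  by rewrite absz_gt0 denq_neq0 leqNgt qp => /(_ isT).
by rewrite expr0 div1r invf_le1 ?exprn_gt0 ?exprn_ege1 ?ltr0n ?ler1n ?prime_gt0 ?(valP p).
Qed.

Definition Af_of_rat (q : rat) : Af := MkAf (rat_restricted q).

Definition Af_frac (x : Af) : rat :=
  xget 0 [set r | 0 <= r < 1 /\ Zhat (x - Af_of_rat r)].

Section fourier.
Variable R : realType.
Local Notation C := R[i].

Definition expi (t : R) : C := (cos t +i* sin t)%C.

Definition chi_infty (x : R) : C := expi (- (2 * pi * x)).

Definition chi_f (x : Af) : C := expi (2 * pi * ratr (Af_frac x)).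

Section L2.
Context d (T : measurableType d) (mu : {measure set T -> \bar R}).
Implicit Types f g : T -> C.

Definition Cintegral f : C :=
  ((\int[mu]_x complex.Re (f x)) +i* (\int[mu]_x complex.Im (f x)))%C.

Definition L2norm f : \bar R := 'N[mu]_2%:E[EFin \o (@Normc.normc R \o f)]%E.

Definition L2 f : Prop :=
  [/\ measurable_fun setT (fun x => complex.Re (f x)),
      measurable_fun setT (fun x => complex.Im (f x)) &
      (L2norm f < +oo)%E].

(* Elements of the Hilbert space are represented by functions, equality being
   almost everywhere. An operator satisfying L2_bounded_operator respects it,
   since its linearity and boundedness force it to map functions that vanish
   almost everywhere to such functions. *)
Definition L2_bounded_operator (F : (T -> C) -> (T -> C)) : Prop :=
  [/\ forall f, L2 f -> L2 (F f),
      forall (a : C) f g, L2 f -> L2 g ->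
        F (fun x => a * f x + g x) = (fun x => a * F f x + F g x) %[ae mu] &
      exists M : R, forall f, L2 f -> (L2norm (F f) <= M%:E * L2norm f)%E].

Definition L2_isometry (F : (T -> C) -> (T -> C)) : Prop :=
  L2_bounded_operator F /\ forall f, L2 f -> L2norm (F f) = L2norm f.

Definition L2_extension (S : set (T -> C)) (F0 : (T -> C) -> (T -> C))
    (F : (T -> C) -> (T -> C)) : Prop :=
  L2_bounded_operator F /\ forall phi, S phi -> F phi = F0 phi %[ae mu].

End L2.

Definition schwartz : set (R -> C) := [set phi : R -> C |
  let smooth_rapid (f : R -> R) :=
    (forall n x, derivable (derive1n n f) x 1) /\
    (forall j k, exists M, forall x, `|x ^+ j * derive1n k f x| <= M) in
  smooth_rapid (fun x => complex.Re (phi x)) /\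
  smooth_rapid (fun x => complex.Im (phi x))].

Definition test_Af : set (Af -> C) := [set phi : Af -> C |
  (forall x, \forall y \near x, phi y = phi x) /\
  compact (closure [set x | phi x != 0])].

(* Since Af is locally compact and second countable, such a measure is
   automatically Radon: regularity need not be required. *)
Definition haar_Af (mu : {measure set Af -> \bar R}) : Prop :=
  (forall (a : Af) (A : set Af), measurable A ->
     mu [set a + x | x in A] = mu A) /\
  mu Zhat = 1%E.

(* In the three definitions below the operator is unique up to almost everywhere
   equality, so the choice made by xget is immaterial; the zero operator stands
   in were there no such operator. *)
Definition fourier_R : (R -> C) -> (R -> C) :=
  xget (fun _ _ => 0) [set F | L2_extension lebesgue_measure schwartz
    (fun phi xi => Cintegral lebesgue_measure
       (fun x => phi x * chi_infty (xi * x))) F].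

Definition fourier_Af (mu : {measure set Af -> \bar R}) :
    (Af -> C) -> (Af -> C) :=
  xget (fun _ _ => 0) [set F | L2_extension mu test_Af
    (fun phi xi => Cintegral mu (fun x => phi x * chi_f (xi * x))) F].

Definition tensor (phi : R -> C) (psi : Af -> C) : R * Af -> C :=
  fun x => phi x.1 * psi x.2.

(* The product sigma-algebra is the Borel sigma-algebra of R * Af, both factors
   being second countable. *)
Definition adele_measure (mu : {sigma_finite_measure set Af -> \bar R}) :
    {measure set (measurableTypeR R * Af) -> \bar R} := (lebesgue_measure \x mu)%E.

Definition fourier_A (mu : {sigma_finite_measure set Af -> \bar R}) :
    (R * Af -> C) -> (R * Af -> C) :=
  xget (fun _ _ => 0) [set F | L2_bounded_operator (adele_measure mu) F /\
    forall phi psi, L2 lebesgue_measure phi -> L2 mu psi ->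
      F (tensor phi psi) = tensor (fourier_R phi) (fourier_Af mu psi)
        %[ae adele_measure mu]].

End fourier.

(* Main.v *)
(* The transforms on R and on Af are two instances of one argument. Let K be a
   symmetric unimodular kernel with K x (- xi) = conj (K x xi), and suppose that
   for some family of sets (the intervals ]a, b], resp. the balls of Af) the
   integral transforms of the indicators have the same inner products as the
   indicators themselves. These indicators span a dense subspace, so the
   transform extends to an isometry F of L2; Fubini's theorem gives the symmetry
   int (F f) g = int f (F g), and testing against the family yields
   F (xi |-> F f (- xi)) = f. On R the inner products reduce to
   int (1 - cos (c x)) / x^2 dx = pi |c|; on Af the transform of the indicator
   of a ball is a character times a multiple of the indicator of the dual ball.
   As Schwartz functions approximate the indicators of intervals in L2, and the
   indicators of balls are test functions, these isometries are the transforms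
   defined by extension from Schwartz, resp. test functions. Finally, tensors
   are total in L2 of the product and their inner products factor, so isometry
   and inversion pass from the factors to the adeles. *)
Require Import Defs.
From mathcomp Require Import all_boot all_order all_algebra.
From mathcomp Require Import generic_quotient ring_quotient complex.
From mathcomp Require Import all_classical all_reals all_analysis.
From mathcomp Require Import measurable_realfun ring lra.

Set Implicit Arguments.
Unset Strict Implicit.
Unset Printing Implicit Defensive.

Import Order.TTheory GRing.Theory Num.Theory.
Import numFieldNormedType.Exports.

Local Open Scope classical_set_scope.
Local Open Scope ring_scope.

(** * L2 spaces of complex functions *)

(** The transform of an interval decays only like [1 / xi], so it is not integrable and inversion
    cannot be read off a second integral. Inversion is therefore tested weakly. Let [J] be the
    reflection. Symmetry of [F] moves one transform across the pairing, [ip (F J F b_i) b_j = int (J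
    F b_i) (F b_j)], and [J F b_i] is the conjugate of [F b_i] because [b_i] is real. The right side
    is then an inner product of two transforms, so the one identity assumed on the family gives both
    isometry and inversion. The integral transform of an integrable function is bounded but not
    known to be square integrable; it is compared with [F f] on sets of finite measure that exhaust
    the space. The transforms of the statement are chosen by [xget]. An operator is first built to
    show that the choice ranges over a nonempty set, and its properties are then carried to the
    chosen operator by uniqueness on a dense family. Functions stand for their classes, so linearity
    and agreement of operators hold almost everywhere only, and real norms replace extended ones
    once membership in [L2] is known. *)

Section complex_parts.
Variable R : realType.
Implicit Types z w : R[i].

Lemma ReD z w : complex.Re (z + w) = complex.Re z + complex.Re w.
Proof. by case: z; case: w. Qed.
Lemma ImD z w : complex.Im (z + w) = complex.Im z + complex.Im w.
Proof. by case: z; case: w. Qed.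
Lemma ReN z : complex.Re (- z) = - complex.Re z.
Proof. by case: z. Qed.
Lemma ImN z : complex.Im (- z) = - complex.Im z.
Proof. by case: z. Qed.
Lemma ReM z w : complex.Re (z * w) =
  complex.Re z * complex.Re w - complex.Im z * complex.Im w.
Proof. by case: z; case: w. Qed.
Lemma ImM z w : complex.Im (z * w) =
  complex.Re z * complex.Im w + complex.Im z * complex.Re w.
Proof. by case: z; case: w. Qed.
Lemma Re_conj z : complex.Re (conjc z) = complex.Re z.
Proof. by case: z. Qed.
Lemma Im_conj z : complex.Im (conjc z) = - complex.Im z.
Proof. by case: z. Qed.
Definition ReImE := (ReD, ImD, ReN, ImN, ReM, ImM, Re_conj, Im_conj).

Lemma conjcM z w : conjc (z * w) = conjc z * conjc w.
Proof. exact: rmorphM. Qed.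

Lemma eq_ReIm z w :
  complex.Re z = complex.Re w -> complex.Im z = complex.Im w -> z = w.
Proof. by case: z; case: w => a b c e /= -> ->. Qed.

(** The squared modulus, kept as a real polynomial in the two parts so that identities and estimates
    are settled by [ring], [lra] and [nra]. *)
Definition normsq z : R := complex.Re z ^+ 2 + complex.Im z ^+ 2.

Lemma normsq_ge0 z : 0 <= normsq z.
Proof. by rewrite addr_ge0// sqr_ge0. Qed.

Lemma normsqM z w : normsq (z * w) = normsq z * normsq w.
Proof. by rewrite /normsq !ReImE; ring. Qed.

Lemma normsq_conj z : normsq (conjc z) = normsq z.
Proof. by rewrite /normsq !ReImE sqrrN. Qed.

Lemma normsqN z : normsq (- z) = normsq z.
Proof. by rewrite /normsq !ReImE !sqrrN. Qed.

Lemma normsq0 : normsq 0 = 0.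
Proof. by rewrite /normsq/= expr0n/= addr0. Qed.

Lemma normsq_eq0 z : normsq z = 0 -> z = 0.
Proof.
move=> /eqP; rewrite paddr_eq0 ?sqr_ge0// !sqrf_eq0 => /andP[/eqP a /eqP b].
exact: eq_ReIm.
Qed.

Lemma normsqD_le z w : normsq (z + w) <= 2 * normsq z + 2 * normsq w.
Proof.
rewrite /normsq !ReImE -subr_ge0.
rewrite (_ : _ - _ = (complex.Re z - complex.Re w) ^+ 2 +
  (complex.Im z - complex.Im w) ^+ 2); last ring.
by rewrite addr_ge0// sqr_ge0.
Qed.

Lemma normsq_Re z : `|complex.Re z| ^+ 2 <= normsq z.
Proof. by rewrite real_normK ?num_real// lerDl sqr_ge0. Qed.

Lemma normsq_Im z : `|complex.Im z| ^+ 2 <= normsq z.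
Proof. by rewrite real_normK ?num_real// lerDr sqr_ge0. Qed.

Lemma mul_conj z : z * conjc z = (normsq z)%:C%C.
Proof. by apply: eq_ReIm; rewrite /normsq !ReImE/=; ring. Qed.

Lemma normsq_real (a : R) : normsq (a%:C%C) = a ^+ 2.
Proof. by rewrite /normsq/= [0 ^+ _]expr0n addr0. Qed.

Lemma normcE z : Normc.normc z = Num.sqrt (normsq z).
Proof. by case: z. Qed.

(** A weak form of [2 |z w| <= |z|^2 + |w|^2]; with [Im_mul_le] it gives the integrable majorant of
    a product of two [L2] functions. *)
Lemma Re_mul_le z w : `|complex.Re (z * w)| <= normsq z + normsq w.
Proof.
rewrite /normsq !ReImE.
move: (complex.Re z) (complex.Im z) (complex.Re w) (complex.Im w) => a b c e.
have := sqr_ge0 (a + c); have := sqr_ge0 (a - c).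
have := sqr_ge0 (b + e); have := sqr_ge0 (b - e).
have := sqr_ge0 a; have := sqr_ge0 b; have := sqr_ge0 c; have := sqr_ge0 e.
by rewrite ler_norml => *; apply/andP; split; nra.
Qed.

Lemma Im_mul_le z w : `|complex.Im (z * w)| <= normsq z + normsq w.
Proof.
rewrite /normsq !ReImE.
move: (complex.Re z) (complex.Im z) (complex.Re w) (complex.Im w) => a b c e.
have := sqr_ge0 (a + e); have := sqr_ge0 (a - e).
have := sqr_ge0 (b + c); have := sqr_ge0 (b - c).
have := sqr_ge0 a; have := sqr_ge0 b; have := sqr_ge0 c; have := sqr_ge0 e.
by rewrite ler_norml => *; apply/andP; split; nra.
Qed.

End complex_parts.

(** * Measurability and integration of complex functions *)

Section complex_integral.
Context d (T : measurableType d) (R : realType) (mu : {measure set T -> \bar R}).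
Implicit Types f g h : T -> R[i].

Definition Cmeasurable f :=
  measurable_fun setT (fun x => complex.Re (f x)) /\
  measurable_fun setT (fun x => complex.Im (f x)).

Lemma CmeasurableD f g : Cmeasurable f -> Cmeasurable g ->
  Cmeasurable (fun x => f x + g x).
Proof.
move=> [f1 f2] [g1 g2]; split.
  under eq_fun do rewrite ReD; exact: measurable_funD.
under eq_fun do rewrite ImD; exact: measurable_funD.
Qed.

Lemma CmeasurableM f g : Cmeasurable f -> Cmeasurable g ->
  Cmeasurable (fun x => f x * g x).
Proof.
move=> [f1 f2] [g1 g2]; split.
  under eq_fun do rewrite ReM; apply: measurable_funB; exact: measurable_funM.
under eq_fun do rewrite ImM; apply: measurable_funD; exact: measurable_funM.
Qed.

Lemma Cmeasurable_conj f : Cmeasurable f -> Cmeasurable (fun x => conjc (f x)).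
Proof.
move=> [f1 f2]; split.
  by under eq_fun do rewrite Re_conj.
by under eq_fun do rewrite Im_conj; exact: measurableT_comp.
Qed.

Lemma Cmeasurable_cst c : Cmeasurable (fun=> c).
Proof. by split; exact: measurable_cst. Qed.

Lemma CmeasurableZ c f : Cmeasurable f -> Cmeasurable (fun x => c * f x).
Proof. by apply: CmeasurableM; exact: Cmeasurable_cst. Qed.

Lemma CmeasurableN f : Cmeasurable f -> Cmeasurable (fun x => - f x).
Proof.
by move=> /(CmeasurableZ (-1)); congr Cmeasurable; apply/funext => x; rewrite mulN1r.
Qed.

Lemma CmeasurableB f g : Cmeasurable f -> Cmeasurable g ->
  Cmeasurable (fun x => f x - g x).
Proof. by move=> mf mg; apply: CmeasurableD => //; exact: CmeasurableN. Qed.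

Lemma Cmeasurable_real (u : T -> R) :
  measurable_fun setT u -> Cmeasurable (fun x => (u x)%:C%C).
Proof. by move=> mu'; split => //; exact: measurable_cst. Qed.

Lemma measurable_normsq f : Cmeasurable f ->
  measurable_fun setT (fun x => normsq (f x)).
Proof. by move=> [f1 f2]; apply: measurable_funD; exact: measurable_funX. Qed.

Definition Cintegrable f :=
  mu.-integrable setT (EFin \o (fun x => complex.Re (f x))) /\
  mu.-integrable setT (EFin \o (fun x => complex.Im (f x))).

Lemma integrable_dom (u v : T -> R) : measurable_fun setT u ->
  (forall x, `|u x| <= v x) -> mu.-integrable setT (EFin \o v) ->
  mu.-integrable setT (EFin \o u).
Proof.
move=> mu' uv iv; apply: le_integrable iv => //.
  exact/measurable_EFinP.
by move=> x _ /=; rewrite lee_fin (le_trans (uv x))// ler_norm.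
Qed.

Lemma Cintegrable_Cmeasurable f : Cintegrable f -> Cmeasurable f.
Proof.
by move=> [/measurable_int/measurable_EFinP ? /measurable_int/measurable_EFinP ?].
Qed.

Lemma Cintegrable_dom f (v : T -> R) : Cmeasurable f ->
  (forall x, `|complex.Re (f x)| <= v x) ->
  (forall x, `|complex.Im (f x)| <= v x) ->
  mu.-integrable setT (EFin \o v) -> Cintegrable f.
Proof. by move=> [f1 f2] h1 h2 iv; split; exact: integrable_dom iv. Qed.

Lemma Rintegrable_lin (u v : T -> R) (a b : R) :
  mu.-integrable setT (EFin \o u) -> mu.-integrable setT (EFin \o v) ->
  mu.-integrable setT (EFin \o (fun x => a * u x + b * v x)).
Proof.
move=> iu iv; have h := integrableD measurableT (integrableZl measurableT a iu)
  (integrableZl measurableT b iv).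
by apply: eq_integrable h => //.
Qed.

Lemma RintegralZD (u v : T -> R) (a b : R) :
  mu.-integrable setT (EFin \o u) -> mu.-integrable setT (EFin \o v) ->
  \int[mu]_x (a * u x + b * v x) = a * \int[mu]_x u x + b * \int[mu]_x v x.
Proof.
move=> iu iv; rewrite RintegralD//=; last 2 first.
- have h := integrableZl measurableT a iu; exact: eq_integrable h.
- have h := integrableZl measurableT b iv; exact: eq_integrable h.
by rewrite !RintegralZl.
Qed.

Lemma CintegrableZ c f : Cintegrable f -> Cintegrable (fun x => c * f x).
Proof.
move=> [f1 f2]; split.
  apply: eq_integrable (Rintegrable_lin (complex.Re c) (- complex.Im c) f1 f2) => // x _ /=.
  by rewrite ReM mulNr.
apply: eq_integrable (Rintegrable_lin (complex.Im c) (complex.Re c) f1 f2) => // x _ /=.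
by rewrite ImM addrC.
Qed.

Lemma CintegralD f g : Cintegrable f -> Cintegrable g ->
  Cintegral mu (fun x => f x + g x) = Cintegral mu f + Cintegral mu g.
Proof.
move=> [f1 f2] [g1 g2]; apply: eq_ReIm; rewrite !ReImE/=.
  by under eq_Rintegral do rewrite ReD; rewrite RintegralD.
by under eq_Rintegral do rewrite ImD; rewrite RintegralD.
Qed.

Lemma CintegralZ c f : Cintegrable f ->
  Cintegral mu (fun x => c * f x) = c * Cintegral mu f.
Proof.
move=> [f1 f2]; apply: eq_ReIm; rewrite !ReImE/=.
  by under eq_Rintegral do rewrite ReM -mulNr; rewrite RintegralZD// mulNr.
by under eq_Rintegral do rewrite ImM; rewrite addrC [RHS]addrC -RintegralZD//;
   apply: eq_Rintegral => x _; rewrite addrC.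
Qed.

Lemma Cintegral_conj f : Cintegrable f ->
  Cintegral mu (fun x => conjc (f x)) = conjc (Cintegral mu f).
Proof.
move=> [f1 f2]; apply: eq_ReIm; rewrite !ReImE/=.
  by under eq_Rintegral do rewrite Re_conj.
by under eq_Rintegral do rewrite Im_conj -mulN1r; rewrite RintegralZl// mulN1r.
Qed.

Lemma Rintegral_ae (u v : T -> R) : measurable_fun setT u ->
  measurable_fun setT v -> u = v %[ae mu] -> \int[mu]_x u x = \int[mu]_x v x.
Proof.
move=> mu' mv uv; rewrite /Rintegral; congr fine; apply: ae_eq_integral => //.
- exact/measurable_EFinP.
- exact/measurable_EFinP.
- by apply: filterS uv => x /= e _; rewrite e.
Qed.

Lemma Cintegral_ae f g : Cmeasurable f -> Cmeasurable g -> f = g %[ae mu] ->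
  Cintegral mu f = Cintegral mu g.
Proof.
move=> [f1 f2] [g1 g2] fg; apply: eq_ReIm => /=; apply: Rintegral_ae => //.
  by apply: filterS fg => x /= e Dx; rewrite e.
by apply: filterS fg => x /= e Dx; rewrite e.
Qed.

Lemma eq_Cintegral f g : f =1 g -> Cintegral mu f = Cintegral mu g.
Proof. by move=> /funext ->. Qed.

End complex_integral.
Arguments integrable_dom {d T R mu u} v.
Arguments Cintegrable_dom {d T R mu f} v.

(** * Norm and inner product on L2 *)

Section L2_space.
Context d (T : measurableType d) (R : realType) (mu : {measure set T -> \bar R}).
Implicit Types f g h : T -> R[i].

Lemma L2norm_integral f :
  L2norm mu f = ((\int[mu]_x (normsq (f x))%:E) `^ 2^-1)%E.
Proof.
rewrite /L2norm unlock; congr poweR; apply: eq_integral => x _ /=.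
rewrite normcE powR_mulrn ?normr_ge0//.
by rewrite real_normK ?num_real// sqr_sqrtr// normsq_ge0.
Qed.

Lemma L2P f : L2 mu f <-> Cmeasurable f /\
  mu.-integrable setT (EFin \o (fun x => normsq (f x))).
Proof.
have absE : (\int[mu]_x `|(EFin \o (fun x => normsq (f x))) x| =
             \int[mu]_x (normsq (f x))%:E)%E.
  by apply: eq_integral => x _ /=; rewrite ger0_norm// normsq_ge0.
split=> [[f1 f2]|[mf /integrableP[_]]].
  rewrite L2norm_integral => foo; split => //; apply/integrableP; split.
    by apply/measurable_EFinP; exact: measurable_normsq.
  rewrite absE; move: foo.
  have : (0 <= \int[mu]_x (normsq (f x))%:E)%E.
    by apply: integral_ge0 => x _; rewrite lee_fin normsq_ge0.
  case: (\int[mu]_x (normsq (f x))%:E)%E => [r _ _|_|//]; first by rewrite ltry.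
  by rewrite poweRyr ?invr_neq0// ltxx.
rewrite absE => foo; case: mf => f1 f2; split => //; rewrite L2norm_integral.
by rewrite poweR_lty.
Qed.

(** The real integral sends an infinite value to 0, so [nsq], and with it [nrm], is meaningful on
    [L2] only. There it agrees with the extended norm, by [L2norm_nrm]. *)
Definition nsq f : R := \int[mu]_x normsq (f x).

Lemma L2_Cmeasurable f : L2 mu f -> Cmeasurable f.
Proof. by move=> /L2P[]. Qed.

Lemma L2_integrable f : L2 mu f ->
  mu.-integrable setT (EFin \o (fun x => normsq (f x))).
Proof. by move=> /L2P[]. Qed.

Lemma nsq_ge0 f : 0 <= nsq f.
Proof. by apply: Rintegral_ge0 => x _; exact: normsq_ge0. Qed.

Lemma nsq_integral f : L2 mu f ->
  (\int[mu]_x (normsq (f x))%:E = (nsq f)%:E)%E.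
Proof.
by move=> /L2_integrable fi; rewrite /nsq /Rintegral fineK//; exact: integrable_fin_num.
Qed.

Definition nrm f : R := Num.sqrt (nsq f).

Lemma nrm_ge0 f : 0 <= nrm f. Proof. exact: sqrtr_ge0. Qed.

Lemma L2norm_nrm f : L2 mu f -> L2norm mu f = (nrm f)%:E.
Proof.
by move=> fL; rewrite L2norm_integral nsq_integral// poweR_EFin powR12_sqrt// nsq_ge0.
Qed.

Lemma L2_dom f (v : T -> R) : Cmeasurable f -> (forall x, normsq (f x) <= v x) ->
  mu.-integrable setT (EFin \o v) -> L2 mu f.
Proof.
move=> mf fv vi; apply/L2P; split => //; apply: integrable_dom vi => //.
  exact: measurable_normsq.
by move=> x; rewrite ger0_norm ?normsq_ge0.
Qed.

Lemma L2D f g : L2 mu f -> L2 mu g -> L2 mu (fun x => f x + g x).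
Proof.
move=> /L2P[mf fi] /L2P[mg gi].
apply: (L2_dom _ _ (Rintegrable_lin 2 2 fi gi)) => [|x].
  exact: CmeasurableD.
exact: normsqD_le.
Qed.

Lemma L2Z c f : L2 mu f -> L2 mu (fun x => c * f x).
Proof.
move=> /L2P[mf fi]; apply: (L2_dom _ _ (Rintegrable_lin (normsq c) 0 fi fi)) => [|x].
  exact: CmeasurableZ.
by rewrite mul0r addr0 normsqM.
Qed.

Lemma L2N f : L2 mu f -> L2 mu (fun x => - f x).
Proof. by move=> /(L2Z (-1)); under eq_fun do rewrite mulN1r. Qed.

Lemma L2B f g : L2 mu f -> L2 mu g -> L2 mu (fun x => f x - g x).
Proof. by move=> fL gL; apply: L2D => //; exact: L2N. Qed.

Lemma L2_0 : L2 mu (fun=> 0).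
Proof.
apply: (L2_dom _ _ (integrable0 mu setT)); first exact: Cmeasurable_cst.
by move=> x; rewrite normsq0.
Qed.

Lemma L2_conj f : L2 mu f -> L2 mu (fun x => conjc (f x)).
Proof.
move=> /L2P[mf fi]; apply: (L2_dom _ _ fi) => [|x]; first exact: Cmeasurable_conj.
by rewrite normsq_conj.
Qed.

Lemma Cintegrable_mul f g : L2 mu f -> L2 mu g ->
  Cintegrable mu (fun x => f x * g x).
Proof.
move=> /L2P[mf fi] /L2P[mg gi].
apply: (Cintegrable_dom _ _ _ _ (Rintegrable_lin 1 1 fi gi)) => [|x|x].
- exact: CmeasurableM.
- by rewrite !mul1r Re_mul_le.
- by rewrite !mul1r Im_mul_le.
Qed.

Definition ip f g : R[i] := Cintegral mu (fun x => f x * conjc (g x)).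

Lemma Cintegrable_ip f g : L2 mu f -> L2 mu g ->
  Cintegrable mu (fun x => f x * conjc (g x)).
Proof. by move=> fL gL; apply: Cintegrable_mul => //; exact: L2_conj. Qed.

Lemma ip_nsq f : ip f f = (nsq f)%:C%C.
Proof.
apply: eq_ReIm; rewrite /ip/nsq/=; first by apply: eq_Rintegral => x _; rewrite mul_conj.
by under eq_Rintegral do rewrite mul_conj/=; rewrite Rintegral_cst// mul0r.
Qed.

Lemma ip0r f : ip f (fun=> 0) = 0.
Proof.
rewrite /ip (_ : (fun x => f x * _) = (fun=> 0)); last first.
  by apply/funext => x; rewrite conjc0 mulr0.
by rewrite /Cintegral/= !Rintegral_cst// !mul0r.
Qed.

Lemma ip_linl c f g h : L2 mu f -> L2 mu g -> L2 mu h ->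
  ip (fun x => c * f x + g x) h = c * ip f h + ip g h.
Proof.
move=> fL gL hL; rewrite /ip -CintegralZ; last exact: Cintegrable_ip.
rewrite -CintegralD; last 2 first.
- by apply: CintegrableZ; exact: Cintegrable_ip.
- exact: Cintegrable_ip.
by apply: eq_Cintegral => x; rewrite mulrDl mulrA.
Qed.

Lemma ip_conj f g : L2 mu f -> L2 mu g -> ip g f = conjc (ip f g).
Proof.
move=> fL gL; rewrite /ip -Cintegral_conj; last exact: Cintegrable_ip.
by apply: eq_Cintegral => x; rewrite rmorphM/= conjcK mulrC.
Qed.

Lemma ip_linr c f g h : L2 mu f -> L2 mu g -> L2 mu h ->
  ip h (fun x => c * f x + g x) = conjc c * ip h f + ip h g.
Proof.
move=> fL gL hL; rewrite ip_conj//; last by apply: L2D => //; exact: L2Z.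
by rewrite ip_linl// rmorphD rmorphM/= (ip_conj fL hL) (ip_conj gL hL).
Qed.

Lemma nsqZ c f : L2 mu f -> nsq (fun x => c * f x) = normsq c * nsq f.
Proof.
move=> /L2_integrable fi; rewrite /nsq.
by under eq_Rintegral do rewrite normsqM; rewrite RintegralZl.
Qed.

Lemma nsqD f g : L2 mu f -> L2 mu g ->
  nsq (fun x => f x + g x) = nsq f + nsq g + 2 * complex.Re (ip f g).
Proof.
move=> fL gL; apply: (@complexI R).
rewrite -ip_nsq (_ : (fun x => f x + g x) = (fun x => 1 * f x + g x)); last first.
  by apply/funext => x; rewrite mul1r.
have fgL : L2 mu (fun x => 1 * f x + g x) by apply: L2D => //; exact: L2Z.
rewrite ip_linl// !ip_linr// (ip_conj fL gL) !ip_nsq.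
by move: (ip f g) => [a b]; apply: eq_ReIm; rewrite !ReImE/=; ring.
Qed.

Lemma nsqN f : nsq (fun x => - f x) = nsq f.
Proof. by rewrite /nsq; apply: eq_Rintegral => x _; rewrite normsqN. Qed.

Lemma nrmN f : nrm (fun x => - f x) = nrm f.
Proof. by rewrite /nrm nsqN. Qed.

Lemma nsq_conj f : nsq (fun x => conjc (f x)) = nsq f.
Proof. by rewrite /nsq; apply: eq_Rintegral => x _; rewrite normsq_conj. Qed.

Lemma nrm_swap f g : nrm (fun x => f x - g x) = nrm (fun x => g x - f x).
Proof. by rewrite -nrmN; congr nrm; apply/funext => x; rewrite opprB. Qed.

Lemma nrmZ c f : L2 mu f -> nrm (fun x => c * f x) = Num.sqrt (normsq c) * nrm f.
Proof. by move=> fL; rewrite /nrm nsqZ// sqrtrM// normsq_ge0. Qed.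

Lemma sqr_nrm f : nrm f ^+ 2 = nsq f.
Proof. by rewrite sqr_sqrtr// nsq_ge0. Qed.

(* Cauchy-Schwarz, from the discriminant of [t |-> nsq (f + t g)] evaluated at
   its minimiser *)
Lemma Re_ip_le f g : L2 mu f -> L2 mu g -> complex.Re (ip f g) <= nrm f * nrm g.
Proof.
move=> fL gL; have H (t : R) : 0 <= nsq g * t ^+ 2 + 2 * t * complex.Re (ip f g) + nsq f.
  have tgL := L2Z (t%:C%C) gL.
  have := nsq_ge0 (fun x => f x + t%:C%C * g x).
  rewrite nsqD// nsqZ// normsq_real.
  have -> : ip f (fun x => t%:C%C * g x) = t%:C%C * ip f g.
    have := ip_linr (t%:C%C) gL L2_0 fL.
    rewrite ip0r.
    rewrite addr0 (_ : (fun x => t%:C%C * g x + 0) = (fun x => t%:C%C * g x)); last first.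
      by apply/funext => x; rewrite addr0.
    by rewrite conjc_real.
  by rewrite ReM/= mul0r subr0; lra.
have [g0|g0] := eqVneq (nsq g) 0.
  rewrite [nrm g]/nrm g0 sqrtr0 mulr0 leNgt; apply/negP => r0.
  (* For [nsq g = 0] the quadratic has degree one in [t]; at this [t] it takes the value -1. *)
  move: H r0 => /(_ (- (nsq f + 1) / (2 * complex.Re (ip f g)))).
  rewrite g0 mul0r add0r; set r := complex.Re _ => H r0.
  move: H; rewrite (_ : 2 * _ * r = - (nsq f + 1)); last first.
    by field; rewrite gt_eqF.
  by move=> ?; lra.
rewrite (le_trans (ler_norm _))// -sqrtr_sqr -sqrtrM ?nsq_ge0// ler_wsqrtr//.
have gp : 0 < nsq g by rewrite lt0r g0 nsq_ge0.
move: H => /(_ (- complex.Re (ip f g) / nsq g)).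
set r := complex.Re _ => H.
rewrite -subr_ge0 (_ : _ - _ = nsq g * (nsq g * (- r / nsq g) ^+ 2 +
  2 * (- r / nsq g) * r + nsq f)); first by rewrite mulr_ge0// nsq_ge0.
by field.
Qed.

Lemma nrmD f g : L2 mu f -> L2 mu g -> nrm (fun x => f x + g x) <= nrm f + nrm g.
Proof.
move=> fL gL; rewrite -(ler_pXn2r (n := 2))// ?nnegrE ?addr_ge0 ?nrm_ge0//.
rewrite sqr_nrm nsqD// sqrrD !sqr_nrm; have := Re_ip_le fL gL.
by rewrite -mulr_natl; lra.
Qed.

Lemma nrm_dist f g h : L2 mu f -> L2 mu g -> L2 mu h ->
  nrm (fun x => f x - h x) <= nrm (fun x => f x - g x) + nrm (fun x => g x - h x).
Proof.
move=> fL gL hL; have := nrmD (L2B fL gL) (L2B gL hL).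
by under [X in nrm X <= _ -> _]eq_fun do rewrite addrA subrK.
Qed.

Lemma L2_ae f g : L2 mu f -> Cmeasurable g -> f = g %[ae mu] -> L2 mu g.
Proof.
move=> [f1 f2 fo] [g1 g2] fg; split => //; move: fo; rewrite !L2norm_integral.
rewrite (ge0_ae_eq_integral _ _ _ _ _ (g := fun x => (normsq (g x))%:E))//.
- by apply/measurable_EFinP; exact: measurable_normsq.
- by apply/measurable_EFinP; exact: measurable_normsq.
- by move=> x _; rewrite lee_fin normsq_ge0.
- by move=> x _; rewrite lee_fin normsq_ge0.
- by apply: filterS fg => x /= e Dx; rewrite e.
Qed.

Lemma nsq_ae f g : L2 mu f -> L2 mu g -> f = g %[ae mu] -> nsq f = nsq g.
Proof.
move=> /L2P[mf _] /L2P[mg _] fg; apply: Rintegral_ae; try exact: measurable_normsq.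
by apply: filterS fg => x /= e Dx; rewrite e.
Qed.

Lemma nrm_ae f g : L2 mu f -> L2 mu g -> f = g %[ae mu] -> nrm f = nrm g.
Proof. by move=> fL gL fg; rewrite /nrm (nsq_ae fL gL fg). Qed.

Lemma ip_ae f f' g g' : L2 mu f -> L2 mu f' -> L2 mu g -> L2 mu g' ->
  f = f' %[ae mu] -> g = g' %[ae mu] -> ip f g = ip f' g'.
Proof.
move=> /L2P[mf _] /L2P[mf' _] /L2P[mg _] /L2P[mg' _] ff gg.
apply: Cintegral_ae; try by apply: CmeasurableM => //; exact: Cmeasurable_conj.
by apply: filterS2 ff gg => x /= e1 e2 Dx; rewrite e1// e2.
Qed.

Lemma nsq_eq0 f : L2 mu f -> nsq f = 0 -> f = (fun=> 0) %[ae mu].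
Proof.
move=> fL f0; have mf := L2_Cmeasurable fL.
have /(ae_eq_integral_abs mu measurableT) : measurable_fun setT (fun x => (normsq (f x))%:E).
  by apply/measurable_EFinP; exact: measurable_normsq.
move=> [+ _]; rewrite (_ : integral _ _ _ = 0%E).
  move=> /(_ erefl); apply: filterS => x /= + _ => /(_ I)[].
  exact: normsq_eq0.
by under eq_integral do rewrite /= ger0_norm ?normsq_ge0//; rewrite nsq_integral// f0.
Qed.

Lemma nrm_sub_eq0 f g : L2 mu f -> L2 mu g -> nrm (fun x => f x - g x) = 0 ->
  f = g %[ae mu].
Proof.
move=> fL gL /eqP; rewrite sqrtr_eq0 => n0.
have /nsq_eq0 : L2 mu (fun x => f x - g x) by exact: L2B.
move=> -[|N [mN N0 sN]]; first by apply/eqP; rewrite eq_le n0 nsq_ge0.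
exists N; split => // x /= H; apply: sN => /= H'; apply: H => _.
by apply/eqP; rewrite -subr_eq0; apply/eqP; exact: H'.
Qed.

Lemma ae_nrm_sub f g : L2 mu f -> L2 mu g -> f = g %[ae mu] ->
  nrm (fun x => f x - g x) = 0.
Proof.
move=> fL gL fg; rewrite (nrm_ae (g := fun=> 0)) /nrm.
- by rewrite /nsq; under eq_Rintegral do rewrite normsq0; rewrite Rintegral_cst// mul0r sqrtr0.
- exact: L2B.
- exact: L2_0.
- by apply: filterS fg => x /= e Dx; rewrite e// subrr.
Qed.

End L2_space.
Arguments L2_dom {d T R mu f} v.

(** * Completeness of L2 *)

Section L2_complete.
Context d (T : measurableType d) (R : realType) (mu : {measure set T -> \bar R}).
Implicit Types f g h : T -> R[i].

Lemma sum_half_le (K : R) n : 0 <= K -> \sum_(0 <= i < n) K / 2 ^+ i <= 2 * K.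
Proof.
move=> K0; have -> : \sum_(0 <= i < n) K / 2 ^+ i = 2 * K - 2 * K / 2 ^+ n.
  elim: n => [|n IH]; first by rewrite big_nil expr0 divr1 subrr.
  by rewrite big_nat_recr//= IH exprS; field; rewrite expf_neq0.
by rewrite gerBl divr_ge0 ?exprn_ge0// mulr_ge0.
Qed.

(* Summability of the weighted integrals forces the weighted values to be
   bounded at almost every point. *)
Lemma ae_bounded_of_integral (D : nat -> T -> R) (K : R) :
  (forall n, measurable_fun setT (D n)) -> (forall n x, 0 <= D n x) ->
  (forall n, (\int[mu]_x (D n x)%:E <= (K / 8 ^+ n)%:E)%E) ->
  {ae mu, forall x, exists M : R, forall n, D n x <= M / 4 ^+ n}.
Proof.
(* The factor [4 ^+ n] leaves integrals at most [K / 2 ^+ n], whose sum is finite; where the series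
   of the [f n x] is finite, its sum bounds every term. *)
move=> mD D0 DK; pose f n x := (4 ^+ n * D n x)%:E : \bar R.
have mf n : measurable_fun setT (f n).
  by apply/measurable_EFinP; exact: measurable_funM.
have f0 n x : setT x -> (0 <= f n x)%E.
  by move=> _; rewrite lee_fin mulr_ge0.
have K0 : 0 <= K.
  have := DK 0%N; rewrite expr0 divr1 -lee_fin; apply: le_trans.
  by apply: integral_ge0 => x _; rewrite lee_fin.
have fi n : (\int[mu]_x f n x <= (K / 2 ^+ n)%:E)%E.
  under eq_integral do rewrite /f EFinM.
  rewrite ge0_integralZl//; last 2 first.
    - exact/measurable_EFinP.
    - by move=> x _; rewrite lee_fin.
  apply: (le_trans (lee_wpmul2l _ (DK n))) => //.
  rewrite -EFinM lee_fin (_ : 8 = 4 * 2)// ?exprMn; last by rewrite -natrM.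
  by rewrite le_eqVlt; apply/orP; left; apply/eqP; field; rewrite !expf_neq0.
have /integrable_ae : mu.-integrable setT (fun x => (\sum_(0 <= n <oo) f n x)%E).
  apply/integrableP; split; first by apply: ge0_emeasurable_sum => // n x _ _; exact: f0.
  under eq_integral => x _.
    rewrite gee0_abs; last by apply: nneseries_ge0 => n _ _; exact: f0.
    over.
  rewrite integral_nneseries//.
  apply: (@le_lt_trans _ _ (2 * K)%:E); last by rewrite ltry.
  apply: lime_le.
    by apply: is_cvg_nneseries => n _ _; apply: integral_ge0 => x _; exact: f0.
  apply: nearW => n; apply: (@le_trans _ _ (\sum_(0 <= i < n) (K / 2 ^+ i)%:E)%E).
    exact: lee_sum.
  by rewrite sumEFin lee_fin sum_half_le.
move=> /(_ measurableT); apply: filterS => x /(_ I) fin.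
exists (fine (\sum_(0 <= n <oo) f n x)%E) => n.
rewrite ler_pdivlMr ?exprn_gt0// mulrC -lee_fin fineK//.
have := @nneseries_lim_ge R (f ^~ x) xpredT 0 n.+1 (fun k _ _ => f0 k x I).
apply: le_trans; rewrite big_nat_recr//= leeDr//; apply: sume_ge0 => k _; exact: f0.
Qed.

(** The increments are at most [sqrt M / 2 ^+ n], so the telescoping series converges absolutely.
    The hypothesis is on squares because the increments to be treated are parts of complex numbers
    controlled by [normsq]. *)
Lemma cvg_of_geometric (u : R^nat) (M : R) :
  (forall n, (u n.+1 - u n) ^+ 2 <= M / 4 ^+ n) -> cvgn u.
Proof.
move=> uM; have M0 : 0 <= M.
  by have := uM 0%N; rewrite expr0 divr1; apply: le_trans; exact: sqr_ge0.
have h n : `|u n.+1 - u n| <= geometric (Num.sqrt M) (2^-1) n.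
  rewrite /= -(ler_pXn2r (n := 2))// ?nnegrE ?mulr_ge0 ?sqrtr_ge0 ?exprn_ge0 ?invr_ge0//.
  rewrite real_normK ?num_real// exprMn sqr_sqrtr// -exprM mulnC exprM exprVn.
  by rewrite exprVn (_ : 2 ^+ 2 = 4)// -natrX.
have : cvgn (series (telescope u)).
  apply: normed_cvg.
  apply: (@series_le_cvg _ _ (geometric (Num.sqrt M) (2^-1))) => [n|n||]; [exact: normr_ge0| |exact: h|].
    by rewrite /= mulr_ge0 ?sqrtr_ge0 ?exprn_ge0 ?invr_ge0.
  by apply: is_cvg_geometric_series; rewrite ger0_norm ?invr_ge0// invf_lt1// ltr1n.
rewrite telescopeK => /cvg_ex[l ul]; apply/cvg_ex; exists (l + u 0%N).
have : (u n - u 0%N + u 0%N) @[n --> \oo] --> l + u 0%N.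
  by apply: cvgD => //; exact: cvg_cst.
by under eq_fun do rewrite subrK.
Qed.

Lemma limn_esup_EFin (u : R^nat) l : u @ \oo --> l -> fine (limn_esup (EFin \o u)) = l.
Proof.
move=> ul; have eul : (EFin \o u) @ \oo --> l%:E.
  by apply/fine_cvgP; split; [exact: nearW|].
by rewrite is_cvg_limn_esupE ?(cvg_lim _ eul)//; apply/cvg_ex; exists l%:E.
Qed.

(** Fatou's lemma for [normsq (s n x - h x)]. The conclusion bounds the extended integral because
    [g] is not yet known to lie in [L2], so that [nsq] could hide an infinite value. *)
Lemma nsq_le_limit (s : nat -> T -> R[i]) g h (K : R) :
  (forall n, L2 mu (s n)) -> Cmeasurable g -> L2 mu h ->
  {ae mu, forall x, (fun n => complex.Re (s n x)) @ \oo --> complex.Re (g x) /\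
                    (fun n => complex.Im (s n x)) @ \oo --> complex.Im (g x)} ->
  (\forall n \near \oo, nsq mu (fun x => s n x - h x) <= K) ->
  (\int[mu]_x (normsq (g x - h x))%:E <= K%:E)%E.
Proof.
move=> sL mg hL sg sK.
have mh := L2_Cmeasurable hL; have ms n := L2_Cmeasurable (sL n).
pose F n x := (normsq (s n x - h x))%:E.
have mF n : measurable_fun setT (F n).
  by apply/measurable_EFinP; apply: measurable_normsq; exact: CmeasurableB.
have -> : (\int[mu]_x (normsq (g x - h x))%:E = \int[mu]_x limn_einf (F ^~ x))%E.
  apply: ae_eq_integral => //.
  - by apply/measurable_EFinP; apply: measurable_normsq; exact: CmeasurableB.
  - apply: (emeasurable_fun_cvg (fun n x => einfs (F ^~ x) n)).
      exact: measurable_fun_einfs.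
    by move=> x _; rewrite limn_einf_lim; exact: is_cvg_einfs.
  apply: filterS sg => x /= [cr ci] _.
  have cF : (F ^~ x) @ \oo --> (normsq (g x - h x))%:E.
    apply/fine_cvgP; split; first exact: nearW.
    rewrite /F/= /normsq !ReImE.
    under [X in X @ _ --> _]eq_fun do rewrite /= !ReImE.
    by apply: cvgD; rewrite expr2; under [X in X @ _ --> _]eq_fun do rewrite expr2;
      apply: cvgM; apply: cvgD => //; exact: cvg_cst.
  by rewrite is_cvg_limn_einfE ?(cvg_lim _ cF)//; apply/cvg_ex; eexists; exact: cF.
apply: (le_trans (fatou mu measurableT mF _)).
  by move=> n x _; rewrite lee_fin normsq_ge0.
rewrite limn_einf_lim; apply: lime_le; first exact: is_cvg_einfs.
move: sK => [N _ sK]; apply: nearW => n.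
apply: ge_ereal_inf; exists (\int[mu]_x F (maxn N n) x)%E.
  by exists (maxn N n) => //=; exact: leq_maxr.
rewrite nsq_integral; last exact: L2B.
by rewrite lee_fin; apply: sK; exact: leq_maxl.
Qed.

(** Riesz-Fischer for sequences that are Cauchy at the rate [4 ^- n]. Squared, this rate is below
    the [8 ^- n] that [ae_bounded_of_integral] asks for, so the sequence itself converges almost
    everywhere and no subsequence is extracted. *)
Lemma L2_complete (s : nat -> T -> R[i]) (K : R) : (forall n, L2 mu (s n)) ->
  (forall n m, (n <= m)%N -> nrm mu (fun x => s m x - s n x) <= K / 4 ^+ n) ->
  exists g, L2 mu g /\ forall n, nrm mu (fun x => g x - s n x) <= K / 4 ^+ n.
Proof.
move=> sL sK; have ms n := L2_Cmeasurable (sL n).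
have K0 : 0 <= K.
  by have := sK 0%N 0%N isT; rewrite expr0 divr1; apply: le_trans; exact: nrm_ge0.
have sK2 n m : (n <= m)%N -> nsq mu (fun x => s m x - s n x) <= (K / 4 ^+ n) ^+ 2.
  move=> /sK h; rewrite -sqr_nrm.
  by rewrite ler_pXn2r// nnegrE ?nrm_ge0// divr_ge0// exprn_ge0.
have : {ae mu, forall x, exists M : R, forall n,
    normsq (s n.+1 x - s n x) <= M / 4 ^+ n}.
  apply: (@ae_bounded_of_integral _ (K ^+ 2)).
  - by move=> n; apply: measurable_normsq; exact: CmeasurableB.
  - by move=> n x; exact: normsq_ge0.
  - move=> n; rewrite nsq_integral; last exact: L2B.
    rewrite lee_fin (le_trans (sK2 _ _ (leqnSn n)))// exprMn ler_wpM2l ?sqr_ge0//.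
    rewrite exprVn lef_pV2 ?posrE ?exprn_gt0//.
    rewrite -exprM mulnC exprM; apply: lerXn2r; rewrite ?nnegrE ?exprn_ge0//.
    by rewrite -natrX ler_nat.
move=> sM.
(* The upper limit is defined and measurable also where the sequence diverges; almost everywhere it
   is the limit. *)
pose g x := (fine (limn_esup (EFin \o (fun n => complex.Re (s n x)))) +i*
             fine (limn_esup (EFin \o (fun n => complex.Im (s n x)))))%C.
have mg : Cmeasurable g.
  split => /=.
    apply: (measurableT_comp (fine_measurable measurableT)).
    by apply: measurable_fun_limn_esup => n; apply/measurable_EFinP; have [] := ms n.
  apply: (measurableT_comp (fine_measurable measurableT)).
  by apply: measurable_fun_limn_esup => n; apply/measurable_EFinP; have [] := ms n.
have sg : {ae mu, forall x, (fun n => complex.Re (s n x)) @ \oo --> complex.Re (g x) /\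
                    (fun n => complex.Im (s n x)) @ \oo --> complex.Im (g x)}.
  apply: filterS sM => x [M xM].
  have c1 : cvgn (fun n => complex.Re (s n x)).
    apply: (@cvg_of_geometric _ M) => n; apply: le_trans (xM n).
    by rewrite -ReN -ReD lerDl sqr_ge0.
  have c2 : cvgn (fun n => complex.Im (s n x)).
    apply: (@cvg_of_geometric _ M) => n; apply: le_trans (xM n).
    by rewrite -ImN -ImD lerDr sqr_ge0.
  by rewrite /= (limn_esup_EFin c1) (limn_esup_EFin c2).
have gs n : (\int[mu]_x (normsq (g x - s n x))%:E <= ((K / 4 ^+ n) ^+ 2)%:E)%E.
  apply: (nsq_le_limit sL) => //.
  by exists n => // m /= nm; exact: sK2.
have gL n : L2 mu (fun x => g x - s n x).
  apply/L2P; split; first exact: CmeasurableB.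
  apply/integrableP; split.
    by apply/measurable_EFinP; apply: measurable_normsq; exact: CmeasurableB.
  under eq_integral do rewrite /= ger0_norm ?normsq_ge0//.
  by rewrite (le_lt_trans (gs n))// ltry.
exists g; split.
  by have := L2D (gL 0%N) (sL 0%N); under eq_fun do rewrite subrK.
move=> n; rewrite -(ler_pXn2r (n := 2))// ?nnegrE ?nrm_ge0 ?divr_ge0 ?exprn_ge0//.
by rewrite sqr_nrm -lee_fin -nsq_integral.
Qed.

End L2_complete.

Lemma le0_of_le_eps (R : realType) (x K : R) :
  (forall e, 0 < e -> x <= K * e) -> x <= 0.
Proof.
move=> H; rewrite leNgt; apply/negP => x0.
have K1 : 0 < 2 * (`|K| + 1) by rewrite mulr_gt0// ltr_wpDl.
have := H (x / (2 * (`|K| + 1))) (divr_gt0 x0 K1); apply/negP; rewrite -ltNge.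
rewrite mulrA ltr_pdivrMr// mulrC ltr_pM2l//.
by have := ler_norm K; have := normr_ge0 K; lra.
Qed.

(** * Linear combinations, closures and bounded operators *)

Section L2_operators.
Context d (T : measurableType d) (R : realType) (mu : {measure set T -> \bar R}).
Implicit Types f g h : T -> R[i].

Lemma nrm0 : nrm mu (fun=> 0) = 0.
Proof.
rewrite /nrm /nsq; under eq_Rintegral do rewrite normsq0.
by rewrite Rintegral_cst// mul0r sqrtr0.
Qed.

Lemma nrm_subxx f : nrm mu (fun x => f x - f x) = 0.
Proof. by under eq_fun do rewrite subrr; exact: nrm0. Qed.

Definition lcomb (I : Type) (b : I -> T -> R[i]) (l : seq (R[i] * I)) : T -> R[i] :=
  fun x => \sum_(c <- l) c.1 * b c.2 x.

(** As [nrm] is 0 on functions of infinite norm, membership is informative for [L2] functions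
    only. *)
Definition L2_closure (I : Type) (b : I -> T -> R[i]) : set (T -> R[i]) :=
  [set f | forall e : R, 0 < e -> exists l, nrm mu (fun x => f x - lcomb b l x) <= e].

Definition L2_dense (I : Type) (b : I -> T -> R[i]) := forall f, L2 mu f -> L2_closure b f.

Section lcomb.
Context (I : Type).
Implicit Types b B : I -> T -> R[i].

Lemma lcomb_cons b c i l :
  lcomb b ((c, i) :: l) = (fun x => c * b i x + lcomb b l x).
Proof. by apply/funext => x; rewrite /lcomb big_cons. Qed.

Lemma lcomb_nil b : lcomb b [::] = (fun=> 0).
Proof. by apply/funext => x; rewrite /lcomb big_nil. Qed.

Lemma lcomb_cat b l l' : lcomb b (l ++ l') = (fun x => lcomb b l x + lcomb b l' x).
Proof. by apply/funext => x; rewrite /lcomb big_cat. Qed.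

Definition lcomb_scale (a : R[i]) (l : seq (R[i] * I)) :=
  [seq (a * c.1, c.2) | c <- l].

Lemma lcomb_scaleE b a l : lcomb b (lcomb_scale a l) = (fun x => a * lcomb b l x).
Proof.
apply/funext => x; rewrite /lcomb big_map mulr_sumr.
by apply: eq_bigr => c _; rewrite mulrA.
Qed.

Lemma L2_lcomb b l : (forall i, L2 mu (b i)) -> L2 mu (lcomb b l).
Proof.
move=> bL; elim: l => [|[c i] l IH]; first by rewrite lcomb_nil; exact: L2_0.
by rewrite lcomb_cons; apply: L2D => //; exact: L2Z.
Qed.

(** Inner products of combinations depend on the Gram matrix alone. Hence sending [b i] to [B i]
    preserves norms of combinations, and is well defined even if the [b i] are linearly
    dependent. *)
Lemma ip_lcomb b B l l' : (forall i, L2 mu (b i)) -> (forall i, L2 mu (B i)) ->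
  (forall i j, ip mu (B i) (B j) = ip mu (b i) (b j)) ->
  ip mu (lcomb B l) (lcomb B l') = ip mu (lcomb b l) (lcomb b l').
Proof.
move=> bL BL bB; elim: l => [|[c i] l IH].
  rewrite !lcomb_nil [LHS]ip_conj; [|exact: L2_lcomb|exact: L2_0].
  rewrite [RHS]ip_conj; [|exact: L2_lcomb|exact: L2_0].
  by rewrite !ip0r.
rewrite !lcomb_cons !ip_linl ?IH; try exact: L2_lcomb; try by [].
congr (_ * _ + _); elim: l' {IH} => [|[c' j] l' IH]; first by rewrite !lcomb_nil !ip0r.
by rewrite !lcomb_cons !ip_linr ?IH ?bB//; exact: L2_lcomb.
Qed.

Lemma nrm_lcomb b B l : (forall i, L2 mu (b i)) -> (forall i, L2 mu (B i)) ->
  (forall i j, ip mu (B i) (B j) = ip mu (b i) (b j)) ->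
  nrm mu (lcomb B l) = nrm mu (lcomb b l).
Proof.
move=> bL BL bB; rewrite /nrm; congr Num.sqrt; apply: (@complexI R).
by rewrite -!ip_nsq; exact: ip_lcomb.
Qed.

End lcomb.

Lemma L2_closure_lin (I : Type) (b : I -> T -> R[i]) a f g :
  (forall i, L2 mu (b i)) -> L2 mu f -> L2 mu g ->
  L2_closure b f -> L2_closure b g -> L2_closure b (fun x => a * f x + g x).
Proof.
move=> bL fL gL fc gc e e0.
have e2 : 0 < e / 2 by rewrite divr_gt0.
have [l1 h1] := gc _ e2.
(* The [+ 1] keeps the divisor positive for [a = 0]. *)
have a0 : 0 < Num.sqrt (normsq a) + 1 by rewrite ltr_wpDl ?sqrtr_ge0.
have [l2 h2] := fc _ (divr_gt0 e2 a0).
exists (lcomb_scale a l2 ++ l1); rewrite lcomb_cat lcomb_scaleE.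
rewrite (_ : (fun x => _) = (fun x => a * (f x - lcomb b l2 x) +
  (g x - lcomb b l1 x))); last by apply/funext => x; ring.
have L1 : L2 mu (fun x => f x - lcomb b l2 x) by apply: L2B => //; exact: L2_lcomb.
rewrite (le_trans (nrmD (L2Z _ L1) _))//; first by apply: L2B => //; exact: L2_lcomb.
rewrite [leRHS](splitr e) lerD// nrmZ//.
apply: (@le_trans _ _ ((Num.sqrt (normsq a) + 1) * (e / 2 / (Num.sqrt (normsq a) + 1)))).
  by rewrite ler_pM ?sqrtr_ge0 ?nrm_ge0// lerDl.
by rewrite mulrC divfK// gt_eqF.
Qed.

Lemma L2_closure0 (I : Type) (b : I -> T -> R[i]) : L2_closure b (fun=> 0).
Proof. by move=> e e0; exists [::]; rewrite lcomb_nil nrm_subxx ltW. Qed.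

Lemma L2_closureZ (I : Type) (b : I -> T -> R[i]) a f : (forall i, L2 mu (b i)) ->
  L2 mu f -> L2_closure b f -> L2_closure b (fun x => a * f x).
Proof.
move=> bL fL fc; have := L2_closure_lin a bL fL (L2_0 mu) fc (L2_closure0 b).
by under [X in L2_closure _ X -> _]eq_fun do rewrite addr0.
Qed.

Lemma L2_closure_gen (I : Type) (b : I -> T -> R[i]) i : L2_closure b (b i).
Proof.
move=> e e0; exists [:: (1, i)]; rewrite lcomb_cons lcomb_nil.
by under eq_fun do rewrite mul1r addr0; rewrite nrm_subxx ltW.
Qed.

Lemma L2_closure_lim (I : Type) (b : I -> T -> R[i]) f : (forall i, L2 mu (b i)) ->
  L2 mu f -> (forall e, 0 < e -> exists g,
    [/\ L2 mu g, L2_closure b g & nrm mu (fun x => f x - g x) <= e]) ->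
  L2_closure b f.
Proof.
move=> bL fL fg e e0; have e2 : 0 < e / 2 by rewrite divr_gt0.
have [g [gL gc fge]] := fg _ e2; have [l gl] := gc _ e2; exists l.
by rewrite (splitr e) (le_trans (nrm_dist fL gL (L2_lcomb l bL)))// lerD.
Qed.

Lemma L2_dense_trans (I J : Type) (b : I -> T -> R[i]) (c : J -> T -> R[i]) :
  (forall i, L2 mu (b i)) -> (forall j, L2 mu (c j)) -> L2_dense b ->
  (forall i, L2_closure c (b i)) -> L2_dense c.
Proof.
move=> bL cL bd bc f fL; apply: L2_closure_lim => // e /(bd f fL)[l fl].
exists (lcomb b l); split => //; first exact: L2_lcomb.
elim: l {fl} => [|[a i] l IH]; first by rewrite lcomb_nil; exact: L2_closure0.
by rewrite lcomb_cons; apply: L2_closure_lin => //; exact: L2_lcomb.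
Qed.

Lemma L2_boundedP (F : (T -> R[i]) -> (T -> R[i])) : L2_bounded_operator mu F <->
  [/\ forall f, L2 mu f -> L2 mu (F f),
      forall (a : R[i]) f g, L2 mu f -> L2 mu g ->
        F (fun x => a * f x + g x) = (fun x => a * F f x + F g x) %[ae mu] &
      exists M : R, forall f, L2 mu f -> nrm mu (F f) <= M * nrm mu f].
Proof.
split=> -[FL Flin [M FM]]; split => //; exists M => f fL; have := FM f fL.
  by rewrite !L2norm_nrm//; exact: FL.
by rewrite !L2norm_nrm//; exact: FL.
Qed.

Section bounded.
Variable F : (T -> R[i]) -> (T -> R[i]).
Hypothesis FB : L2_bounded_operator mu F.

Lemma op_L2 f : L2 mu f -> L2 mu (F f). Proof. by case: FB => FL _ _; exact: FL. Qed.

Lemma op_lin a f g : L2 mu f -> L2 mu g ->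
  F (fun x => a * f x + g x) = (fun x => a * F f x + F g x) %[ae mu].
Proof. by case: FB => _ h _; exact: h. Qed.

(** The difference [F f - F g] is [F (f - g)] only almost everywhere; this Lipschitz form absorbs
    the exceptional set once and for all, with a nonnegative constant. *)
Lemma op_dist : exists M : R, 0 <= M /\ forall f g, L2 mu f -> L2 mu g ->
  nrm mu (fun x => F f x - F g x) <= M * nrm mu (fun x => f x - g x).
Proof.
have /L2_boundedP[FL Flin [M FM]] := FB; exists `|M|; split => // f g fL gL.
have e h h' : (fun x : T => (-1) * h' x + h x) = (fun x => h x - h' x) :> (T -> R[i]).
  by apply/funext => x; rewrite mulN1r addrC.
rewrite -e; have h := op_lin (-1) gL fL.
rewrite -(nrm_ae _ _ h); last 2 first.
- by apply: FL; rewrite e; exact: L2B.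
- by rewrite e; apply: L2B; exact: FL.
rewrite e (le_trans (FM _ _))//; first exact: L2B.
by rewrite ler_wpM2r ?nrm_ge0 ?ler_norm.
Qed.

Lemma op_ae f g : L2 mu f -> L2 mu g -> f = g %[ae mu] -> F f = F g %[ae mu].
Proof.
move=> fL gL fg; have [M [M0 FM]] := op_dist.
apply: nrm_sub_eq0; [exact: op_L2|exact: op_L2|].
apply/eqP; rewrite eq_le nrm_ge0 andbT (le_trans (FM _ _ fL gL))//.
by rewrite ae_nrm_sub// mulr0.
Qed.

Lemma op_0 : F (fun=> 0) = (fun=> 0) %[ae mu].
Proof.
have := op_lin (-1) (L2_0 mu) (L2_0 mu); set z := (fun x => _ + 0).
have -> : z = (fun=> 0) by apply/funext => x; rewrite /z mulr0 addr0.
by apply: filterS => x /= e _; rewrite e// mulN1r addNr.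
Qed.

Lemma op_lcomb (I : Type) (b : I -> T -> R[i]) l : (forall i, L2 mu (b i)) ->
  F (lcomb b l) = lcomb (fun i => F (b i)) l %[ae mu].
Proof.
move=> bL; elim: l => [|[c i] l IH]; first by rewrite !lcomb_nil; exact: op_0.
rewrite !lcomb_cons; have := op_lin c (bL i) (L2_lcomb l bL).
by move: IH; apply: filterS2 => x /= e1 e2 Dx; rewrite e2// e1.
Qed.

End bounded.

(** On a combination of the [b i] the two operators agree, so [F f] and [G f] differ in norm by at
    most [(M + N) * e], where [e] is the error of approximating [f]. *)
Lemma op_unique (I : Type) (b : I -> T -> R[i]) F G : (forall i, L2 mu (b i)) ->
  L2_dense b -> L2_bounded_operator mu F -> L2_bounded_operator mu G ->
  (forall i, F (b i) = G (b i) %[ae mu]) ->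
  forall f, L2 mu f -> F f = G f %[ae mu].
Proof.
move=> bL bd FB GB FG f fL.
have [M [M0 FM]] := op_dist FB; have [N [N0 GN]] := op_dist GB.
have Ff := op_L2 FB fL; have Gf := op_L2 GB fL.
apply: nrm_sub_eq0 => //; apply/eqP; rewrite eq_le nrm_ge0 andbT.
apply: (@le0_of_le_eps _ _ (M + N)) => e /(bd _ fL)[l fl].
have lL := L2_lcomb l bL.
have Fl := op_L2 FB lL; have Gl := op_L2 GB lL.
rewrite (le_trans (nrm_dist Ff Fl Gf))// mulrDl lerD//.
  by rewrite (le_trans (FM _ _ _ _))// ler_wpM2l.
rewrite (@nrm_ae _ _ _ _ _ (fun x => G (lcomb b l) x - G f x)); [|exact: L2B|exact: L2B|].
  by rewrite nrm_swap (le_trans (GN _ _ _ _))// ler_wpM2l.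
have lFG : lcomb (fun i => F (b i)) l = lcomb (fun i => G (b i)) l %[ae mu].
  elim: l {fl lL Fl Gl} => [|[c i] l IH]; first by rewrite !lcomb_nil; exact: nearW.
  by rewrite !lcomb_cons; move: IH (FG i); apply: filterS2 => x /= e1 e2 Dx; rewrite e1// e2.
have := op_lcomb FB l bL; have := op_lcomb GB l bL; move: lFG.
by apply: filterS3 => x /= e1 e2 e3 Dx; rewrite e3// e2// e1.
Qed.

Lemma L2_bounded_comp F G : L2_bounded_operator mu F -> L2_bounded_operator mu G ->
  L2_bounded_operator mu (fun f => F (G f)).
Proof.
move=> FB GB; have /L2_boundedP[FL Flin [M FM]] := FB.
have /L2_boundedP[GL Glin [N GN]] := GB.
apply/L2_boundedP; split.
- by move=> f fL; apply: FL; exact: GL.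
- move=> a f g fL gL.
  have h1 := Flin a _ _ (GL _ fL) (GL _ gL).
  have h2 : F (G (fun x => a * f x + g x)) = F (fun x => a * G f x + G g x) %[ae mu].
    apply: op_ae => //; last exact: Glin.
      by apply: GL; apply: L2D => //; exact: L2Z.
    by apply: L2D; [apply: L2Z|]; exact: GL.
  by move: h1 h2; apply: filterS2 => x /= e1 e2 Dx; rewrite e2// e1.
- exists (`|M| * `|N|) => f fL; rewrite (le_trans (FM _ (GL _ fL)))//.
  rewrite (@le_trans _ _ (`|M| * nrm mu (G f)))//.
    by rewrite ler_wpM2r ?nrm_ge0 ?ler_norm.
  rewrite -mulrA ler_wpM2l// (le_trans (GN _ fL))//.
  by rewrite ler_wpM2r ?nrm_ge0 ?ler_norm.
Qed.

Lemma L2_bounded_id : L2_bounded_operator mu (fun f => f).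
Proof.
apply/L2_boundedP; split => //; first by move=> *; exact: nearW.
by exists 1 => f _; rewrite mul1r.
Qed.

Lemma op_isometry (F : (T -> R[i]) -> (T -> R[i])) : L2_isometry mu F <->
  L2_bounded_operator mu F /\ forall f, L2 mu f -> nrm mu (F f) = nrm mu f.
Proof.
split=> -[FB H]; split => // f fL; have := H f fL.
  by rewrite !L2norm_nrm => [[]| |]//; exact: op_L2.
by rewrite !L2norm_nrm => [->| |]//; exact: op_L2.
Qed.

(* By polarisation. *)
Lemma isometry_ip F : L2_isometry mu F -> forall f g, L2 mu f -> L2 mu g ->
  ip mu (F f) (F g) = ip mu f g.
Proof.
move=> /op_isometry[FB Fiso] f g fL gL.
have Re_eq u v : L2 mu u -> L2 mu v ->
    complex.Re (ip mu (F u) (F v)) = complex.Re (ip mu u v).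
  move=> uL vL; have uvL : L2 mu (fun x => 1 * u x + v x).
    by apply: L2D => //; exact: L2Z.
  have := Fiso _ uvL; rewrite /nrm => /(congr1 (fun x => x ^+ 2)).
  rewrite !sqr_sqrtr ?nsq_ge0//.
  have Fu := op_L2 FB uL; have Fv := op_L2 FB vL.
  rewrite (nsq_ae _ _ (op_lin FB 1 uL vL)); last 2 first.
  - exact: op_L2.
  - by apply: L2D => //; exact: L2Z.
  have e h h' : (fun x : T => 1 * h x + h' x) = (fun x => h x + h' x) :> (T -> R[i]).
    by apply/funext => x; rewrite mul1r.
  rewrite !e !nsqD// -!sqr_nrm !Fiso// => /addrI/(mulfI _) -> //.
apply: eq_ReIm; first exact: Re_eq.
(* The real part of the inner product for ['i * f] is minus the imaginary part for [f]. The zero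
   function is added to match the shape of [op_lin]. *)
have ifL : L2 mu (fun x => 'i%C * f x + (fun=> 0) x).
  by apply: L2D; [exact: L2Z|exact: L2_0].
have := Re_eq _ _ ifL gL.
have z0 h : L2 mu h -> ip mu (fun=> 0) h = 0.
  by move=> hL; rewrite ip_conj ?ip0r ?conjc0//; exact: L2_0.
have Ff := op_L2 FB fL; have Fg := op_L2 FB gL; have L0 := L2_0 mu.
rewrite (ip_linl _ fL L0 gL) z0// addr0.
rewrite (@ip_ae _ _ _ _ _ (fun x => 'i%C * F f x + (fun=> 0) x) _ (F g)) => //.
- rewrite (ip_linl _ Ff L0 Fg) z0// addr0 !ReM/= !mul0r !mul1r !sub0r.
  exact: oppr_inj.
- exact: op_L2.
- by apply: L2D => //; exact: L2Z.
- have := op_0 FB; have := op_lin FB 'i%C fL L0.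
  by apply: filterS2 => x /= e1 e2 Dx; rewrite e1// e2.
- exact: nearW.
Qed.

End L2_operators.

(** * Extension of an isometry from a dense family *)

Section L2_extend.
Context d (T : measurableType d) (R : realType) (mu : {measure set T -> \bar R}).
Context (I : Type) (b B : I -> T -> R[i]).
Hypothesis bL : forall i, L2 mu (b i).
Hypothesis BL : forall i, L2 mu (B i).
Hypothesis bB : forall i j, ip mu (B i) (B j) = ip mu (b i) (b j).
Hypothesis bd : L2_dense mu b.
Implicit Types f g h : T -> R[i].

(** The graph of the extension: the same coefficients approximate [f] along [b] and [g] along [B].
    With a relation, existence, linearity and uniqueness are separate statements, and the operator
    is chosen only afterwards. *)
Let Ext f g := L2 mu g /\ forall e : R, 0 < e -> exists l,
  nrm mu (fun x => f x - lcomb b l x) <= e /\ nrm mu (fun x => g x - lcomb B l x) <= e.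

Let Ext_ex f : L2 mu f -> exists g, Ext f g.
Proof.
move=> fL.
have p4 n : 0 < (4 ^+ n)^-1 :> R by rewrite invr_gt0 exprn_gt0.
have /choice[l fl] : forall n, exists l, nrm mu (fun x => f x - lcomb b l x) <= (4 ^+ n)^-1.
  by move=> n; exact: bd.
(* The constant 2 counts the errors [4 ^- n] and [4 ^- m <= 4 ^- n] of the triangle inequality
   through [f]. *)
have [||g [gL gl]] := @L2_complete _ _ _ mu (fun n => lcomb B (l n)) 2.
- by move=> n; exact: L2_lcomb.
- move=> n m nm.
  have e (c : I -> T -> R[i]) : (fun x => lcomb c (l m) x - lcomb c (l n) x) =
      lcomb c (l m ++ lcomb_scale (-1) (l n)).
    by rewrite lcomb_cat lcomb_scaleE; apply/funext => x; rewrite mulN1r.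
  rewrite e (nrm_lcomb _ bL BL bB) -e.
  rewrite (le_trans (nrm_dist (L2_lcomb (l m) bL) fL (L2_lcomb (l n) bL)))//.
  rewrite mulr_natl mulr2n lerD// nrm_swap (le_trans (fl m))//.
  by rewrite lef_pV2 ?posrE ?exprn_gt0// ler_weXn2l// ler1n.
exists g; split => // e e0.
have [n ne] : exists n, 2 / 4 ^+ n <= e :> R.
  pose k := Num.bound (2 / e); exists k.
  rewrite ler_pdivrMr ?exprn_gt0// mulrC -ler_pdivrMr//.
  apply: ltW; apply: (@lt_le_trans _ _ k%:R).
    by rewrite archi_boundP// divr_ge0// ltW.
  by rewrite -natrX ler_nat ltnW// ltn_expl.
exists (l n); split; last exact: le_trans ne.
by rewrite (le_trans (fl n))// (le_trans _ ne)// ler_peMl ?invr_ge0 ?exprn_ge0// ler1n.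
Qed.

Let Ext_lin a f g f' g' : L2 mu f -> L2 mu f' -> Ext f g -> Ext f' g' ->
  Ext (fun x => a * f x + f' x) (fun x => a * g x + g' x).
Proof.
move=> fL fL' [gL H] [gL' H']; split; first by apply: L2D => //; exact: L2Z.
move=> e e0; have a0 : 0 < Num.sqrt (normsq a) + 1 by rewrite ltr_wpDl ?sqrtr_ge0.
have e2 : 0 < e / 2 by rewrite divr_gt0.
have [l [l1 l2]] := H _ (divr_gt0 e2 a0); have [l' [l1' l2']] := H' _ e2.
have key h h' (c : I -> T -> R[i]) : (forall i, L2 mu (c i)) -> L2 mu h -> L2 mu h' ->
    nrm mu (fun x => h x - lcomb c l x) <= e / 2 / (Num.sqrt (normsq a) + 1) ->
    nrm mu (fun x => h' x - lcomb c l' x) <= e / 2 ->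
    nrm mu (fun x => a * h x + h' x - lcomb c (lcomb_scale a l ++ l') x) <= e.
  move=> cL hL hL' h1 h2; rewrite lcomb_cat lcomb_scaleE.
  rewrite (_ : (fun x => _) = (fun x => a * (h x - lcomb c l x) +
    (h' x - lcomb c l' x))); last by apply/funext => x; ring.
  have L1 : L2 mu (fun x => h x - lcomb c l x) by apply: L2B => //; exact: L2_lcomb.
  rewrite (le_trans (nrmD (L2Z _ L1) _))//; first by apply: L2B => //; exact: L2_lcomb.
  rewrite [leRHS](splitr e) lerD// nrmZ//.
  apply: (@le_trans _ _ ((Num.sqrt (normsq a) + 1) * (e / 2 / (Num.sqrt (normsq a) + 1)))).
    by rewrite ler_pM ?sqrtr_ge0 ?nrm_ge0// lerDl.
  by rewrite mulrC divfK// gt_eqF.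
by exists (lcomb_scale a l ++ l'); split; exact: key.
Qed.

Let Ext_nrm f g : L2 mu f -> Ext f g -> nrm mu g = nrm mu f.
Proof.
move=> fL [gL H]; apply/eqP; rewrite -subr_eq0 -normr_eq0 eq_le normr_ge0 andbT.
apply: (@le0_of_le_eps _ _ 2) => e /H[l [h1 h2]].
have key h (c : I -> T -> R[i]) : (forall i, L2 mu (c i)) -> L2 mu h ->
    nrm mu (fun x => h x - lcomb c l x) <= e ->
    nrm mu h <= e + nrm mu (lcomb c l) /\ nrm mu (lcomb c l) <= e + nrm mu h.
  move=> cL hL hl; have lL := L2_lcomb l cL; split.
    have := nrmD (L2B hL lL) lL; under [X in nrm _ X <= _ -> _]eq_fun do rewrite subrK.
    by move=> /le_trans -> //; rewrite lerD2r.
  have := nrmD (L2B lL hL) hL; under [X in nrm _ X <= _ -> _]eq_fun do rewrite subrK.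
  by rewrite nrm_swap => /le_trans -> //; rewrite lerD2r.
have [a1 a2] := key _ _ bL fL h1; have [b1 b2] := key _ _ BL gL h2.
move: b1 b2; rewrite (nrm_lcomb _ bL BL bB) => b1 b2.
by rewrite ler_norml; apply/andP; split; lra.
Qed.

(** By linearity [g - g'] is an image of [f - f = 0], and by [Ext_nrm] an image has the norm of its
    source. *)
Let Ext_uniq f g g' : L2 mu f -> Ext f g -> Ext f g' -> g = g' %[ae mu].
Proof.
move=> fL E E'; have := Ext_lin (-1) fL fL E' E; have [gL _] := E; have [gL' _] := E'.
set z := (fun x => _); move=> /Ext_nrm H.
have zE : z = (fun=> 0) by apply/funext => x; rewrite /z mulN1r addNr.
apply: nrm_sub_eq0 => //.
have -> : (fun x => g x - g' x) = (fun x => -1 * g' x + g x).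
  by apply/funext => x; rewrite mulN1r addrC.
rewrite H; last by rewrite zE; exact: L2_0.
by rewrite zE nrm0.
Qed.

Lemma L2_extend : exists F, L2_isometry mu F /\ forall i, F (b i) = B i %[ae mu].
Proof.
have /choice[F FE] : forall f, exists g, L2 mu f -> Ext f g.
  move=> f; have [/Ext_ex[g fg]|nf] := pselect (L2 mu f); first by exists g.
  by exists f.
have FL f : L2 mu f -> L2 mu (F f) by move=> /FE[].
have Fn f : L2 mu f -> nrm mu (F f) = nrm mu f by move=> fL; exact: Ext_nrm (FE f fL).
exists F; split.
  apply/op_isometry; split => //; apply/L2_boundedP; split => //.
    move=> a f g fL gL.
    have L : L2 mu (fun x => a * f x + g x) by apply: L2D => //; exact: L2Z.
    by apply: (Ext_uniq L (FE _ L)); apply: Ext_lin => //; exact: FE.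
  by exists 1 => f fL; rewrite mul1r Fn.
move=> i; apply: (Ext_uniq (bL i) (FE _ (bL i))); split => // e e0.
have k (c : I -> T -> R[i]) : (fun x => c i x - lcomb c [:: (1, i)] x) = (fun=> 0).
  by apply/funext => x; rewrite lcomb_cons lcomb_nil mul1r addr0 subrr.
by exists [:: (1, i)]; rewrite !k !nrm0 ltW.
Qed.

End L2_extend.

Section L2_closure_limits.
Context d (T : measurableType d) (R : realType) (mu : {measure set T -> \bar R}).
Context (I : Type) (b : I -> T -> R[i]).
Hypothesis bL : forall i, L2 mu (b i).
Implicit Types f g : T -> R[i].

(** Dominated convergence for [normsq (s n x - f x)], which is at most [4 * v x]; a late term of the
    sequence then approximates [f] in norm. *)
Lemma L2_closure_cvg (s : nat -> T -> R[i]) f (v : T -> R) :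
  (forall n, L2 mu (s n)) -> (forall n, L2_closure mu b (s n)) -> Cmeasurable f ->
  mu.-integrable setT (EFin \o v) -> (forall x, normsq (f x) <= v x) ->
  (forall n x, normsq (s n x) <= v x) ->
  {ae mu, forall x, (fun n => normsq (s n x - f x)) @ \oo --> (0 : R)} ->
  L2_closure mu b f.
Proof.
move=> sL sc mf vi fv sv sf.
have fL : L2 mu f by exact: L2_dom vi.
apply: L2_closure_lim => // e e0.
have mD n : measurable_fun setT (fun x => normsq (s n x - f x)).
  by apply: measurable_normsq; apply: CmeasurableB => //; exact: L2_Cmeasurable.
have h1 n : measurable_fun setT (fun x => (normsq (s n x - f x))%:E).
  exact/measurable_EFinP.
have h2 : {ae mu, forall x, setT x -> (fun n => (normsq (s n x - f x))%:E) @ \oo --> cst 0%E x}.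
  apply: filterS sf => x h _; apply/fine_cvgP; split; [exact: nearW|exact: h].
have h3 : {ae mu, forall x, forall n, setT x ->
    (`|(normsq (s n x - f x))%:E| <= (EFin \o (fun x => 2 * v x + 2 * v x)%R) x)%E}.
  apply: nearW => x n _; rewrite lee_fin /= ger0_norm ?normsq_ge0//.
  by rewrite (le_trans (normsqD_le _ _))// normsqN lerD// ler_pM2l.
have [_ _] := dominated_convergence measurableT h1 (measurable_cst _) h2
  (Rintegrable_lin 2 2 vi vi) h3.
rewrite integral0. move=> /fine_cvgP[_] /cvgrPdist_le /(_ (e ^+ 2)).
rewrite exprn_gt0// => /(_ isT)[N _ /(_ N (leqnn N))].
rewrite sub0r normrN /= => h; exists (s N); split => //.
rewrite nrm_swap -(ler_pXn2r (n := 2))// ?nnegrE ?nrm_ge0 ?(ltW e0)// sqr_nrm.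
by apply: le_trans h; rewrite nsq_integral ?ler_norm//; exact: L2B.
Qed.

End L2_closure_limits.

(** * Density of indicator functions *)

Section indicators.
Context d (T : measurableType d) (R : realType) (mu : {measure set T -> \bar R}).

Definition indC (A : set T) (x : T) : R[i] := (\1_A x)%:C%C.

Lemma indCI A B x : indC (A `&` B) x = indC A x * indC B x.
Proof. by rewrite /indC indicI/= rmorphM. Qed.

Lemma conj_indC A x : conjc (indC A x) = indC A x.
Proof. exact: conjc_real. Qed.

Lemma normsq_indC A x : normsq (indC A x) = \1_A x.
Proof.
by rewrite normsq_real indicE; case: (_ \in _); rewrite ?expr1n ?expr0n.
Qed.

Lemma Cmeasurable_indC A : measurable A -> Cmeasurable (indC A).
Proof. by move=> mA; apply: Cmeasurable_real; exact: measurable_indic. Qed.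

Lemma integrable_indic_fin A : measurable A -> (mu A < +oo)%E ->
  mu.-integrable setT (EFin \o (\1_A : T -> R)).
Proof.
move=> mA Aoo; apply/integrableP; split.
  by apply/measurable_EFinP; exact: measurable_indic.
under eq_integral do rewrite /= ger0_norm//.
by rewrite integral_indic// setIT.
Qed.

Lemma L2_indC A : measurable A -> (mu A < +oo)%E -> L2 mu (indC A).
Proof.
move=> mA Aoo; apply: (L2_dom _ _ _ (integrable_indic_fin mA Aoo)) => [|x].
  exact: Cmeasurable_indC.
by rewrite normsq_indC.
Qed.

Lemma ip_indC A B : measurable A -> measurable B -> (mu (A `&` B) < +oo)%E ->
  ip mu (indC A) (indC B) = (fine (mu (A `&` B)))%:C%C.
Proof.
move=> mA mB ABoo; have mAB := measurableI _ _ mA mB.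
rewrite /ip (_ : (fun x => _) = indC (A `&` B)); last first.
  by apply/funext => x; rewrite indCI conj_indC.
apply: eq_ReIm => /=; last by rewrite Rintegral_cst// mul0r.
by rewrite /Rintegral integral_indic// setIT.
Qed.

End indicators.
Arguments indC {d T} R A x.

Import HBSimple HBNNSimple.

Section L2_dense_indicators.
Context d (T : measurableType d) (R : realType) (mu : {measure set T -> \bar R}).
Context (I : Type) (G : I -> set T) (E : nat -> I).
Hypothesis mG : forall i, measurable (G i).
Hypothesis Goo : forall i, (mu (G i) < +oo)%E.
Hypothesis GI : forall i j, G i `&` G j = set0 \/ exists k, G i `&` G j = G k.
Hypothesis sG : forall A, measurable A -> <<s range G >> A.
Hypothesis ndE : forall n m, (n <= m)%N -> G (E n) `<=` G (E m).
Hypothesis ET : \bigcup_n G (E n) = setT.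

Local Notation b := (fun i => indC R (G i)).
Local Notation cl := (L2_closure mu b).

Let bL i : L2 mu (b i). Proof. exact: L2_indC. Qed.

(** The indicator of [A] is a majorant, integrable because [A] has finite measure. *)
Let cl_nd (B : nat -> set T) (A : set T) : (forall n, measurable (B n)) ->
  (forall n m, (n <= m)%N -> B n `<=` B m) -> \bigcup_n B n = A ->
  (mu A < +oo)%E -> (forall n, cl (indC R (B n))) -> cl (indC R A).
Proof.
move=> mB nB BA Aoo Bc.
have mA : measurable A by rewrite -BA; exact: bigcup_measurable.
have BsA n : B n `<=` A by rewrite -BA; exact: bigcup_sup.
have BnL n : L2 mu (indC R (B n)).
  by apply: L2_indC => //; rewrite (le_lt_trans _ Aoo)// le_measure ?inE.
apply: (L2_closure_cvg bL BnL Bc _ (integrable_indic_fin mA Aoo)).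
- exact: Cmeasurable_indC.
- by move=> x; rewrite normsq_indC.
- move=> n x; rewrite normsq_indC !indicE ler_nat.
  by have [/set_mem/BsA/mem_set->|] := boolP (x \in B n).
apply: nearW => x; apply: cvg_near_cst.
have [Ax|nAx] := pselect (A x).
  have := Ax; rewrite -{1}BA => -[N _ BNx]; exists N => // n /= Nn.
  by rewrite /indC !indicE !mem_set ?subrr ?normsq0//; exact: nB BNx.
near=> n; rewrite /indC !indicE !memNset ?subrr ?normsq0//.
by move=> /BsA.
Unshelve. all: by end_near.
Qed.

Let cl_sub (A B : set T) : measurable A -> measurable B -> B `<=` A -> (mu A < +oo)%E ->
  cl (indC R A) -> cl (indC R B) -> cl (indC R (A `\` B)).
Proof.
move=> mA mB BA Aoo Ac Bc.
have AL := L2_indC mA Aoo.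
have BL : L2 mu (indC R B) by apply: L2_indC => //; rewrite (le_lt_trans _ Aoo)// le_measure ?inE.
have := L2_closure_lin (-1) bL BL AL Bc Ac; congr (L2_closure mu b).
apply/funext => x; rewrite mulN1r addrC /indC -rmorphB/=; congr (_%:C)%C.
rewrite !indicE in_setD; have [/set_mem/BA/mem_set->|_] := boolP (x \in B).
  by rewrite subrr.
by rewrite subr0 andbT.
Qed.

Let cl_add (A B : set T) : measurable A -> measurable B -> A `&` B = set0 ->
  (mu A < +oo)%E -> (mu B < +oo)%E ->
  cl (indC R A) -> cl (indC R B) -> cl (indC R (A `|` B)).
Proof.
move=> mA mB AB Aoo Boo Ac Bc.
have := L2_closure_lin 1 bL (L2_indC mA Aoo) (L2_indC mB Boo) Ac Bc.
congr (L2_closure mu b); apply/funext => x; rewrite mul1r /indC -rmorphD/=.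
congr (_%:C)%C; rewrite !indicE in_setU.
have [/set_mem Ax|_] := boolP (x \in A); last by rewrite add0r.
rewrite memNset ?addr0// => Bx; have : (A `&` B) x by [].
by rewrite AB.
Qed.

(** Dynkin's theorem: the [G i] together with the empty set are stable under intersection, and the
    sets [A] with this property form a Dynkin system. Intersecting with [G (E n)] keeps all measures
    finite, so that a complement becomes a difference of two indicators in [L2]. *)
Let cl_inter n A : measurable A -> cl (indC R (A `&` G (E n))).
Proof.
move=> mA; pose H : set (set T) := [set B | B = set0 \/ range G B].
have HI : setI_closed H.
  move=> B B' [->|[i _ <-]]; first by rewrite set0I; left.
  move=> [->|[j _ <-]]; first by rewrite setI0; left.
  by have [->|[k ->]] := GI i j; [left|right; exists k].
have {}sA : <<d H >> A.
  rewrite setI_closed_g_dynkin_g_sigma_algebra//.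
  have := sG mA; apply: smallest_sub; first exact: smallest_sigma_algebra.
  by move=> B [i _ <-]; apply: sub_gen_smallest; right; exists i.
have Eoo B : measurable B -> (mu (B `&` G (E n)) < +oo)%E.
  move=> mB; apply: le_lt_trans (Goo (E n)).
  by apply: le_measure; rewrite ?inE//; exact: measurableI.
suff : <<d H >> `<=` [set B | measurable B /\ cl (indC R (B `&` G (E n)))].
  by move=> /(_ _ sA)[].
apply: smallest_sub; last first.
  move=> B [->|[i _ <-]]; split => //.
    rewrite set0I (_ : indC R set0 = (fun=> 0)); first exact: L2_closure0.
    by apply/funext => x; rewrite /indC indic0.
  have [->|[k ->]] := GI i (E n); last exact: L2_closure_gen.
  rewrite (_ : indC R set0 = (fun=> 0)); first exact: L2_closure0.
  by apply/funext => x; rewrite /indC indic0.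
split.
- by split => //; rewrite setTI; exact: L2_closure_gen.
- move=> B [mB Bc]; split; first exact: measurableC.
  rewrite (_ : _ `&` _ = G (E n) `\` (B `&` G (E n))); last first.
    apply/seteqP; split => x [h1 h2]; split => //; first by case.
    by move=> Bx; apply: h2.
  apply: cl_sub => //; first exact: measurableI.
  exact: L2_closure_gen.
- move=> F tF FH; have mF k : measurable (F k) by have [] := FH k.
  split; first exact: bigcup_measurable.
  pose B k := (\big[setU/set0]_(i < k) F i) `&` G (E n).
  have mS k : measurable (\big[setU/set0]_(i < k) F i) by exact: bigsetU_measurable.
  have mB k : measurable (B k) by exact: measurableI.
  apply: (@cl_nd B) => //.
  + move=> k m km; apply: setSI; exact: subset_bigsetU.
  + rewrite /B -setI_bigcupl; congr (_ `&` _); apply/seteqP; split => x [k _].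
      by rewrite -bigcup_mkord => -[i _ Fi]; exists i.
    by move=> Fk; exists k.+1 => //; rewrite -bigcup_mkord; exists k => /=.
  + by apply: Eoo; exact: bigcup_measurable.
  + elim=> [|k IH].
      rewrite /B big_ord0 set0I (_ : indC R set0 = (fun=> 0)); first exact: L2_closure0.
      by apply/funext => x; rewrite /indC indic0.
    rewrite /B big_ord_recr/= setIUl; apply: cl_add => //.
    * exact: mB.
    * by apply: measurableI; [exact: mF|exact: mG].
    * rewrite setIACA setIid; rewrite (_ : _ `&` F k = set0) ?set0I//.
      rewrite -bigcup_mkord setI_bigcupl; apply: bigcup0 => i /= ik.
      apply: contrapT => /eqP/set0P[x [Fi Fk]].
      by have := tF i k Logic.I Logic.I (ex_intro _ x (conj Fi Fk)); move: ik => /[swap] ->; rewrite ltnn.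
    * exact: (Eoo _ (mS k)).
    * exact: (Eoo _ (mF k)).
    * by have [] := FH k.
Qed.

Let cl_fin A : measurable A -> (mu A < +oo)%E -> cl (indC R A).
Proof.
move=> mA Aoo; apply: (@cl_nd (fun n => A `&` G (E n))) => //.
- by move=> n; exact: measurableI.
- by move=> n m nm; apply: setIS; exact: ndE.
- by rewrite -setI_bigcupr ET setIT.
- by move=> n; exact: cl_inter.
Qed.

Let cl_sum (J : Type) (r : seq J) (F : J -> T -> R[i]) :
  (forall j, L2 mu (F j)) -> (forall j, cl (F j)) ->
  cl (fun x => \sum_(j <- r) F j x) /\ L2 mu (fun x => \sum_(j <- r) F j x).
Proof.
move=> FL Fc; elim: r => [|j r [IH1 IH2]].
  rewrite (_ : (fun x => \sum_(j <- [::]) F j x) = (fun=> 0)); last first.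
    by apply/funext => x; rewrite big_nil.
  by split; [exact: L2_closure0|exact: L2_0].
rewrite (_ : (fun x => \sum_(k <- j :: r) F k x) = (fun x => 1 * F j x + \sum_(k <- r) F k x)); last first.
  by apply/funext => x; rewrite big_cons mul1r.
by split; [exact: L2_closure_lin|apply: L2D => //; exact: L2Z].
Qed.

(** Simple functions increase to [u]; they are cut off by [G (E n)] so that each of their level
    sets, that of the value 0 included, has finite measure. *)
Let cl_nneg (u : T -> R) : (forall x, 0 <= u x) -> L2 mu (fun x => (u x)%:C%C) ->
  cl (fun x => (u x)%:C%C).
Proof.
move=> u0 /L2P[[mu' _] uL].
have meu : measurable_fun setT (EFin \o u) by exact/measurable_EFinP.
have [g [ndg gu]] := approximation measurableT meu (fun x _ => u0 x).
have gu' x : (fun n => g n x) @ \oo --> u x.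
  by have /fine_cvgP[_] := gu x Logic.I.
have gle n x : g n x <= u x.
  rewrite -(cvg_lim _ (gu' x))//; apply: nondecreasing_cvgn_le.
    by move=> k m km; have /lefP := ndg _ _ km; exact.
  by apply/cvg_ex; exists (u x).
pose s n x : R[i] := \sum_(y <- finmap.enum_fset (fset_set (range (g n))))
  y%:C%C * indC R ((g n) @^-1` [set y] `&` G (E n)) x.
have sE n x : s n x = (g n x * \1_(G (E n)) x)%:C%C.
  rewrite (fimfunE (g n) x) fsbig_finite//= mulr_suml rmorph_sum; apply: eq_bigr => y _.
  by rewrite indCI /indC !rmorphM/= mulrA.
have mgE n y : measurable ((g n) @^-1` [set y] `&` G (E n)).
  by apply: measurableI => //; exact: measurable_sfunP.
have gEoo n y : (mu ((g n) @^-1` [set y] `&` G (E n)) < +oo)%E.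
  by apply: le_lt_trans (Goo (E n)); apply: le_measure; rewrite ?inE.
have FL n y : L2 mu (fun x => y%:C%C * indC R ((g n) @^-1` [set y] `&` G (E n)) x).
  by apply: L2Z; exact: L2_indC.
have Fc n y : cl (fun x => y%:C%C * indC R ((g n) @^-1` [set y] `&` G (E n)) x).
  by apply: L2_closureZ => //; [exact: L2_indC|exact: cl_fin].
apply: (L2_closure_cvg bL (s := s) _ _ _ uL) => //.
- by move=> n; have [] := cl_sum (finmap.enum_fset (fset_set (range (g n)))) (FL n) (Fc n).
- by move=> n; have [] := cl_sum (finmap.enum_fset (fset_set (range (g n)))) (FL n) (Fc n).
- move=> n x; rewrite sE !normsq_real exprMn -[leRHS]mulr1.
  have i1 : (\1_(G (E n)) x : R) ^+ 2 <= 1.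
    by rewrite indicE; case: (_ \in _); rewrite ?expr1n ?expr0n ?ler01.
  have gu2 : g n x ^+ 2 <= u x ^+ 2 by apply: lerXn2r; rewrite ?nnegrE.
  by apply: ler_pM; rewrite ?sqr_ge0.
apply: nearW => x; under eq_fun do rewrite sE -rmorphB/= normsq_real expr2.
suff h : (fun n => g n x * \1_(G (E n)) x) @ \oo --> u x.
  have h0 : (fun n => g n x * \1_(G (E n)) x - u x) @ \oo --> (0 : R).
    have : (fun n => g n x * \1_(G (E n)) x - u x) @ \oo --> u x - u x.
      by apply: cvgB => //; exact: cvg_cst.
    by rewrite subrr.
  rewrite -[X in nbhs X](mulr0 (0 : R)); exact: cvgM.
have : setT x by []; rewrite -ET => -[N _ Nx].
apply: (cvg_trans _ (gu' x)); apply: near_eq_cvg.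
by exists N => // n /= Nn; rewrite indicE mem_set ?mulr1//; exact: ndE Nx.
Qed.

(** The real and imaginary parts split into positive and negative parts, each dominated by [f] and
    hence in [L2]; [cl_nneg] applies to these four functions. *)
Lemma L2_dense_indC : L2_dense mu b.
Proof.
have key (u : T -> R) (f : T -> R[i]) : L2 mu f -> measurable_fun setT u ->
    (forall x, u x ^+ 2 <= normsq (f x)) -> L2 mu (fun x => (u x)%:C%C) /\
    cl (fun x => (u x)%:C%C).
  move=> /L2P[mf fi] mu' uf.
  have L (w : T -> R) : measurable_fun setT w -> (forall x, w x ^+ 2 <= u x ^+ 2) ->
      L2 mu (fun x => (w x)%:C%C).
    move=> mw wu; apply: (L2_dom _ _ _ fi); first exact: Cmeasurable_real.
    by move=> x; rewrite normsq_real (le_trans (wu x)).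
  split; first exact: L.
  have Lp : L2 mu (fun x => (u^\+ x)%:C%C).
    apply: L; first exact: measurable_funrpos.
    move=> x; rewrite /funrpos; case: (leP (u x) 0) => h; last by [].
    by rewrite expr0n sqr_ge0.
  have Ln : L2 mu (fun x => (u^\- x)%:C%C).
    apply: L; first exact: measurable_funrneg.
    move=> x; rewrite /funrneg; case: (leP (- u x) 0) => h; first by rewrite expr0n sqr_ge0.
    by rewrite sqrrN.
  have := L2_closure_lin (-1) bL Ln Lp (cl_nneg _ Ln) (cl_nneg _ Lp).
  rewrite (_ : (fun x => _ + _) = (fun x => (u x)%:C%C)); first by apply=> x;
    rewrite /funrpos /funrneg le_max lexx orbT.
  apply/funext => x; rewrite mulN1r addrC -rmorphB/=; congr (_%:C)%C.
  by have /(congr1 (fun f => f x)) := funrposBneg u.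
move=> f fL; have [mf1 mf2 _] := fL.
have [|L1 c1] := key _ _ fL mf1; first by move=> x; rewrite lerDl sqr_ge0.
have [|L2' c2] := key _ _ fL mf2; first by move=> x; rewrite lerDr sqr_ge0.
have := L2_closure_lin 'i%C bL L2' L1 c2 c1; congr (L2_closure mu b).
by apply/funext => x; rewrite [RHS]complexE addrC.
Qed.

End L2_dense_indicators.

Section norm1.
Variable R : realType.
Implicit Types z w : R[i].

(** The sum norm on the plane: it bounds both parts at once, is submultiplicative, and is integrable
    as soon as the two parts are. *)
Definition norm1 z : R := `|complex.Re z| + `|complex.Im z|.

Lemma norm1_ge0 z : 0 <= norm1 z. Proof. exact: addr_ge0. Qed.

Lemma norm1M z w : norm1 (z * w) <= norm1 z * norm1 w.
Proof.
rewrite /norm1 !ReImE mulrDl !mulrDr -!normrM.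
apply: (le_trans (lerD (ler_normB _ _) (ler_normD _ _))).
by rewrite le_eqVlt; apply/orP; left; apply/eqP; ring.
Qed.

Lemma Re_norm1 z : `|complex.Re z| <= norm1 z. Proof. by rewrite lerDl. Qed.
Lemma Im_norm1 z : `|complex.Im z| <= norm1 z. Proof. by rewrite lerDr. Qed.

Lemma norm1_le2 z : normsq z <= 1 -> norm1 z <= 2.
Proof.
move=> z1; rewrite /norm1 -[2]/(1 + 1); apply: lerD.
  rewrite -(ler_pXn2r (n := 2))// ?nnegrE// expr1n.
  exact: le_trans (normsq_Re z) z1.
rewrite -(ler_pXn2r (n := 2))// ?nnegrE// expr1n.
exact: le_trans (normsq_Im z) z1.
Qed.

End norm1.

Section Cintegrable_norm1.
Context d (T : measurableType d) (R : realType) (mu : {measure set T -> \bar R}).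

Lemma integrable_norm1 (f : T -> R[i]) : Cintegrable mu f ->
  mu.-integrable setT (EFin \o (fun x => norm1 (f x))).
Proof.
move=> [f1 f2]; have := integrableD measurableT (integrable_norm f1) (integrable_norm f2).
exact: eq_integrable.
Qed.

Lemma Cintegrable_bounded_mul (f k : T -> R[i]) : Cintegrable mu f -> Cmeasurable k ->
  (forall x, normsq (k x) <= 1) -> Cintegrable mu (fun x => f x * k x).
Proof.
move=> fi mk k1; have fi1 := integrable_norm1 fi.
have mf := Cintegrable_Cmeasurable fi.
have le x : norm1 (f x * k x) <= 2 * norm1 (f x) + 0 * norm1 (f x).
  rewrite mul0r addr0 (le_trans (norm1M _ _))// mulrC.
  by rewrite ler_wpM2r ?norm1_ge0// norm1_le2.
apply: (Cintegrable_dom _ _ _ _ (Rintegrable_lin 2 0 fi1 fi1)).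
- exact: CmeasurableM.
- by move=> x; exact: le_trans (Re_norm1 _) (le x).
- by move=> x; exact: le_trans (Im_norm1 _) (le x).
Qed.

End Cintegrable_norm1.

(** * Fubini for complex integrals *)

Section C_fubini.
Context d1 d2 (T1 : measurableType d1) (T2 : measurableType d2) (R : realType).
Context (m1 : {sigma_finite_measure set T1 -> \bar R}).
Context (m2 : {sigma_finite_measure set T2 -> \bar R}).
Local Notation C := R[i].

(** The inner integral is finite for almost every [x] only; elsewhere [fine] still gives it a real
    value, so the real and the extended iterated integrals are compared almost everywhere. *)
Lemma C_fubini1 (H : T1 * T2 -> C) : Cintegrable (m1 \x m2)%E H ->
  Cintegral (m1 \x m2)%E H = Cintegral m1 (fun x => Cintegral m2 (fun y => H (x, y))) /\
  Cmeasurable (fun x => Cintegral m2 (fun y => H (x, y))).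
Proof.
move=> [H1 H2].
have mH (h : T1 * T2 -> R) : (m1 \x m2)%E.-integrable setT (EFin \o h) ->
    measurable_fun setT (fun x => \int[m2]_y h (x, y)).
  move=> hi; apply: (measurableT_comp (fine_measurable measurableT)).
  exact: (measurable_fubini_F hi).
split; last by split; [exact: (mH _ H1)|exact: (mH _ H2)].
have E (h : T1 * T2 -> R) : (m1 \x m2)%E.-integrable setT (EFin \o h) ->
    \int[(m1 \x m2)%E]_z h z = \int[m1]_x (\int[m2]_y h (x, y)).
  move=> hi; rewrite /Rintegral; congr fine.
  rewrite -(integral12_prod_meas1 hi); apply: ae_eq_integral => //.
  - exact: (measurable_fubini_F hi).
  - by apply/measurable_EFinP; exact: mH.
  - apply: filterS (ae_integrable1 hi) => x ix _.
    by rewrite /fubini_F /= fineK//; exact: integrable_fin_num.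
by apply: eq_ReIm => /=; [exact: (E _ H1)|exact: (E _ H2)].
Qed.

Lemma C_fubini2 (H : T1 * T2 -> C) : Cintegrable (m1 \x m2)%E H ->
  Cintegral (m1 \x m2)%E H = Cintegral m2 (fun y => Cintegral m1 (fun x => H (x, y))) /\
  Cmeasurable (fun y => Cintegral m1 (fun x => H (x, y))).
Proof.
move=> [H1 H2].
have mH (h : T1 * T2 -> R) : (m1 \x m2)%E.-integrable setT (EFin \o h) ->
    measurable_fun setT (fun y => \int[m1]_x h (x, y)).
  move=> hi; apply: (measurableT_comp (fine_measurable measurableT)).
  exact: (measurable_fubini_G hi).
split; last by split; [exact: (mH _ H1)|exact: (mH _ H2)].
have E (h : T1 * T2 -> R) : (m1 \x m2)%E.-integrable setT (EFin \o h) ->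
    \int[(m1 \x m2)%E]_z h z = \int[m2]_y (\int[m1]_x h (x, y)).
  move=> hi; rewrite /Rintegral; congr fine.
  rewrite -(integral21_prod_meas1 hi); apply: ae_eq_integral => //.
  - exact: (measurable_fubini_G hi).
  - by apply/measurable_EFinP; exact: mH.
  - apply: filterS (ae_integrable2 hi) => x ix _.
    by rewrite /fubini_G /= fineK//; exact: integrable_fin_num.
by apply: eq_ReIm => /=; [exact: (E _ H1)|exact: (E _ H2)].
Qed.

Lemma integrable_prod (u : T1 -> R) (v : T2 -> R) :
  m1.-integrable setT (EFin \o u) -> m2.-integrable setT (EFin \o v) ->
  (m1 \x m2)%E.-integrable setT (EFin \o (fun z => u z.1 * v z.2)).
Proof.
move=> ui vi.
have /measurable_EFinP mu := measurable_int _ ui.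
have /measurable_EFinP mv := measurable_int _ vi.
apply/integrable12ltyP.
  apply/measurable_EFinP; apply: measurable_funM.
    exact: (measurableT_comp mu).
  exact: (measurableT_comp mv).
under eq_integral => x _.
  under eq_integral do rewrite /= normrM EFinM.
  rewrite ge0_integralZl//; [|by apply/measurable_EFinP; exact: measurableT_comp].
  over.
have /integrableP[_ vo] := vi; have /integrableP[_ uo] := ui.
have vf : (\int[m2]_y `|v y|%:E)%E \is a fin_num.
  by rewrite ge0_fin_numE//; exact: integral_ge0.
rewrite -(fineK vf) ge0_integralZr//=; last 2 first.
- by apply/measurable_EFinP; exact: measurableT_comp.
- by rewrite lee_fin fine_ge0//; exact: integral_ge0.
apply: lte_mul_pinfty; [exact: integral_ge0| |by rewrite ltry].
by rewrite ge0_fin_numE//; exact: integral_ge0.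
Qed.

Lemma Cmeasurable_fst (f : T1 -> C) : Cmeasurable f ->
  Cmeasurable (fun z : T1 * T2 => f z.1).
Proof.
by move=> [f1 f2]; split; [exact: (measurableT_comp f1)|exact: (measurableT_comp f2)].
Qed.

Lemma Cmeasurable_snd (f : T2 -> C) : Cmeasurable f ->
  Cmeasurable (fun z : T1 * T2 => f z.2).
Proof.
by move=> [f1 f2]; split; [exact: (measurableT_comp f1)|exact: (measurableT_comp f2)].
Qed.

End C_fubini.

(** * Composition with a measure-preserving map *)

Section pushforward_L2.
Context d (T : measurableType d) (R : realType) (mu : {measure set T -> \bar R}).
Variable neg : T -> T.
Hypothesis mneg : measurable_fun setT neg.
Hypothesis neg_mu : forall A, measurable A -> mu (neg @^-1` A) = mu A.
Implicit Types f g : T -> R[i].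

Lemma ge0_integral_comp (u : T -> \bar R) : measurable_fun setT u ->
  (forall x, 0 <= u x)%E -> (\int[mu]_x u (neg x) = \int[mu]_x u x)%E.
Proof.
move=> mu' u0.
have := ge0_integral_pushforward mneg mu measurableT mu' (fun x _ => u0 x).
rewrite preimage_setT => <-; apply: eq_measure_integral => A mA _.
exact: neg_mu.
Qed.

Lemma Cmeasurable_comp f : Cmeasurable f -> Cmeasurable (fun x => f (neg x)).
Proof.
by move=> [f1 f2]; split; [exact: (measurableT_comp f1)|exact: (measurableT_comp f2)].
Qed.

Lemma L2_comp f : L2 mu f -> L2 mu (fun x => f (neg x)).
Proof.
move=> /L2P[mf /integrableP[mi io]]; apply/L2P; split; first exact: Cmeasurable_comp.
apply/integrableP; split.
  by apply/measurable_EFinP; apply: measurable_normsq; exact: Cmeasurable_comp.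
rewrite (ge0_integral_comp (u := fun x => `|(normsq (f x))%:E|%E))//.
exact: measurableT_comp.
Qed.

Lemma nsq_comp f : Cmeasurable f -> nsq mu (fun x => f (neg x)) = nsq mu f.
Proof.
move=> mf; rewrite /nsq /Rintegral; congr fine.
rewrite (ge0_integral_comp (u := fun x => (normsq (f x))%:E))//.
  by apply/measurable_EFinP; exact: measurable_normsq.
by move=> x; rewrite lee_fin normsq_ge0.
Qed.

Lemma ae_comp f g : f = g %[ae mu] -> (fun x => f (neg x)) = (fun x => g (neg x)) %[ae mu].
Proof.
move=> [N [mN N0 sN]]; exists (neg @^-1` N); split.
- by rewrite -[_ @^-1` _]setTI; exact: mneg.
- by rewrite neg_mu.
- by move=> x /= H; apply: sN => /= H'; apply: H => _; exact: H'.
Qed.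

Lemma L2_bounded_neg : L2_bounded_operator mu (fun f x => f (neg x)).
Proof.
apply/L2_boundedP; split.
- exact: L2_comp.
- by move=> *; exact: nearW.
- by exists 1 => f /L2P[mf _]; rewrite mul1r /nrm nsq_comp.
Qed.

End pushforward_L2.

Section L2_functional.
Context d (T : measurableType d) (R : realType) (mu : {measure set T -> \bar R}).
Implicit Types f g : T -> R[i].

(** A one-sided bound on the real part is enough: by density it yields [Re (L f) <= 0], and applied
    to [a * f] with [a] equal to 1, -1, i and -i this forces [L f = 0]. *)
Lemma functional_eq0 (I : Type) (b : I -> T -> R[i]) (L : (T -> R[i]) -> R[i]) (M : R) :
  (forall i, L2 mu (b i)) -> L2_dense mu b ->
  (forall a f g, L2 mu f -> L2 mu g -> L (fun x => a * f x + g x) = a * L f + L g) ->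
  (forall f, L2 mu f -> complex.Re (L f) <= M * nrm mu f) ->
  (forall i, L (b i) = 0) -> forall f, L2 mu f -> L f = 0.
Proof.
move=> bL bd Llin LM Lb.
have L0 : L (fun=> 0) = 0.
  have := Llin (-1) _ _ (L2_0 mu) (L2_0 mu).
  have aux (z : R[i]) : -1 * z + z = 0 by rewrite mulN1r addNr.
  rewrite (aux (L (fun=> 0))) => h; rewrite -[RHS]h.
  by congr L; apply/funext => x; rewrite mulr0 addr0.
have Llc l : L (lcomb b l) = 0.
  elim: l => [|[a i] l IH]; first by rewrite lcomb_nil.
  by rewrite lcomb_cons Llin ?Lb ?IH ?mulr0 ?addr0//; exact: L2_lcomb.
have Re_le f : L2 mu f -> complex.Re (L f) <= 0.
  move=> fL; apply: (@le0_of_le_eps _ _ `|M|) => e /(bd _ fL)[l fl].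
  have lL := L2_lcomb l bL.
  have -> : L f = L (fun x => f x - lcomb b l x).
    rewrite (_ : (fun x => f x - lcomb b l x) = (fun x => -1 * lcomb b l x + f x)).
      by rewrite Llin// Llc mulr0 add0r.
    by apply/funext => x; rewrite mulN1r addrC.
  rewrite (le_trans (LM _ (L2B fL lL)))//.
  apply: (le_trans (ler_wpM2r (nrm_ge0 _ _) (ler_norm M))).
  by rewrite ler_wpM2l.
have Lz a f : L2 mu f -> L (fun x => a * f x) = a * L f.
  move=> fL; have := Llin a _ _ fL (L2_0 mu); rewrite L0 addr0 => <-.
  by congr L; apply/funext => x; rewrite addr0.
move=> f fL; have h a : complex.Re (a * L f) <= 0.
  by rewrite -Lz//; apply: Re_le; exact: L2Z.
have := h 1; have := h (-1); have := h 'i%C; have := h (- 'i)%C.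
rewrite !ReM !ReN !ImN/= => h1 h2 h3 h4.
by apply: eq_ReIm => /=; apply/eqP; rewrite eq_le; apply/andP; split; lra.
Qed.

(** The bounded functional [g |-> ip g f] vanishes on the family, hence on [f] itself. *)
Lemma orthogonal_dense (I : Type) (b : I -> T -> R[i]) f : (forall i, L2 mu (b i)) ->
  L2_dense mu b -> L2 mu f -> (forall i, ip mu f (b i) = 0) -> f = (fun=> 0) %[ae mu].
Proof.
move=> bL bd fL fb.
have : ip mu f f = 0.
  rewrite ip_conj//; apply/eqP; rewrite conjc_eq0; apply/eqP.
  apply: (functional_eq0 (L := ip mu ^~ f) (M := nrm mu f) bL bd) => //.
  - by move=> a g h gL hL; exact: ip_linl.
  - by move=> g gL; rewrite mulrC; exact: Re_ip_le.
  - by move=> i; rewrite ip_conj// fb conjc0.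
by rewrite ip_nsq => /(congr1 (@complex.Re R)) /=; exact: nsq_eq0.
Qed.

End L2_functional.

(** * Transforms given by a unimodular kernel *)

Lemma Cintegrable_tensor d1 d2 (T1 : measurableType d1) (T2 : measurableType d2)
    (R : realType) (m1 : {sigma_finite_measure set T1 -> \bar R})
    (m2 : {sigma_finite_measure set T2 -> \bar R}) (f : T1 -> R[i]) (g : T2 -> R[i]) :
  Cintegrable m1 f -> Cintegrable m2 g ->
  Cintegrable (m1 \x m2)%E (fun z => f z.1 * g z.2).
Proof.
move=> fi gi; have mf := Cintegrable_Cmeasurable fi; have mg := Cintegrable_Cmeasurable gi.
have le z : norm1 (f z.1 * g z.2) <= norm1 (f z.1) * norm1 (g z.2) by exact: norm1M.
apply: (Cintegrable_dom (fun z => norm1 (f z.1) * norm1 (g z.2))).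
- by apply: CmeasurableM; [exact: Cmeasurable_fst|exact: Cmeasurable_snd].
- by move=> z; exact: le_trans (Re_norm1 _) (le z).
- by move=> z; exact: le_trans (Im_norm1 _) (le z).
- exact: (integrable_prod (integrable_norm1 fi) (integrable_norm1 gi)).
Qed.

Section kernel_transform.
Context d (T : measurableType d) (R : realType) (mu : {sigma_finite_measure set T -> \bar R}).
Variable K : T -> T -> R[i].
Hypothesis mK : Cmeasurable (fun z : T * T => K z.1 z.2).
Hypothesis K1 : forall x y, normsq (K x y) <= 1.
Hypothesis Ksym : forall x y, K x y = K y x.
Implicit Types f g : T -> R[i].

Definition kernel_hat f xi := Cintegral mu (fun x => f x * K x xi).
Local Notation hat := kernel_hat.

Lemma Cmeasurable_kernel xi : Cmeasurable (fun x => K x xi).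
Proof.
case: mK => k1 k2; split.
  exact: (measurableT_comp k1 (measurable_pair2 xi)).
exact: (measurableT_comp k2 (measurable_pair2 xi)).
Qed.

Lemma Cintegrable_kernel f xi : Cintegrable mu f -> Cintegrable mu (fun x => f x * K x xi).
Proof.
by move=> fi; apply: Cintegrable_bounded_mul => //; exact: Cmeasurable_kernel.
Qed.

Lemma Cintegrable_kernel2 f g : Cintegrable mu f -> Cintegrable mu g ->
  Cintegrable (mu \x mu)%E (fun z => f z.1 * g z.2 * K z.1 z.2).
Proof.
move=> fi gi; apply: Cintegrable_bounded_mul => //.
exact: Cintegrable_tensor.
Qed.

Lemma kernel_hat_mulr f g xi : Cintegrable mu f ->
  Cintegral mu (fun x => f x * g xi * K x xi) = hat f xi * g xi.
Proof.
move=> fi; rewrite mulrC -CintegralZ; last exact: Cintegrable_kernel.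
by apply: eq_Cintegral => x; ring.
Qed.

Lemma Cmeasurable_hat_mul f g : Cintegrable mu f -> Cintegrable mu g ->
  Cmeasurable (fun xi => hat f xi * g xi).
Proof.
move=> fi gi; have [_] := C_fubini2 (Cintegrable_kernel2 fi gi).
by congr Cmeasurable; apply/funext => xi /=; exact: kernel_hat_mulr.
Qed.

(** Both sides are the double integral of [f x * g xi * K x xi], absolutely convergent because [K]
    is bounded; [Ksym] turns the inner integral of the second order into [hat g]. *)
Lemma kernel_fubini f g : Cintegrable mu f -> Cintegrable mu g ->
  Cintegral mu (fun xi => hat f xi * g xi) = Cintegral mu (fun x => f x * hat g x).
Proof.
move=> fi gi; have H := Cintegrable_kernel2 fi gi.
have [e1 _] := C_fubini1 H; have [e2 _] := C_fubini2 H.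
transitivity (Cintegral (mu \x mu)%E (fun z => f z.1 * g z.2 * K z.1 z.2)).
  by rewrite e2; apply: eq_Cintegral => xi /=; rewrite kernel_hat_mulr.
rewrite e1; apply: eq_Cintegral => x /=.
rewrite -CintegralZ; last exact: Cintegrable_kernel.
by apply: eq_Cintegral => y; rewrite (Ksym y x); ring.
Qed.

(** The factor 4 is crude: [norm1] is at most 2 where [normsq] is at most 1, and the two parts are
    bounded separately. *)
Lemma norm1_hat f xi : Cintegrable mu f ->
  norm1 (hat f xi) <= 4 * \int[mu]_x norm1 (f x).
Proof.
move=> fi; have fi1 := integrable_norm1 fi.
have [k1 k2] := Cintegrable_kernel xi fi.
have le x : norm1 (f x * K x xi) <= 2 * norm1 (f x).
  by rewrite (le_trans (norm1M _ _))// mulrC ler_wpM2r ?norm1_ge0// norm1_le2.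
have fi2 : mu.-integrable setT (EFin \o (fun x => 2 * norm1 (f x))).
  by have := integrableZl measurableT 2 fi1; exact: eq_integrable.
have key (u : T -> R) : mu.-integrable setT (EFin \o u) ->
    (forall x, `|u x| <= 2 * norm1 (f x)) -> `|\int[mu]_x u x| <= 2 * \int[mu]_x norm1 (f x).
  move=> ui ule; rewrite (le_trans (le_normr_Rintegral _ ui))//.
  rewrite -RintegralZl//; apply: le_Rintegral => //.
  by have := integrable_norm ui; exact: eq_integrable.
have -> : 4 * \int[mu]_x norm1 (f x) =
    2 * \int[mu]_x norm1 (f x) + 2 * \int[mu]_x norm1 (f x) by ring.
rewrite [leLHS]/norm1; apply: lerD.
  by apply: (key _ k1) => x; exact: le_trans (Re_norm1 _) (le x).
by apply: (key _ k2) => x; exact: le_trans (Im_norm1 _) (le x).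
Qed.

Variable neg : T -> T.
Hypothesis mneg : measurable_fun setT neg.
Hypothesis neg_mu : forall A, measurable A -> mu (neg @^-1` A) = mu A.
Hypothesis Kneg : forall x xi, K x (neg xi) = conjc (K x xi).

Context (I : Type) (G : I -> set T) (E : nat -> I).
Hypothesis mG : forall i, measurable (G i).
Hypothesis Goo : forall i, (mu (G i) < +oo)%E.
Hypothesis GI : forall i j, G i `&` G j = set0 \/ exists k, G i `&` G j = G k.
Hypothesis sG : forall A, measurable A -> <<s range G >> A.
Hypothesis ndE : forall n m, (n <= m)%N -> G (E n) `<=` G (E m).
Hypothesis ET : \bigcup_n G (E n) = setT.
Local Notation b := (fun i => indC R (G i)).
Hypothesis hatL : forall i, L2 mu (hat (b i)).
Hypothesis hat_ip : forall i j, ip mu (hat (b i)) (hat (b j)) = ip mu (b i) (b j).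

Let bL i : L2 mu (b i). Proof. exact: (L2_indC (mG i) (Goo i)). Qed.
Let bd : L2_dense mu b. Proof. exact: (L2_dense_indC mG Goo GI sG ndE ET). Qed.
Let bi i : Cintegrable mu (b i).
Proof.
split; first exact: (integrable_indic_fin (mG i) (Goo i)).
exact: integrable0.
Qed.

Lemma Cint_op_ae F f g h : L2_bounded_operator mu F -> L2 mu f -> L2 mu g -> L2 mu h ->
  F f = g %[ae mu] -> Cintegral mu (fun x => F f x * h x) = Cintegral mu (fun x => g x * h x).
Proof.
move=> FB fL gL hL fg; have Ff := op_L2 FB fL.
apply: Cintegral_ae.
- exact: (CmeasurableM (L2_Cmeasurable Ff) (L2_Cmeasurable hL)).
- exact: (CmeasurableM (L2_Cmeasurable gL) (L2_Cmeasurable hL)).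
- by apply: filterS fg => x /= e Dx; rewrite e.
Qed.

(* The identity holds for indicators by Fubini, and both sides are bounded
   bilinear forms on L2. *)
Lemma transform_mul F f g : L2_isometry mu F -> (forall i, F (b i) = hat (b i) %[ae mu]) ->
  L2 mu f -> L2 mu g ->
  Cintegral mu (fun x => F f x * g x) = Cintegral mu (fun x => f x * F g x).
Proof.
move=> FI Fb; have /op_isometry[FB Fn] := FI.
pose D f g := Cintegral mu (fun x => F f x * g x) - Cintegral mu (fun x => f x * F g x).
(* By this antisymmetry, linearity and bounds need only be shown in the first argument. *)
have DC f' g' : D f' g' = - D g' f'.
  by rewrite /D opprB; congr (_ - _); apply: eq_Cintegral => x; exact: mulrC.
have Dlin h a f' g' : L2 mu h -> L2 mu f' -> L2 mu g' ->
    D (fun x => a * f' x + g' x) h = a * D f' h + D g' h.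
  move=> hL fL gL; have L : L2 mu (fun x => a * f' x + g' x) by apply: L2D => //; exact: L2Z.
  have Fh := op_L2 FB hL; have Ff := op_L2 FB fL; have Fg := op_L2 FB gL.
  have FL : L2 mu (fun x => a * F f' x + F g' x) by apply: L2D => //; exact: L2Z.
  have lin u v w : L2 mu u -> L2 mu v -> L2 mu w ->
      Cintegral mu (fun x => (a * u x + v x) * w x) =
      a * Cintegral mu (fun x => u x * w x) + Cintegral mu (fun x => v x * w x).
    move=> uL vL wL; rewrite -CintegralZ; last exact: Cintegrable_mul.
    rewrite -CintegralD.
    - by apply: eq_Cintegral => x; ring.
    - by apply: CintegrableZ; exact: Cintegrable_mul.
    - exact: Cintegrable_mul.
  rewrite /D (Cint_op_ae FB L FL hL (op_lin FB a fL gL)) !lin//.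
  by rewrite mulrBr; ring.
have Dle f' g' : L2 mu f' -> L2 mu g' -> complex.Re (D f' g') <= 2 * nrm mu f' * nrm mu g'.
  move=> fL gL; have Ff := op_L2 FB fL; have Fg := op_L2 FB gL.
  have e u v : Cintegral mu (fun x => u x * v x) = ip mu u (fun x => conjc (v x)).
    by apply: eq_Cintegral => x; rewrite conjcK.
  have nc u : nrm mu (fun x => conjc (u x)) = nrm mu u by rewrite /nrm nsq_conj.
  have h1 := Re_ip_le Ff (L2_conj gL).
  have h2 := Re_ip_le (L2N fL) (L2_conj Fg).
  move: h1 h2; rewrite nrmN !nc !Fn// -!e => h1 h2.
  rewrite /D !ReImE; have -> : - complex.Re (Cintegral mu (fun x => f' x * F g' x)) =
      complex.Re (Cintegral mu (fun x => - f' x * F g' x)).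
    rewrite (_ : (fun x => - f' x * F g' x) = (fun x => -1 * (f' x * F g' x))).
      by rewrite CintegralZ; [rewrite mulN1r ReN|exact: Cintegrable_mul].
    by apply/funext => x; ring.
  by move: h1 h2; lra.
have Dbb i j : D (b i) (b j) = 0.
  rewrite /D (Cint_op_ae FB (bL i) (hatL i) (bL j) (Fb i)).
  have -> : Cintegral mu (fun x => b i x * F (b j) x) = Cintegral mu (fun x => b i x * hat (b j) x).
    have := Cint_op_ae FB (bL j) (hatL j) (bL i) (Fb j).
    by under eq_Cintegral do rewrite mulrC; under [RHS]eq_Cintegral do rewrite mulrC.
  by rewrite kernel_fubini ?subrr.
have Dfb f' j : L2 mu f' -> D f' (b j) = 0.
  apply: (functional_eq0 (L := D ^~ (b j)) (M := 2 * nrm mu (b j)) bL bd) => //.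
  - by move=> a u v uL vL; exact: Dlin.
  - by move=> u uL; rewrite mulrAC; exact: Dle.
(* Antisymmetry brings [g] to the first place, where the passage from the family to [L2] can be made
   a second time. *)
move=> fL gL; apply/eqP; rewrite -subr_eq0 -[_ - _]/(D f g) DC oppr_eq0; apply/eqP.
apply: (functional_eq0 (L := D ^~ f) (M := 2 * nrm mu f) bL bd _ _ _ gL).
- by move=> a u v uL vL; exact: Dlin.
- by move=> u uL; rewrite mulrAC; exact: Dle.
- by move=> i; rewrite DC Dfb ?oppr0.
Qed.

(** The second property identifies [F] with the integral on Schwartz and test functions, which are
    both integrable and in [L2]; it cannot be inferred from the indicators by continuity in [L2]
    alone, since convergence in [L2] does not control the integrals. *)
Lemma kernel_transform : exists F, [/\ L2_isometry mu F,
  forall f, Cintegrable mu f -> L2 mu f -> F f = hat f %[ae mu] &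
  forall f, L2 mu f -> F (fun xi => F f (neg xi)) = f %[ae mu]].
Proof.
have [F [FI Fb]] := L2_extend bL hatL hat_ip bd.
exists F; have /op_isometry[FB Fn] := FI; split => //.
  move=> f fi fL; have Ff := op_L2 FB fL.
  (* The function [hat f] is bounded but possibly not in [L2]; multiplied by the indicator of a set
     of finite measure it is. *)
  have EF n : (fun xi => (F f xi - hat f xi) * b (E n) xi) = (fun=> 0) %[ae mu].
    have hm : Cmeasurable (fun xi => hat f xi * b (E n) xi) by exact: Cmeasurable_hat_mul.
    have L1 : L2 mu (fun xi => hat f xi * b (E n) xi).
      pose M := 4 * \int[mu]_x norm1 (f x).
      apply: (L2_dom (fun xi => (2 * M ^+ 2) * \1_(G (E n)) xi) hm).
        move=> xi; rewrite normsqM normsq_indC ler_wpM2r//.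
        have := norm1_hat xi fi; rewrite -/M.
        rewrite /norm1 /normsq -(real_normK (num_real (complex.Re _))).
        rewrite -(real_normK (num_real (complex.Im _))).
        have := normr_ge0 (complex.Re (hat f xi)); have := normr_ge0 (complex.Im (hat f xi)).
        by move: `|_| `|_| => p q *; nra.
      have := integrableZl measurableT (2 * M ^+ 2) (integrable_indic_fin (mG (E n)) (Goo (E n))).
      exact: eq_integrable.
    have L2' : L2 mu (fun xi => F f xi * b (E n) xi).
      apply: (L2_dom _ _ _ (L2_integrable Ff)).
        exact: (CmeasurableM (L2_Cmeasurable Ff) (L2_Cmeasurable (bL _))).
      move=> x; rewrite normsqM normsq_indC.
      apply: ler_piMr; first exact: normsq_ge0.
      by rewrite indicE lern1; case: (_ \in _).
    have L : L2 mu (fun xi => (F f xi - hat f xi) * b (E n) xi).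
      have := L2B L2' L1; congr (L2 mu).
      by apply/funext => x; rewrite mulrBl.
    (* Against [b j] the product of the two indicators is 0 or some [b k], and [int F f * b k = int
       f * F (b k) = int f * hat (b k) = int hat f * b k]. *)
    apply: (orthogonal_dense bL bd) => // j.
    have [e|[k e]] := GI (E n) j.
      rewrite /ip (_ : (fun x => _) = (fun=> 0)); last first.
        apply/funext => x; rewrite conj_indC -mulrA -indCI e.
        by rewrite /indC indic0 mulr0.
      by rewrite /Cintegral/= !Rintegral_cst// !mul0r.
    rewrite /ip (_ : (fun x => _) = (fun x => F f x * b k x + -1 * (hat f x * b k x))); last first.
      apply/funext => x; rewrite conj_indC -mulrA -indCI e; ring.
    have hi : Cintegrable mu (fun x => hat f x * b k x).
      have := Cintegrable_dom (fun x => (4 * \int[mu]_x norm1 (f x)) * \1_(G k) x)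
        (Cmeasurable_hat_mul fi (bi k)).
      have le x : norm1 (hat f x * b k x) <= (4 * \int[mu]_x norm1 (f x)) * \1_(G k) x.
        rewrite (le_trans (norm1M _ _))//; apply: ler_pM; rewrite ?norm1_ge0 ?norm1_hat//.
        by rewrite /norm1/= normr0 addr0 ger0_norm.
      apply.
      - by move=> x; exact: le_trans (Re_norm1 _) (le x).
      - by move=> x; exact: le_trans (Im_norm1 _) (le x).
      - have := integrableZl measurableT (4 * \int[mu]_x norm1 (f x)) (integrable_indic_fin (mG k) (Goo k)).
        exact: eq_integrable.
    rewrite CintegralD; [|exact: Cintegrable_mul|exact: CintegrableZ].
    rewrite CintegralZ// (transform_mul FI Fb)// kernel_fubini//.
    have -> : Cintegral mu (fun x => f x * F (b k) x) = Cintegral mu (fun x => f x * hat (b k) x).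
      have := Cint_op_ae FB (bL k) (hatL k) fL (Fb k).
      by under eq_Cintegral do rewrite mulrC; under [RHS]eq_Cintegral do rewrite mulrC.
    by rewrite mulN1r subrr.
  have := ae_foralln EF; apply: filterS => x H _.
  have : setT x by []; rewrite -ET => -[n _ nx].
  have := H n Logic.I; rewrite /indC indicE mem_set// mulr1 => /eqP.
  by rewrite subr_eq0 => /eqP.
pose J := fun (f : T -> R[i]) x => f (neg x).
have JB : L2_bounded_operator mu J by exact: L2_bounded_neg.
have FJFB := L2_bounded_comp FB (L2_bounded_comp JB FB).
(* Both [F J F] and the identity are bounded operators, so inversion need only be checked on the
   family. *)
apply: (op_unique bL bd FJFB (L2_bounded_id mu)) => i.
have FbL := op_L2 FB (bL i); have JFbL := op_L2 JB FbL; have FJ := op_L2 FB JFbL.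
have L : L2 mu (fun x => F (J (F (b i))) x - b i x) by exact: L2B.
suff : (fun x => F (J (F (b i))) x - b i x) = (fun=> 0) %[ae mu].
  by apply: filterS => x /= h Dx; apply/eqP; rewrite -subr_eq0; apply/eqP; exact: h.
apply: (orthogonal_dense bL bd) => // j.
have -> : (fun x => F (J (F (b i))) x - b i x) = (fun x => -1 * b i x + F (J (F (b i))) x).
  by apply/funext => x; rewrite mulN1r addrC.
rewrite ip_linl// mulN1r; apply/eqP; rewrite addrC subr_eq0; apply/eqP.
(* Symmetry turns this into [int (J F b_i) * (F b_j)], and [J F b_i] is the conjugate of [hat b_i]
   by [Kneg], indicators being real. What remains is [ip (hat b_j) (hat b_i)], which [hat_ip]
   evaluates as the measure of the intersection. *)
have -> : ip mu (F (J (F (b i)))) (b j) = Cintegral mu (fun x => F (J (F (b i))) x * b j x).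
  by apply: eq_Cintegral => x; rewrite /indC conjc_real.
rewrite (transform_mul FI Fb)//.
have hJ : J (F (b i)) = (fun xi => conjc (hat (b i) xi)) %[ae mu].
  have := ae_comp mneg neg_mu (Fb i); apply: filterS => x h Dx.
  have {h} : F (b i) (neg x) = hat (b i) (neg x) by exact: h Dx.
  rewrite /J => ->; rewrite /kernel_hat -Cintegral_conj; last exact: Cintegrable_kernel.
  by apply: eq_Cintegral => y; rewrite Kneg conjcM conj_indC.
have -> : Cintegral mu (fun x => J (F (b i)) x * F (b j) x) = ip mu (hat (b j)) (hat (b i)).
  apply: Cintegral_ae.
  - exact: (CmeasurableM (L2_Cmeasurable JFbL) (L2_Cmeasurable (op_L2 FB (bL j)))).
  - apply: (CmeasurableM (L2_Cmeasurable (hatL j))).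
    exact: (Cmeasurable_conj (L2_Cmeasurable (hatL i))).
  - move: hJ (Fb j); apply: filterS2 => x h1 h2 Dx.
    by rewrite (h1 Dx) (h2 Dx) mulrC.
rewrite hat_ip !ip_indC//; first by rewrite setIC.
- by apply: le_lt_trans (Goo i); apply: le_measure; rewrite ?inE//; exact: measurableI.
- by apply: le_lt_trans (Goo j); apply: le_measure; rewrite ?inE//; exact: measurableI.
Qed.

End kernel_transform.

(** * The real line *)

Section half_line.
Variable R : realType.
Local Notation leb := (@lebesgue_measure R).
Implicit Types f F g : R -> R.

Lemma is_derive_continuous f df : (forall x, is_derive x (1 : R) f (df x)) -> continuous f.
Proof.
by move=> fd x; apply: differentiable_continuous; apply/derivable1_diffP; have [] := fd x.
Qed.

Lemma integral_0y_antiderivative f F (l : R) : (forall x, 0 <= x -> 0 <= f x) ->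
  continuous f -> (forall x, is_derive x (1 : R) F (f x)) -> F x @[x --> +oo] --> l ->
  (\int[leb]_(x in `[0%R, +oo[) (f x)%:E = (l - F 0)%:E)%E.
Proof.
move=> f0 cf dF Fl; have cF := is_derive_continuous dF.
rewrite (ge0_continuous_FTC2y f0 _ Fl) ?EFinB//.
- exact: continuous_subspaceT.
- by apply: cvg_at_right_filter; exact: cF.
- by move=> x _; rewrite derive1E; exact: derive_val.
Qed.

Lemma cvgy_le0 f (M : R) : (\forall x \near +oo, `|f x| <= M / x) -> f x @[x --> +oo] --> 0.
Proof.
move=> fM; apply/cvgrPdist_le => e e0.
near=> x; rewrite sub0r normrN.
have x0 : 0 < x by near: x; exact: nbhs_pinfty_gt.
have h : `|f x| <= M / x by near: x.
have : M / e <= x by near: x; apply: nbhs_pinfty_ge; rewrite num_real.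
by rewrite ler_pdivrMr// mulrC => Me; apply: (le_trans h); rewrite ler_pdivrMr.
Unshelve. all: by end_near. Qed.

Lemma expRN_le (y : R) : 0 < y -> expR (- y) <= y^-1.
Proof.
move=> y0; rewrite expRN lef_pV2 ?posrE ?expR_gt0//.
by rewrite (le_trans _ (expR_ge1Dx y))// lerDr.
Qed.

(** From [1 + y ^+ 2 / 2 <= expR y]. *)
Lemma mul_expRN_le (y : R) : 0 < y -> y * expR (- y) <= 2 / y.
Proof.
move=> y0; rewrite expRN ler_pdivrMr ?expR_gt0// mulrAC ler_pdivlMr//.
have := @expR_ge1Dxn R y 1 (ltW y0); rewrite (_ : 2`!%:R = 2)// => h.
by move: h; rewrite expr2; lra.
Qed.

(** Written as a factor of the integrand, it turns integrals over a half-line into integrals over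
    the whole line, the form to which Tonelli's theorem is applied. *)
Definition gt0i : R -> R := \1_`]0, +oo[%classic.

Lemma gt0iE x : gt0i x = (0 < x)%R%:R.
Proof. by rewrite /gt0i indicE mem_setE in_itv/= andbT. Qed.

Lemma measurable_gt0i : measurable_fun setT gt0i.
Proof. exact: measurable_indic. Qed.

Lemma integral_gt0i g : measurable_fun setT g ->
  (\int[leb]_x (gt0i x * g x)%:E = \int[leb]_(x in `[0%R, +oo[) (g x)%:E)%E.
Proof.
move=> mg; rewrite -integral_itv_obnd_cbnd; last first.
  by apply/measurable_EFinP; exact: measurable_funTS.
rewrite [RHS]integral_mkcond; apply: eq_integral => x _.
rewrite patchE /gt0i indicE; case: (x \in _); first by rewrite mul1r.
by rewrite mul0r.
Qed.

Lemma integral_mul_expRN (x : R) : 0 < x ->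
  (\int[leb]_s (gt0i s * (s * expR (- (x * s))))%:E = (x ^- 2)%:E)%E.
Proof.
move=> x0; have xn0 : x != 0 by rewrite gt_eqF.
pose F (s : R) := - ((s / x + x ^- 2) * expR (- (x * s))).
have df s : is_derive s (1 : R) (fun s => s * expR (- (x * s)))
    (expR (- (x * s)) - x * s * expR (- (x * s))).
  by apply: is_derive_eq; rewrite /GRing.scale/=; ring.
rewrite integral_gt0i; last by apply: continuous_measurable_fun; exact: is_derive_continuous df.
have dF s : is_derive s (1 : R) F (s * expR (- (x * s))).
  by apply: is_derive_eq; rewrite /GRing.scale/=; field.
have lF : F s @[s --> +oo] --> 0.
  apply: (@cvgy_le0 _ (3 / x ^+ 3)); near=> s.
  have s0 : 0 < s by near: s; exact: nbhs_pinfty_gt.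
  have xs : 0 < x * s by rewrite mulr_gt0.
  rewrite /F normrN ger0_norm; last first.
    by rewrite mulr_ge0 ?expR_ge0// addr_ge0// ?divr_ge0 ?invr_ge0 ?exprn_ge0// ltW.
  have h1 := expRN_le xs; have h2 := mul_expRN_le xs.
  rewrite (_ : (s / x + _) * _ = x ^- 2 * (x * s * expR (- (x * s)) + expR (- (x * s)))); last by field.
  rewrite (_ : 3 / _ / s = x ^- 2 * (2 / (x * s) + (x * s)^-1)); last by field; rewrite xn0 gt_eqF.
  by rewrite ler_wpM2l ?lerD// invr_ge0 exprn_ge0// ltW.
rewrite (integral_0y_antiderivative _ (is_derive_continuous df) dF lF).
  by rewrite /F mulr0 oppr0 expR0 mul0r !add0r mulr1 opprK.
by move=> s s0; rewrite mulr_ge0// expR_ge0.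
Unshelve. all: by end_near. Qed.

Lemma integral_1Bcos_expRN (c s : R) : 0 < s ->
  (\int[leb]_x (gt0i x * ((1 - cos (c * x)) * expR (- (s * x))))%:E =
   (c ^+ 2 / (s * (s ^+ 2 + c ^+ 2)))%:E)%E.
Proof.
move=> s0; have sn0 : s != 0 by rewrite gt_eqF.
have D0 : 0 < s ^+ 2 + c ^+ 2 by rewrite ltr_wpDr ?sqr_ge0// exprn_gt0.
have Dn0 : s ^+ 2 + c ^+ 2 != 0 by rewrite gt_eqF.
(* Minus [B x * expR (- (s * x))] is a primitive: [s^-1] comes from the constant 1 and the quotient
   from the primitive of [cos (c * x) * expR (- (s * x))]. *)
pose B x := s^-1 + (c * sin (c * x) - s * cos (c * x)) / (s ^+ 2 + c ^+ 2).
pose F x := - (B x * expR (- (s * x))).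
have df x : is_derive x (1 : R) (fun x => (1 - cos (c * x)) * expR (- (s * x)))
    (c * sin (c * x) * expR (- (s * x)) - s * (1 - cos (c * x)) * expR (- (s * x))).
  by apply: is_derive_eq; rewrite /GRing.scale/=; ring.
rewrite integral_gt0i; last by apply: continuous_measurable_fun; exact: is_derive_continuous df.
have dF x : is_derive x (1 : R) F ((1 - cos (c * x)) * expR (- (s * x))).
  by apply: is_derive_eq; rewrite /B /GRing.scale/=; field; rewrite sn0 Dn0.
have lF : F x @[x --> +oo] --> 0.
  pose M := s^-1 + (`|c| + s) / (s ^+ 2 + c ^+ 2).
  apply: (@cvgy_le0 _ (M / s)); near=> x.
  have x0 : 0 < x by near: x; exact: nbhs_pinfty_gt.
  have sx : 0 < s * x by rewrite mulr_gt0.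
  rewrite /F normrN normrM (ger0_norm (expR_ge0 _)) -mulrA -invfM.
  have BM : `|B x| <= M.
    rewrite /B /M (le_trans (ler_normD _ _))// ger0_norm ?invr_ge0 ?(ltW s0)// lerD2l.
    rewrite normrM (ger0_norm (x := _^-1)) ?invr_ge0 ?(ltW D0)// ler_wpM2r ?invr_ge0 ?(ltW D0)//.
    rewrite (le_trans (ler_normB _ _))// !normrM (ger0_norm (ltW s0)) lerD//.
      by rewrite ler_piMr// ler_norml sin_geN1 sin_le1.
    by rewrite ler_piMr ?(ltW s0)// ler_norml cos_geN1 cos_le1.
  by apply: ler_pM; rewrite ?expR_ge0 ?expRN_le.
rewrite (integral_0y_antiderivative _ (is_derive_continuous df) dF lF).
  rewrite /F /B !mulr0 oppr0 expR0 sin0 cos0 !mulr0 !mulr1; congr EFin.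
  by field; rewrite Dn0.
by move=> x x0; rewrite mulr_ge0 ?expR_ge0// subr_ge0 cos_le1.
Unshelve. all: by end_near. Qed.

Lemma integral_sq_div (c : R) : 0 < c ->
  (\int[leb]_s (gt0i s * (c ^+ 2 / (s ^+ 2 + c ^+ 2)))%:E = (c * pi / 2)%:E)%E.
Proof.
move=> c0; have cn0 : c != 0 by rewrite gt_eqF.
have D0 s : 0 < s ^+ 2 + c ^+ 2 by rewrite ltr_wpDl ?sqr_ge0// exprn_gt0.
have Dn0 s : s ^+ 2 + c ^+ 2 != 0 by rewrite gt_eqF.
have cf : continuous (fun s : R => c ^+ 2 / (s ^+ 2 + c ^+ 2)).
  move=> s; apply: cvgM; first exact: cvg_cst.
  apply: cvgV => //; apply: cvgD; last exact: cvg_cst.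
  by rewrite expr2; apply: cvgM; exact: cvg_id.
rewrite integral_gt0i; last exact: continuous_measurable_fun.
pose F (s : R) := c * atan (s / c).
have dF s : is_derive s (1 : R) F (c ^+ 2 / (s ^+ 2 + c ^+ 2)).
  apply: is_derive_eq; rewrite /GRing.scale/=; field.
  by rewrite cn0 Dn0.
have lF : F s @[s --> +oo] --> c * (pi / 2).
  apply: cvgM; first exact: cvg_cst.
  apply: (@cvg_comp _ _ _ _ _ _ (pinfty_nbhs R)); last exact: cvgy_atan.
  by apply: gt0_cvgMly => //; rewrite invr_gt0.
rewrite (integral_0y_antiderivative _ cf dF lF).
  by rewrite /F mul0r atan0 mulr0 subr0 mulrA.
by move=> s _; rewrite divr_ge0 ?sqr_ge0// ltW.
Qed.

End half_line.

(** * The integral of (1 - cos (c x)) / x^2 *)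

Section sinc.
Variable R : realType.
Local Notation leb := (@lebesgue_measure R).

Lemma continuous_muln (c : R) : continuous (fun x : R => c * x).
Proof. by move=> x; apply: cvgM; [exact: cvg_cst|exact: cvg_id]. Qed.

Lemma continuous_cosM (c : R) : continuous (fun x : R => cos (c * x)).
Proof.
move=> x; apply: continuous_comp; first exact: continuous_muln.
exact: continuous_cos.
Qed.

Lemma continuous_sinM (c : R) : continuous (fun x : R => sin (c * x)).
Proof.
move=> x; apply: continuous_comp; first exact: continuous_muln.
exact: continuous_sin.
Qed.

(* [x^-1] is the pointwise limit of [x / (x^2 + 1/n)], including at [x = 0]
   where the inverse is [0]. *)
Lemma measurable_invr : measurable_fun setT (fun x : R => x^-1).
Proof.
have p (x : R) n : 0 < x ^+ 2 + n.+1%:R^-1 by rewrite ltr_wpDl ?sqr_ge0// invr_gt0 ltr0n.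
have mh n : measurable_fun setT (fun x : R => x / (x ^+ 2 + n.+1%:R^-1)).
  apply: continuous_measurable_fun => x; apply: cvgM; first exact: cvg_id.
  apply: cvgV; first by rewrite gt_eqF.
  by apply: cvgD; [rewrite expr2; apply: cvgM; exact: cvg_id|exact: cvg_cst].
have hc (x : R) : setT x -> (fun n => x / (x ^+ 2 + n.+1%:R^-1)) @ \oo --> x^-1.
  move=> _; have [->|x0] := eqVneq x 0.
    by under eq_fun do rewrite mul0r; rewrite invr0; exact: cvg_cst.
  have <- : x / (x ^+ 2 + 0) = x^-1 by rewrite addr0; field.
  apply: cvgM; first exact: cvg_cst.
  apply: cvgV; first by rewrite addr0 expf_neq0.
  by apply: cvgD; [exact: cvg_cst|exact: cvg_harmonic].
exact: (measurable_fun_cvg mh hc).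
Qed.

(** This is [2 * (sin (c * x / 2) / x) ^+ 2]; as the inverse of 0 is 0, its value at 0 is 0 instead
    of the limit [c ^+ 2 / 2], which no integral sees. *)
Definition sinc2 (c x : R) : R := (1 - cos (c * x)) * (x^-1 * x^-1).

Lemma sinc2_ge0 c x : 0 <= sinc2 c x.
Proof. by rewrite /sinc2 mulr_ge0 ?subr_ge0 ?cos_le1// -expr2 sqr_ge0. Qed.

Lemma measurable_1Bcos (c : R) : measurable_fun setT (fun x : R => 1 - cos (c * x)).
Proof.
apply: continuous_measurable_fun => x; apply: cvgB; first exact: cvg_cst.
exact: continuous_cosM.
Qed.

Lemma measurable_sinc2 c : measurable_fun setT (sinc2 c).
Proof.
apply: measurable_funM; first exact: measurable_1Bcos.
by apply: measurable_funM; exact: measurable_invr.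
Qed.

(* Tonelli, writing [x^-2] as the Laplace transform of [s |-> s]. *)
Lemma integral_sinc2_half (c : R) : 0 < c ->
  (\int[leb]_x (gt0i x * sinc2 c x)%:E = (c * pi / 2)%:E)%E.
Proof.
move=> c0.
(* On the positive half-lines, integration over [z.2] gives [sinc2 c z.1], and integration over
   [z.1] gives [c ^+ 2 / (z.2 ^+ 2 + c ^+ 2)], the factor [z.2] cancelling against a denominator. *)
pose h (z : R * R) := (gt0i z.1 * (1 - cos (c * z.1))) * (gt0i z.2 * (z.2 * expR (- (z.1 * z.2)))).
have gt0i_ge0 (x : R) : 0 <= gt0i x by rewrite gt0iE ler0n.
have h0 z : 0 <= h z.
  rewrite /h gt0iE [gt0i _]gt0iE; case: ltP => z1; last by rewrite !mul0r.
  case: ltP => z2; last by rewrite mul0r mulr0.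
  by rewrite !mul1r mulr_ge0 ?subr_ge0 ?cos_le1// mulr_ge0 ?expR_ge0// ltW.
have mh : measurable_fun [set: measurableTypeR R * measurableTypeR R] h.
  pose RR := (measurableTypeR R * measurableTypeR R)%type.
  have m1 : measurable_fun [set: RR] (fun z : RR => gt0i z.1).
    exact: (measurableT_comp (@measurable_gt0i R) measurable_fst).
  have m2 : measurable_fun [set: RR] (fun z : RR => 1 - cos (c * z.1)).
    exact: (measurableT_comp (measurable_1Bcos c) measurable_fst).
  have m3 : measurable_fun [set: RR] (fun z : RR => gt0i z.2).
    exact: (measurableT_comp (@measurable_gt0i R) measurable_snd).
  have m4 : measurable_fun [set: RR] (fun z : RR => z.1 * z.2 : R).
    exact: (measurable_funM measurable_fst measurable_snd).
  have m5 : measurable_fun [set: RR] (fun z : RR => expR (- (z.1 * z.2 : R))).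
    apply: (measurableT_comp (@measurable_expR R)).
    exact: (measurableT_comp (@oppr_measurable R setT) m4).
  have m6 : measurable_fun [set: RR] (fun z : RR => z.2 * expR (- (z.1 * z.2 : R))).
    exact: (measurable_funM measurable_snd m5).
  exact: (measurable_funM (measurable_funM m1 m2) (measurable_funM m3 m6)).
have := @fubini_tonelli _ _ (measurableTypeR R) (measurableTypeR R) R leb leb (EFin \o h)
  (proj2 (measurable_EFinP _ _) mh) (fun z => h0 z).
rewrite (_ : (\int[leb]_x _)%E = (\int[leb]_x (gt0i x * sinc2 c x)%:E)%E); last first.
  apply: eq_integral => x _ /=.
  rewrite /h/= gt0iE; case: ltP => x0; last first.
    by under eq_integral do rewrite !mul0r; rewrite integral0 mul0r.
  under eq_integral do rewrite EFinM.
  rewrite ge0_integralZl//; last 2 first.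
  - apply/measurable_EFinP; apply: measurable_funM; first exact: measurable_gt0i.
    apply: continuous_measurable_fun.
    apply: (is_derive_continuous (df := fun s => expR (- (x * s)) - x * s * expR (- (x * s)))) => s.
    by apply: is_derive_eq; rewrite /GRing.scale/=; ring.
  - move=> s _; rewrite lee_fin gt0iE; case: ltP => s0; last by rewrite mul0r.
    by rewrite mul1r mulr_ge0 ?expR_ge0// ltW.
  by rewrite integral_mul_expRN// -EFinM /sinc2 !mul1r -expr2 exprVn.
move=> ->; rewrite -integral_sq_div//; apply: eq_integral => s _ /=.
rewrite /h/= [gt0i s]gt0iE; case: ltP => s0; last first.
  by under eq_integral do rewrite !mul0r mulr0; rewrite integral0 mul0r.
transitivity (\int[leb]_x (s%:E * (gt0i x * ((1 - cos (c * x)) * expR (- (s * x))))%:E))%E.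
  by apply: eq_integral => x _; rewrite -EFinM; congr EFin; rewrite (mulrC x s) mul1r; ring.
rewrite ge0_integralZl//; last 3 first.
- apply/measurable_EFinP; apply: measurable_funM; first exact: measurable_gt0i.
  apply: measurable_funM; first exact: measurable_1Bcos.
  apply: (measurableT_comp (@measurable_expR R)).
  apply: (measurableT_comp (@oppr_measurable R setT)).
  by apply: continuous_measurable_fun; exact: continuous_muln.
- move=> x _; rewrite lee_fin gt0iE; case: ltP => x0; last by rewrite mul0r.
  by rewrite mul1r mulr_ge0 ?expR_ge0// subr_ge0 cos_le1.
- by rewrite lee_fin ltW.
rewrite integral_1Bcos_expRN// -EFinM mul1r; congr EFin.
have D0 : s ^+ 2 + c ^+ 2 != 0 by rewrite gt_eqF// ltr_wpDl ?sqr_ge0// exprn_gt0.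
by field; rewrite D0 gt_eqF.
Qed.

Lemma leb_neg (A : set (measurableTypeR R)) : measurable A -> leb (-%R @^-1` A) = leb A.
Proof. exact: lebesgue_measureN. Qed.

Lemma measurable_neg : measurable_fun setT (-%R : measurableTypeR R -> measurableTypeR R).
Proof. exact: (@oppr_measurable R setT). Qed.

Lemma integral_sinc2 (c : R) : (\int[leb]_x (sinc2 c x)%:E = (`|c| * pi)%:E)%E.
Proof.
wlog c0 : c / 0 < c => [H|].
  have [c0|c0|->] := ltrgtP c 0; last 2 first.
  - exact: H.
  - rewrite normr0 mul0r; under eq_integral do rewrite /sinc2 mul0r cos0 subrr mul0r.
    exact: integral0.
  rewrite -normrN -H ?oppr_gt0//; apply: eq_integral => x _.
  by rewrite /sinc2 mulNr cosN.
rewrite gtr0_norm//.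
have gs0 (x : R) : (0 <= (gt0i x * sinc2 c x)%:E)%E.
  by rewrite lee_fin mulr_ge0 ?sinc2_ge0// gt0iE ler0n.
have mgs : measurable_fun setT (fun x : R => (gt0i x * sinc2 c x)%:E).
  apply/measurable_EFinP; apply: measurable_funM; first exact: measurable_gt0i.
  exact: measurable_sinc2.
transitivity (\int[leb]_x ((gt0i x * sinc2 c x)%:E + (gt0i (- x) * sinc2 c (- x))%:E))%E.
  apply: eq_integral => x _; rewrite -EFinD; congr EFin.
  have -> : sinc2 c (- x) = sinc2 c x by rewrite /sinc2 mulrN cosN invrN mulrNN.
  rewrite !gt0iE oppr_gt0; case: ltrgtP => [x0|x0|<-]; rewrite ?mul1r ?mul0r ?addr0 ?add0r//.
  by rewrite /sinc2 mulr0 cos0 subrr mul0r.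
rewrite ge0_integralD//; last 1 first.
  exact: (measurableT_comp mgs measurable_neg).
rewrite (ge0_integral_comp measurable_neg leb_neg mgs gs0) integral_sinc2_half//.
by rewrite -EFinD; congr EFin; field.
Qed.

Lemma integrable_sinc2 (c : R) : leb.-integrable setT (EFin \o sinc2 c).
Proof.
apply/integrableP; split; first by apply/measurable_EFinP; exact: measurable_sinc2.
under eq_integral do rewrite /= ger0_norm ?sinc2_ge0//.
by rewrite integral_sinc2 ltry.
Qed.

Lemma Rintegral_sinc2 (c : R) : \int[leb]_x sinc2 c x = `|c| * pi.
Proof. by rewrite /Rintegral integral_sinc2. Qed.

Lemma Rintegral_odd (u : R -> R) : leb.-integrable setT (EFin \o u) ->
  (forall x, u (- x) = - u x) -> \int[leb]_x u x = 0.
Proof.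
move=> ui uN; have mu' := measurable_int _ ui.
rewrite /Rintegral integralE.
have -> : (\int[leb]_x ((EFin \o u)^\- x) = \int[leb]_x ((EFin \o u)^\+ x))%E.
  rewrite -(ge0_integral_comp measurable_neg leb_neg (measurable_funepos mu')) => [|x].
    by apply: eq_integral => x _; rewrite funeposE funenegE /= uN EFinN.
  exact: funepos_ge0.
by rewrite subee// integral_fune_fin_num// integrable_funepos.
Qed.

End sinc.

(** * Transforms of intervals *)

Section real_transform.
Variable R : realType.
Local Notation leb := (@lebesgue_measure R).
Local Notation TR := (measurableTypeR R).

Lemma Rintegral_indic_itv (a b : R) (f F : R -> R) : a <= b -> continuous f ->
  (forall x, is_derive x (1 : R) F (f x)) ->
  \int[leb]_x (\1_`]a, b]%classic x * f x) = F b - F a.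
Proof.
move=> ab cf dF; have cF := is_derive_continuous dF.
have [->|neq] := eqVneq a b.
  rewrite set_itv_ge ?bnd_simp ?ltxx// subrr.
  by under eq_Rintegral do rewrite indic0 mul0r; rewrite Rintegral_cst// mul0r.
have {}ab : a < b by rewrite lt_neqAle neq.
rewrite /Rintegral; transitivity (fine (\int[leb]_(x in `]a, b]) (f x)%:E)).
  rewrite [in RHS]integral_mkcond; congr fine; apply: eq_integral => x _.
  by rewrite patchE indicE; case: (x \in _); rewrite ?mul1r ?mul0r.
rewrite integral_itv_obnd_cbnd; last first.
  by apply/measurable_EFinP; apply: measurable_funTS; exact: continuous_measurable_fun.
rewrite (continuous_FTC2 ab (f := f) (F := F)) ?EFinB//.
- exact: continuous_subspaceT.
- split; first by move=> x _; have [] := dF x.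
    by apply: cvg_at_right_filter; exact: cF.
  by apply: cvg_at_left_filter; exact: cF.
- by move=> x _; rewrite derive1E; exact: derive_val.
Qed.

Definition kernelR (x xi : TR) : R[i] := chi_infty (xi * x : R).

Lemma kernelRE x xi : kernelR x xi =
  (cos (2 * pi * xi * x) -i* sin (2 * pi * xi * x))%C.
Proof. by rewrite /kernelR /chi_infty /expi cosN sinN !mulrA. Qed.

Lemma kernelR_sym x y : kernelR x y = kernelR y x.
Proof. by rewrite /kernelR mulrC. Qed.

Lemma normsq_kernelR x y : normsq (kernelR x y) = 1.
Proof. by rewrite kernelRE /normsq/= sqrrN cos2Dsin2. Qed.

Lemma kernelR_neg x xi : kernelR x (- xi) = conjc (kernelR x xi).
Proof. by rewrite !kernelRE mulrN mulNr cosN sinN. Qed.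

Lemma Cmeasurable_kernelR : Cmeasurable (fun z : TR * TR => kernelR z.1 z.2).
Proof.
have m : measurable_fun [set: TR * TR] (fun z : TR * TR => 2 * pi * (z.2 : R) * z.1).
  exact: (measurable_funM (measurable_funM (measurable_cst _) measurable_snd) measurable_fst).
split.
  under eq_fun do rewrite kernelRE/=.
  exact: (measurableT_comp (continuous_measurable_fun (@continuous_cos R)) m).
under eq_fun do rewrite kernelRE/=.
apply: (measurableT_comp (@oppr_measurable R setT)).
exact: (measurableT_comp (continuous_measurable_fun (@continuous_sin R)) m).
Qed.

(** The intervals are taken half-open, so that an intersection is empty or again of this kind;
    ordered endpoints make the measure their difference, with degenerate intervals allowed. *)
Definition segment := {x : R * R | x.1 <= x.2}.
Definition seg_set (i : segment) : set TR := `](sval i).1, (sval i).2]%classic.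

Lemma measurable_seg i : measurable (seg_set i).
Proof. exact: measurable_itv. Qed.

Lemma leb_seg i : leb (seg_set i) = ((sval i).2 - (sval i).1)%:E.
Proof.
rewrite /seg_set lebesgue_measure_itv/= lte_fin.
case: i => -[a b] /= ab; case: ltP => [|ba]; first by rewrite EFinB.
by rewrite (le_anti (introT andP (conj ab ba))) subrr.
Qed.

Lemma leb_seg_lty i : (leb (seg_set i) < +oo)%E.
Proof. by rewrite leb_seg ltry. Qed.

Lemma seg_setI i j : seg_set i `&` seg_set j = set0 \/
  exists k, seg_set i `&` seg_set j = seg_set k.
Proof.
case: i j => -[a b] /= ab [[c e] /= ce]; rewrite /seg_set/=.
have E : `]a, b]%classic `&` `]c, e]%classic =
    `](Num.max a c), (Num.min b e)]%classic :> set R.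
  apply/seteqP; split => x /=; rewrite !in_itv/= gt_max le_min.
    by move=> [/andP[-> ->] /andP[-> ->]].
  by move=> /andP[/andP[-> ->] /andP[-> ->]].
case: (leP (Num.max a c) (Num.min b e)) => h; last first.
  by left; rewrite E set_itv_ge// bnd_simp -leNgt ltW.
by right; exists (exist (fun x : R * R => x.1 <= x.2) (Num.max a c, Num.min b e) h).
Qed.

Lemma measurable_seg_gen (A : set TR) : measurable A -> <<s range seg_set >> A.
Proof.
apply: smallest_sub; first exact: smallest_sigma_algebra.
move=> _ [[a b] _ <-]; have [ab|ba] := leP a b.
  by apply: sub_gen_smallest; exists (exist (fun x : R * R => x.1 <= x.2) (a, b) ab).
rewrite set_itv_ge/=; last by rewrite bnd_simp -leNgt ltW.
by have [] := smallest_sigma_algebra setT (range seg_set).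
Qed.

Definition seg_exhaust (n : nat) : segment.
Proof. by exists (- n%:R, n%:R); rewrite /= (@le_trans _ _ 0)// oppr_le0. Defined.

Lemma seg_exhaust_nd n m : (n <= m)%N -> seg_set (seg_exhaust n) `<=` seg_set (seg_exhaust m).
Proof.
move=> nm x; rewrite /seg_set/= !in_itv/= => /andP[h1 h2]; apply/andP; split.
  by apply: le_lt_trans h1; rewrite lerN2 ler_nat.
by apply: (le_trans h2); rewrite ler_nat.
Qed.

Lemma seg_exhaustT : \bigcup_n seg_set (seg_exhaust n) = setT.
Proof.
rewrite -subTset => x _; exists (Num.bound `|x|) => //.
have := archi_boundP (normr_ge0 x); rewrite ltr_norml => /andP[h1 h2].
by rewrite /seg_set/= in_itv/= h1 ltW.
Qed.

(** The integral of [x |-> exp (- i w x)] between the endpoints, by its primitive. At [xi = 0]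
    division by zero gives 0 in place of the length, and [kernel_hat_seg] carries the correction at
    that single point. *)
Definition seg_hat (i : segment) (xi : R) : R[i] :=
  let w := 2 * pi * xi in
  ((sin (w * (sval i).2) - sin (w * (sval i).1)) / w +i*
   ((cos (w * (sval i).2) - cos (w * (sval i).1)) / w))%C.

Lemma kernel_hat_seg i xi : kernel_hat leb kernelR (indC R (seg_set i)) xi =
  seg_hat i xi + (((sval i).2 - (sval i).1) * \1_[set (0 : R)] xi)%:C%C.
Proof.
have eRe : \int[leb]_x (complex.Re (indC R (seg_set i) x * kernelR x xi)) =
    \int[leb]_x (\1_(seg_set i) x * cos (2 * pi * xi * x)).
  by apply: eq_Rintegral => x _; rewrite kernelRE ReM/= mul0r subr0.
have eIm : \int[leb]_x (complex.Im (indC R (seg_set i) x * kernelR x xi)) =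
    \int[leb]_x (\1_(seg_set i) x * - sin (2 * pi * xi * x)).
  by apply: eq_Rintegral => x _; rewrite kernelRE ImM/= mul0r addr0.
rewrite /kernel_hat /Cintegral eRe eIm /seg_hat.
case: i {eRe eIm} => -[a b] /= ab; rewrite /seg_set/=.
have cNs c : continuous (fun x : R => - sin (c * x)).
  by move=> x; apply: cvgN; exact: continuous_sinM.
set w := 2 * pi * xi; have [xi0|xi0] := eqVneq xi 0.
  have w0 : w = 0 by rewrite /w xi0 mulr0.
  rewrite w0 indicE mem_set// mulr1; apply: eq_ReIm; rewrite !ReImE/= !mul0r subrr mul0r add0r.
    have dF (x : R) : is_derive x (1 : R) id (cos (0 * x)).
      by rewrite mul0r cos0; exact: is_derive_id.
    by rewrite (Rintegral_indic_itv ab (@continuous_cosM R 0) dF).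
  have dF (x : R) : is_derive x (1 : R) (cst 0) (- sin (0 * x)).
    by rewrite mul0r sin0 oppr0; exact: is_derive_cst.
  by rewrite (Rintegral_indic_itv ab (cNs 0) dF) subrr ?addr0.
have w0 : w != 0 by rewrite !mulf_neq0// gt_eqF// pi_gt0.
rewrite indicE memNset ?mulr0 ?addr0; last by move=> /= /eqP; rewrite (negPf xi0).
have dS (x : R) : is_derive x (1 : R) (fun x => sin (w * x) / w) (cos (w * x)).
  by apply: is_derive_eq; rewrite /GRing.scale/=; field.
have dC (x : R) : is_derive x (1 : R) (fun x => cos (w * x) / w) (- sin (w * x)).
  by apply: is_derive_eq; rewrite /GRing.scale/=; field.
rewrite (Rintegral_indic_itv ab (@continuous_cosM R w) dS).
by rewrite (Rintegral_indic_itv ab (cNs w) dC) !mulrBl.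
Qed.

Lemma Cmeasurable_seg_hat i : Cmeasurable (seg_hat i : TR -> R[i]).
Proof.
have m1 : measurable_fun [set: TR] (fun xi : TR => 2 * pi * (xi : R)).
  exact: (continuous_measurable_fun (@continuous_muln R (2 * pi))).
have mw : measurable_fun [set: TR] (fun xi : TR => (2 * pi * (xi : R))^-1).
  exact: (measurableT_comp (@measurable_invr R) m1).
have mc (g : R -> R) a : continuous g -> measurable_fun [set: TR] (fun xi : TR => g (2 * pi * (xi : R) * a)).
  move=> cg; apply: (measurableT_comp (continuous_measurable_fun cg)).
  exact: (measurable_funM m1 (measurable_cst _)).
split => /=; apply: (measurable_funM _ mw); apply: measurable_funB; apply: mc;
  [exact: continuous_sin|exact: continuous_sin|exact: continuous_cos|exact: continuous_cos].
Qed.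

(** The squared modulus of [exp (- i w b) - exp (- i w a)] is [2 (1 - cos (w (b - a)))], divided
    here by [w ^+ 2] with [w = 2 pi xi]. *)
Lemma normsq_seg_hat i xi : normsq (seg_hat i xi) =
  (2 * pi ^+ 2)^-1 * sinc2 (2 * pi * ((sval i).2 - (sval i).1)) xi.
Proof.
rewrite /normsq /seg_hat /sinc2/=; case: i => -[a b] /= _.
rewrite (_ : 2 * pi * (b - a) * xi = 2 * pi * xi * b - 2 * pi * xi * a); last by ring.
have [->|xi0] := eqVneq xi 0.
  by rewrite !(mulr0, mul0r) invr0 !mulr0 expr0n/= addr0.
have := cos2Dsin2 (2 * pi * xi * a); have := cos2Dsin2 (2 * pi * xi * b).
have p0 : pi != 0 :> R by rewrite gt_eqF// pi_gt0.
rewrite cosB.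
move: (cos (2 * pi * xi * a)) (sin (2 * pi * xi * a)) (cos (2 * pi * xi * b))
  (sin (2 * pi * xi * b)) => ca sa cb sb hb ha.
move: (pi : R) p0 => p p0.
rewrite (_ : _ + _ = ((cb ^+ 2 + sb ^+ 2) + (ca ^+ 2 + sa ^+ 2) - 2 * (cb * ca + sb * sa)) /
  (2 * p * xi) ^+ 2); last by field; rewrite p0 xi0.
by rewrite hb ha; field; rewrite p0 xi0.
Qed.

Lemma L2_seg_hat i : L2 leb (seg_hat i : TR -> R[i]).
Proof.
apply/L2P; split; first exact: Cmeasurable_seg_hat.
have := integrableZl measurableT ((2 * pi ^+ 2)^-1)
  (integrable_sinc2 (2 * pi * ((sval i).2 - (sval i).1))).
by apply: eq_integrable => // x _ /=; rewrite normsq_seg_hat.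
Qed.

Lemma kernel_hat_seg_ae i :
  kernel_hat leb kernelR (indC R (seg_set i)) = seg_hat i %[ae leb].
Proof.
exists [set 0]; split; [exact: measurable_set1|exact: lebesgue_measure_set1|].
move=> x /= H; apply: contrapT => /= x0; apply: H => _.
by rewrite kernel_hat_seg indicE memNset// mulr0 addr0.
Qed.

Lemma L2_kernel_hat_seg i : L2 leb (kernel_hat leb kernelR (indC R (seg_set i))).
Proof.
apply: (L2_ae (L2_seg_hat i)).
  have -> : kernel_hat leb kernelR (indC R (seg_set i)) = (fun xi : TR => seg_hat i xi +
      (((sval i).2 - (sval i).1) * \1_[set (0 : R)] xi)%:C%C).
    by apply/funext => xi; exact: kernel_hat_seg.
  apply: CmeasurableD; first exact: Cmeasurable_seg_hat.
  apply: Cmeasurable_real; apply: (measurable_funM (measurable_cst _)).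
  exact: (@measurable_indic _ TR R setT _ (measurable_set1 (0 : R))).
by apply: filterS (kernel_hat_seg_ae i) => x h Dx; rewrite h.
Qed.

Lemma Rintegral_sinc2_lin4 (c1 c2 c3 c4 k : R) :
  \int[leb]_x (k * (sinc2 c1 x + sinc2 c2 x - sinc2 c3 x - sinc2 c4 x)) =
  k * pi * (`|c1| + `|c2| - `|c3| - `|c4|).
Proof.
have i1 := Rintegrable_lin 1 1 (integrable_sinc2 c1) (integrable_sinc2 c2).
have i2 := Rintegrable_lin 1 1 (integrable_sinc2 c3) (integrable_sinc2 c4).
transitivity (\int[leb]_x (k * (1 * sinc2 c1 x + 1 * sinc2 c2 x) +
    (- k) * (1 * sinc2 c3 x + 1 * sinc2 c4 x))).
  by apply: eq_Rintegral => x _; ring.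
rewrite (RintegralZD k (- k) i1 i2).
rewrite (RintegralZD 1 1 (integrable_sinc2 c1) (integrable_sinc2 c2)).
rewrite (RintegralZD 1 1 (integrable_sinc2 c3) (integrable_sinc2 c4)).
by rewrite !Rintegral_sinc2; ring.
Qed.

(** For the intervals from [a] to [b] and from [c] to [e], addition formulas write the real part as
    a combination of four [sinc2], with integral [(|b - c| + |a - e| - |b - e| - |a - c|) / 2]; a
    comparison of the endpoints shows that this is the length of the intersection. The imaginary
    part is odd. *)
Lemma ip_seg_hat i j :
  ip leb (seg_hat i : TR -> R[i]) (seg_hat j : TR -> R[i]) =
  ip leb (indC R (seg_set i)) (indC R (seg_set j)).
Proof.
have mI : (leb (seg_set i `&` seg_set j) < +oo)%E.
  apply: le_lt_trans (leb_seg_lty i); apply: le_measure => //; rewrite ?inE.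
    by apply: measurableI; exact: measurable_seg.
  exact: measurable_seg.
rewrite ip_indC; [|exact: measurable_seg|exact: measurable_seg|by []].
have Lij := Cintegrable_ip (L2_seg_hat i) (L2_seg_hat j).
have p0 : pi != 0 :> R by rewrite gt_eqF// pi_gt0.
rewrite /ip; apply: eq_ReIm => /=; last first.
  have [_ iIm] := Lij; apply: (Rintegral_odd iIm) => x.
  rewrite /seg_hat /= !mulrN !mulNr !sinN !cosN !invrN; ring.
move: i j {Lij} mI => [[a b] /= ab] [[c e] /= ce]; rewrite /seg_set/= => _.
transitivity (\int[leb]_x ((2 * pi)^-1 ^+ 2 * (sinc2 (2 * pi * (b - c)) x +
    sinc2 (2 * pi * (a - e)) x - sinc2 (2 * pi * (b - e)) x - sinc2 (2 * pi * (a - c)) x))).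
  apply: eq_Rintegral => x _; rewrite /seg_hat/= /sinc2.
  rewrite !(mulrBr (2 * pi)) !mulrBl !cosB.
  rewrite ![2 * pi * _ * x]mulrAC invfM.
  move: (cos _) (cos _) (cos _) (cos _) (sin _) (sin _) (sin _) (sin _) (2 * pi)^-1 (x^-1).
  by move=> *; ring.
rewrite Rintegral_sinc2_lin4 !normrM (ger0_norm (x := 2))// (ger0_norm (pi_ge0 R)).
rewrite (_ : `]a, b]%classic `&` `]c, e]%classic = `](Num.max a c), (Num.min b e)]%classic :> set R); last first.
  apply/seteqP; split => x /=; rewrite !in_itv/= gt_max le_min.
    by move=> [/andP[-> ->] /andP[-> ->]].
  by move=> /andP[/andP[-> ->] /andP[-> ->]].
rewrite lebesgue_measure_itv/= lte_fin.
transitivity (2^-1 * (`|b - c| + `|a - e| - `|b - e| - `|a - c|)).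
  by move: (pi : R) p0 => p p0; field.
have m0 : fine (if Num.max a c < Num.min b e then ((Num.min b e)%:E - (Num.max a c)%:E)%E else 0%E) =
    Num.max 0 (Num.min b e - Num.max a c).
  case: ltP => h.
    by rewrite -EFinB/=; apply/esym/max_idPr; rewrite subr_ge0; exact: ltW.
  by apply/esym/max_idPl; rewrite subr_le0.
rewrite m0; have dist u v : `|u - v| = Num.max u v - Num.min u v :> R.
  case: leP => h; first by rewrite distrC ger0_norm; [ |rewrite subr_ge0].
  by rewrite ger0_norm; [ |rewrite subr_ge0 ltW].
rewrite !dist.
case: (leP b c); case: (leP a e); case: (leP b e); case: (leP a c) => h1 h2 h3 h4;
  case: leP => h5; lra.
Qed.

Lemma kernelR_transform : exists F : (TR -> R[i]) -> (TR -> R[i]), [/\ L2_isometry leb F,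
  forall f, Cintegrable leb f -> L2 leb f -> F f = kernel_hat leb kernelR f %[ae leb] &
  forall f, L2 leb f -> F (fun xi => F f (- xi)) = f %[ae leb]].
Proof.
apply: (kernel_transform Cmeasurable_kernelR _ kernelR_sym (@measurable_neg R) (@leb_neg R)
  kernelR_neg measurable_seg leb_seg_lty seg_setI measurable_seg_gen seg_exhaust_nd
  seg_exhaustT L2_kernel_hat_seg) => [x y|i j]; first by rewrite normsq_kernelR.
rewrite -ip_seg_hat; apply: ip_ae; try exact: kernel_hat_seg_ae.
- exact: L2_kernel_hat_seg.
- exact: L2_seg_hat.
- exact: L2_kernel_hat_seg.
- exact: L2_seg_hat.
Qed.

End real_transform.

(** * Schwartz functions and smooth approximations of intervals *)

Section schwartz.
Variable R : realType.
Local Notation leb := (@lebesgue_measure R).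
Local Notation TR := (measurableTypeR R).

Lemma integrable_even (f : R -> R) : (forall x, 0 <= f x) -> continuous f ->
  f =1 f \o -%R -> (\int[leb]_(x in `[0%R, +oo[) (f x)%:E < +oo)%E ->
  leb.-integrable setT (EFin \o f).
Proof.
move=> f0 cf fe fo; apply/integrableP; split.
  by apply/measurable_EFinP; exact: continuous_measurable_fun.
under eq_integral do rewrite /= ger0_norm//.
rewrite ge0_symfun_integralT//.
have -> : [set x : R | 0 <= x] = `[0%R, +oo[%classic.
  by apply/seteqP; split => x /=; rewrite in_itv/= andbT.
by rewrite lte_mul_pinfty.
Qed.

Lemma integrable_inv_sq : leb.-integrable setT (EFin \o (fun x : R => (1 + x ^+ 2)^-1)).
Proof.
have D0 (x : R) : 0 < 1 + x ^+ 2 by rewrite ltr_pwDl ?sqr_ge0.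
have cf : continuous (fun x : R => (1 + x ^+ 2)^-1).
  move=> x; apply: cvgV; first by rewrite gt_eqF.
  by apply: cvgD; [exact: cvg_cst|rewrite expr2; apply: cvgM; exact: cvg_id].
apply: integrable_even => //.
- by move=> x; rewrite invr_ge0 ltW.
- by move=> x /=; rewrite sqrrN.
have := @integral_sq_div R 1 ltr01; rewrite integral_gt0i; last first.
  apply: continuous_measurable_fun => x; apply: cvgM; first exact: cvg_cst.
  apply: cvgV; first by rewrite expr1n addrC gt_eqF.
  by apply: cvgD; [rewrite expr2; apply: cvgM; exact: cvg_id|exact: cvg_cst].
move=> H; have -> : (\int[leb]_(x in `[0%R, +oo[) ((1 + x ^+ 2)^-1)%:E)%E = (1 * pi / 2)%:E.
  by rewrite -H; apply: eq_integral => x _; rewrite expr1n mul1r addrC.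
by rewrite ltry.
Qed.

Lemma integrable_expR_norm : leb.-integrable setT (EFin \o (fun x : R => expR (- `|x|))).
Proof.
have cE : continuous (fun x : R => expR (- x)).
  move=> x; apply: continuous_comp; first exact: continuousN.
  exact: continuous_expR.
apply: integrable_even => //.
- move=> x; apply: (@continuous_comp _ _ _ (fun x : R => `|x|) (fun x : R => expR (- x))).
    exact: norm_continuous.
  exact: cE.
- by move=> x /=; rewrite normrN.
have dF (x : R) : is_derive x (1 : R) (fun x => - expR (- x)) (expR (- x)).
  by apply: is_derive_eq; rewrite /GRing.scale/=; ring.
have lF : - expR (- x) @[x --> +oo] --> (- 0 : R) by apply: cvgN; exact: cvgr_expR.
have -> : (\int[leb]_(x in `[0%R, +oo[) (expR (- `|x|))%:E =
    \int[leb]_(x in `[0%R, +oo[) (expR (- x))%:E)%E.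
  by apply: eq_integral => x; rewrite inE/= in_itv/= andbT => x0; rewrite ger0_norm.
by rewrite (integral_0y_antiderivative _ cE dF lF) ?ltry.
Qed.

(** The bounds on [f] itself for the powers 0 and 2 of [x] add up to a bound on
    [|f x| * (1 + x ^+ 2)]. *)
Lemma schwartz_dom (phi : R -> R[i]) : schwartz phi ->
  Cmeasurable (phi : TR -> R[i]) /\ exists M : R, forall x,
    `|complex.Re (phi x)| <= M * (1 + x ^+ 2)^-1 /\ `|complex.Im (phi x)| <= M * (1 + x ^+ 2)^-1.
Proof.
have key (f : R -> R) : (forall n x, derivable (derive1n n f) x 1) ->
    (forall j k, exists M, forall x, `|x ^+ j * derive1n k f x| <= M) ->
    continuous f /\ exists M, forall x, `|f x| * (1 + x ^+ 2) <= M.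
  move=> fd fr; split.
    move=> x; apply: differentiable_continuous; apply/derivable1_diffP.
    exact: (fd 0%N).
  have [M0 h0] := fr 0%N 0%N; have [M2 h2] := fr 2%N 0%N.
  exists (M0 + M2) => x; have := h0 x; have := h2 x.
  rewrite derive1n0 expr0 mul1r normrM normrX real_normK ?num_real//.
  by rewrite mulrDr mulr1 => ? ?; rewrite lerD// mulrC.
move=> [[r1 r2] [i1 i2]].
have [cr [M1 h1]] := key _ r1 r2; have [ci [M2 h2]] := key _ i1 i2.
split; first by split; exact: continuous_measurable_fun.
have D0 (x : R) : 0 < 1 + x ^+ 2 by rewrite ltr_pwDl ?sqr_ge0.
exists (`|M1| + `|M2|) => x; split; rewrite ler_pdivlMr//.
  by rewrite (le_trans (h1 x))// (le_trans (ler_norm _))// lerDl.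
by rewrite (le_trans (h2 x))// (le_trans (ler_norm _))// lerDr.
Qed.

Lemma schwartz_Cintegrable (phi : R -> R[i]) : schwartz phi ->
  Cintegrable leb (phi : TR -> R[i]).
Proof.
move=> /schwartz_dom[mphi [M hM]].
apply: (@Cintegrable_dom _ TR R leb phi (fun x => M * (1 + (x : R) ^+ 2)^-1) mphi).
- by move=> x; have [] := hM x.
- by move=> x; have [] := hM x.
- by have := integrableZl measurableT M integrable_inv_sq; exact: eq_integrable.
Qed.

Lemma schwartz_L2 (phi : R -> R[i]) : schwartz phi -> L2 leb (phi : TR -> R[i]).
Proof.
move=> /schwartz_dom[mphi [M hM]].
apply: (@L2_dom _ TR R leb phi (fun x => (2 * M ^+ 2) * (1 + (x : R) ^+ 2)^-1) mphi); last first.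
  by have := integrableZl measurableT (2 * M ^+ 2) integrable_inv_sq; exact: eq_integrable.
move=> x; have D1 : (1 + x ^+ 2)^-1 <= 1 by rewrite invf_le1 ?lerDl ?sqr_ge0// ltr_pwDl ?sqr_ge0.
have D0 : 0 <= (1 + x ^+ 2)^-1 by rewrite invr_ge0 addr_ge0 ?sqr_ge0.
have sq (u : R) : `|u| <= M * (1 + x ^+ 2)^-1 -> u ^+ 2 <= M ^+ 2 * (1 + x ^+ 2)^-1.
  move=> h; rewrite -real_normK ?num_real//.
  apply: (@le_trans _ _ ((M * (1 + x ^+ 2)^-1) ^+ 2)).
    by apply: lerXn2r; rewrite ?nnegrE ?normr_ge0 ?(le_trans _ h).
  by rewrite exprMn ler_wpM2l ?sqr_ge0// expr2 ler_piMr.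
have [/sq h1 /sq h2] := hM x.
by rewrite -mulrA mulr_natl mulr2n lerD.
Qed.

(** A smooth step whose derivative is a polynomial in the step itself, [logistic - logistic ^+ 2];
    this makes the Schwartz property of [bump] a matter of algebra. *)
Definition logistic (x : R) : R := (1 + expR (- x))^-1.

Let L0 (x : R) : 0 < 1 + expR (- x). Proof. by rewrite ltr_pwDl ?expR_ge0. Qed.

Lemma logistic_ge0 x : 0 <= logistic x.
Proof. by rewrite invr_ge0 ltW. Qed.

Lemma logistic_le1 x : logistic x <= 1.
Proof. by rewrite invf_le1// lerDl expR_ge0. Qed.

Lemma logistic_le_expR x : logistic x <= expR x.
Proof. by rewrite -[leRHS]invrK -expRN lef_pV2 ?posrE ?expR_gt0// lerDr. Qed.

Lemma logistic_neg y : y < 0 -> logistic y <= (- y)^-1.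
Proof.
move=> y0; rewrite (le_trans (logistic_le_expR y))// -{1}(opprK y).
by apply: expRN_le; rewrite oppr_gt0.
Qed.

Lemma logistic_pos y : 0 < y -> 1 - logistic y <= y^-1.
Proof.
move=> y0; apply: le_trans (expRN_le y0).
have -> : 1 - logistic y = expR (- y) * logistic y.
  by rewrite /logistic; field; rewrite gt_eqF.
by rewrite ler_piMr ?expR_ge0// logistic_le1.
Qed.

Lemma cvg_sq_of_le (w : R^nat) K : (forall n, `|w n| <= K / n.+1%:R) ->
  (fun n => w n ^+ 2) @ \oo --> (0 : R).
Proof.
move=> wK; have w0 : w @ \oo --> (0 : R).
  apply/cvgrPdist_le => e e0; near=> n; rewrite sub0r normrN.
  rewrite (le_trans (wK n))// ler_pdivrMr ?ltr0n// mulrC -ler_pdivrMr//.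
  rewrite (le_trans (ler_norm _))//.
  apply: (@le_trans _ _ n%:R); last by rewrite ler_nat.
  by near: n; exact: nbhs_infty_ger.
rewrite -(mulr0 (0 : R)); under eq_fun do rewrite expr2.
exact: cvgM.
Unshelve. all: by end_near. Qed.

Definition bump (a b N x : R) : R := logistic (N * (x - a)) * logistic (N * (b - x)).

Lemma bump_ge0 a b N x : 0 <= bump a b N x.
Proof. by rewrite mulr_ge0 ?logistic_ge0. Qed.

Lemma bump_le1 a b N x : bump a b N x <= 1.
Proof. by rewrite mulr_ile1 ?logistic_ge0 ?logistic_le1. Qed.

(** A majorant independent of [N], as dominated convergence requires: for [x >= 0] the descending
    factor is at most [expR (b - x)], for [x < 0] the ascending one is at most [expR (x - a)]. *)
Lemma bump_le a b N x : 1 <= N -> bump a b N x <= (expR (- a) + expR b) * expR (- `|x|).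
Proof.
move=> N1.
have key (y : R) : logistic (N * y) <= expR y.
  have [y0|y0] := leP y 0.
    by rewrite (le_trans (logistic_le_expR _))// ler_expR ler_neMl.
  by rewrite (le_trans (logistic_le1 _))// -expR0 ler_expR ltW.
rewrite mulrDl -!expRD; have [x0|x0] := leP 0 x.
  rewrite ger0_norm// (@le_trans _ _ (expR (b - x)))//; last by rewrite lerDr expR_ge0.
  by rewrite (le_trans _ (key _))// ler_piMl ?logistic_ge0 ?logistic_le1.
rewrite ltr0_norm// opprK (@le_trans _ _ (expR (x - a)))//; last first.
  by rewrite addrC lerDl expR_ge0.
by rewrite (le_trans _ (key _))// ler_piMr ?logistic_ge0 ?logistic_le1.
Qed.

Lemma indic_le_expR (a b x : R) :
  \1_`]a, b]%classic x <= (expR (- a) + expR b) * expR (- `|x|).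
Proof.
rewrite indicE mem_setE in_itv/= mulrDl -!expRD; case: (ltP a x) => /= [ax|_]; last first.
  by rewrite addr_ge0 ?expR_ge0.
case: (leP x b) => /= [xb|_]; last by rewrite addr_ge0 ?expR_ge0.
have [x0|x0] := leP 0 x.
  rewrite ger0_norm// (@le_trans _ _ (expR (b - x)))//; last by rewrite lerDr expR_ge0.
  by rewrite -expR0 ler_expR subr_ge0.
rewrite ltr0_norm// opprK (@le_trans _ _ (expR (x - a)))//; last first.
  by rewrite addrC lerDl expR_ge0.
by rewrite -expR0 ler_expR subr_ge0 ltW.
Qed.

(** Off the endpoints each logistic factor is within a constant over [n + 1] of 0 or 1, by
    [logistic_neg] and [logistic_pos]. At an endpoint one factor is constantly [1 / 2]. *)
Lemma cvg_bump (a b x : R) : x != a -> x != b ->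
  (fun n => (bump a b n.+1%:R x - \1_`]a, b]%classic x) ^+ 2) @ \oo --> (0 : R).
Proof.
move=> xa xb.
have N0 n : 0 < n.+1%:R :> R by rewrite ltr0n.
have far n y z : y < 0 -> `|logistic (n.+1%:R * y) * logistic z| <= (- y)^-1 / n.+1%:R.
  move=> y0; rewrite ger0_norm ?mulr_ge0 ?logistic_ge0//.
  rewrite (@le_trans _ _ (logistic (n.+1%:R * y)))//.
    by rewrite ler_piMr ?logistic_ge0 ?logistic_le1.
  rewrite -invfM mulNr [y * _]mulrC; apply: logistic_neg.
  by rewrite pmulr_rlt0.
rewrite indicE mem_setE in_itv/=; case: (ltP a x) => /= ax; last first.
  apply: (@cvg_sq_of_le _ (- (x - a))^-1) => n; rewrite subr0 far//.
  by rewrite subr_lt0 lt_neqAle xa.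
case: (leP x b) => /= bx; last first.
  apply: (@cvg_sq_of_le _ (- (b - x))^-1) => n; rewrite subr0 /bump mulrC far//.
  by rewrite subr_lt0.
have {}bx : x < b by rewrite lt_neqAle xb.
apply: (@cvg_sq_of_le _ ((x - a)^-1 + (b - x)^-1)) => n.
have p1 : 0 < n.+1%:R * (x - a) by rewrite mulr_gt0 ?subr_gt0.
have p2 : 0 < n.+1%:R * (b - x) by rewrite mulr_gt0 ?subr_gt0.
have := logistic_pos p1; have := logistic_pos p2.
rewrite !invfM mulrDl ![_ / n.+1%:R]mulrC /bump.
have := logistic_le1 (n.+1%:R * (x - a)); have := logistic_le1 (n.+1%:R * (b - x)).
have := logistic_ge0 (n.+1%:R * (x - a)); have := logistic_ge0 (n.+1%:R * (b - x)).
move: (logistic (n.+1%:R * (x - a))) (logistic (n.+1%:R * (b - x))) =>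
  u v v0 u0 v1 u1 h2 h1.
rewrite distrC ger0_norm; last by rewrite subr_ge0 mulr_ile1.
rewrite (_ : 1 - u * v = (1 - u) + u * (1 - v)); last by ring.
apply: lerD => //; rewrite (le_trans _ h2)// ler_piMl// subr_ge0//.
Qed.

End schwartz.

Section bump_schwartz.
Variables (R : realType) (a b N : R).
Hypothesis N1 : 1 <= N.
Local Notation leb := (@lebesgue_measure R).
Local Notation TR := (measurableTypeR R).
Let u (x : R) := logistic (N * (x - a)).
Let v (x : R) := logistic (N * (b - x)).

(* The triple (c, (i, j)) encodes the function [c u^(i+1) v^(j+1)]; such sums
   are stable under differentiation because [u' = N (u - u^2)] and
   [v' = - N (v - v^2)]. *)
Definition bump_monom (m : R * (nat * nat)) (x : R) : R :=
  m.1 * (u x ^+ m.2.1.+1 * v x ^+ m.2.2.+1).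

Definition bump_poly (l : seq (R * (nat * nat))) (x : R) : R :=
  \sum_(m <- l) bump_monom m x.

(** From [(u^k)' = k N (1 - u) u^k] and [(v^k)' = - k N (1 - v) v^k], with [k = i + 1] and
    [k = j + 1]. *)
Definition bump_deriv (l : seq (R * (nat * nat))) :=
  flatten [seq let: (c, (i, j)) := m in
    [:: (N * c * (i.+1%:R - j.+1%:R), (i, j)); (- (N * c * i.+1%:R), (i.+1, j));
        (N * c * j.+1%:R, (i, j.+1))] | m <- l].

Let du x : is_derive x (1 : R) u (N * (u x - u x ^+ 2)).
Proof.
have n0 : 1 + expR (- (N * (x - a))) != 0 by rewrite gt_eqF// ltr_pwDl ?expR_ge0.
rewrite /u /logistic; apply: is_derive_eq; rewrite /GRing.scale/=; field.
by rewrite n0.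
Qed.

Let dv x : is_derive x (1 : R) v (- (N * (v x - v x ^+ 2))).
Proof.
have n0 : 1 + expR (- (N * (b - x))) != 0 by rewrite gt_eqF// ltr_pwDl ?expR_ge0.
rewrite /v /logistic; apply: is_derive_eq; rewrite /GRing.scale/=; field.
by rewrite n0.
Qed.

Lemma is_derive_bump_poly l x :
  is_derive x (1 : R) (bump_poly l) (bump_poly (bump_deriv l) x).
Proof.
elim: l => [|[c [i j]] l IH].
  rewrite (_ : bump_poly [::] = cst 0); last by apply/funext => y; rewrite /bump_poly big_nil.
  exact: is_derive_cst.
rewrite (_ : bump_poly _ = (fun x => c * (u x ^+ i.+1 * v x ^+ j.+1)) + bump_poly l); last first.
  by apply/funext => y; rewrite /bump_poly big_cons.
have -> : bump_poly (bump_deriv ((c, (i, j)) :: l)) x =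
    c * (i.+1%:R * u x ^+ i * (N * (u x - u x ^+ 2)) * v x ^+ j.+1 +
         j.+1%:R * v x ^+ j * (- (N * (v x - v x ^+ 2))) * u x ^+ i.+1) +
    bump_poly (bump_deriv l) x.
  rewrite /bump_deriv/= -/(bump_deriv l) {1}/bump_poly !big_cons -/(bump_poly _ x).
  rewrite !addrA; congr (_ + _); rewrite /bump_monom/= !exprS.
  move: (u x) (v x) (i.+1%:R : R) (j.+1%:R : R) => p q i1 j1; ring.
have pow (f : R -> R) df n : is_derive x (1 : R) f df ->
    is_derive x (1 : R) (fun y => f y ^+ n.+1) (n.+1%:R * f x ^+ n * df).
  move=> fd; rewrite (_ : (fun y => _) = f ^+ n.+1); last first.
    by apply/funext => y; rewrite exprfctE.
  exact: is_deriveX.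
have du' := pow _ _ i (du x); have dv' := pow _ _ j (dv x).
apply: is_deriveD; apply: is_derive_eq.
rewrite /GRing.scale/= !exprS.
move: (u x) (v x) (i.+1%:R : R) (j.+1%:R : R) => p q i1 j1; ring.
Qed.

(** Both exponents of a monomial are at least 1 and both factors at most 1, so the monomial is at
    most its coefficient times [bump]. *)
Lemma bump_poly_dom l : exists M : R, forall x, `|bump_poly l x| <= M * expR (- `|x|).
Proof.
elim: l => [|[c [i j]] l [M IH]].
  by exists 0 => x; rewrite /bump_poly big_nil normr0 mul0r.
exists (`|c| * (expR (- a) + expR b) + M) => x; rewrite /bump_poly big_cons.
rewrite (le_trans (ler_normD _ _))// mulrDl lerD//; last exact: IH.
rewrite /bump_monom/= normrM -mulrA ler_wpM2l// ger0_norm; last first.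
  by rewrite mulr_ge0 ?exprn_ge0 ?logistic_ge0.
apply: le_trans (bump_le a b x N1); rewrite /bump !exprS -/(u x) -/(v x).
have [u0 v0] := (logistic_ge0 (N * (x - a)), logistic_ge0 (N * (b - x))).
apply: ler_pM; rewrite ?mulr_ge0 ?exprn_ge0//.
  by rewrite ler_piMr// exprn_ile1// logistic_le1.
by rewrite ler_piMr// exprn_ile1// logistic_le1.
Qed.

Lemma derive1n_bump_poly k l : exists l', derive1n k (bump_poly l) = bump_poly l'.
Proof.
elim: k => [|k [l' IH]]; first by exists l.
exists (bump_deriv l'); rewrite derive1nS IH; apply/funext => x.
by rewrite derive1E; have d := is_derive_bump_poly l' x; exact: derive_val.
Qed.

Lemma bump_poly_derivable l n x : derivable (derive1n n (bump_poly l)) x 1.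
Proof.
have [l' ->] := derive1n_bump_poly n l.
by have d := is_derive_bump_poly l' x; exact: ex_derive.
Qed.

(** The power is absorbed by [|x| ^+ j <= j! * expR |x|], a term of the exponential series. *)
Lemma bump_poly_rapid l j k :
  exists M : R, forall x, `|x ^+ j * derive1n k (bump_poly l) x| <= M.
Proof.
have [l' ->] := derive1n_bump_poly k l; have [M hM] := bump_poly_dom l'.
exists (j`!%:R * `|M|) => x; rewrite normrM normrX.
have xj : `|x| ^+ j <= j`!%:R * expR `|x|.
  case: j => [|j].
    by rewrite expr0 mul1r -expR0 ler_expR.
  rewrite -ler_pdivrMl ?ltr0n ?fact_gt0// mulrC.
  by rewrite (le_trans _ (expR_ge1Dxn j (normr_ge0 x)))// lerDr.
rewrite (@le_trans _ _ (j`!%:R * expR `|x| * (`|M| * expR (- `|x|))))//.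
  apply: ler_pM; rewrite ?exprn_ge0 ?normr_ge0//.
  by rewrite (le_trans (hM x))// ler_wpM2r ?expR_ge0 ?ler_norm.
by rewrite mulrACA -expRD subrr expR0 mulr1.
Qed.

Lemma schwartz_bump : schwartz (fun x => (bump a b N x)%:C%C).
Proof.
split => /=.
  rewrite (_ : (fun x => bump a b N x) = bump_poly [:: (1, (0%N, 0%N))]).
    by split; [exact: bump_poly_derivable|exact: bump_poly_rapid].
  apply/funext => x; rewrite /bump_poly big_cons big_nil /bump_monom/=.
  by rewrite mul1r !expr1 addr0.
rewrite (_ : (fun=> 0) = bump_poly [::]); last first.
  by apply/funext => x; rewrite /bump_poly big_nil.
by split; [exact: bump_poly_derivable|exact: bump_poly_rapid].
Qed.

End bump_schwartz.

Section transfer.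
Context d (T : measurableType d) (R : realType) (mu : {measure set T -> \bar R}).
Variable neg : T -> T.
Hypothesis mneg : measurable_fun setT neg.
Hypothesis neg_mu : forall A, measurable A -> mu (neg @^-1` A) = mu A.

Definition L2_fourier_inversion (F : (T -> R[i]) -> (T -> R[i])) :=
  L2_isometry mu F /\ forall f, L2 mu f -> F (fun xi => F f (neg xi)) = f %[ae mu].

(** The bridge from a constructed operator [F] to the operator [G] selected by [xget], of which only
    boundedness and the values on a generating family are known. *)
Lemma fourier_inversion_unique (I : Type) (b : I -> T -> R[i]) F G :
  (forall i, L2 mu (b i)) -> L2_dense mu b -> L2_fourier_inversion F ->
  L2_bounded_operator mu G -> (forall i, G (b i) = F (b i) %[ae mu]) ->
  L2_fourier_inversion G.
Proof.
move=> bL bd [FI FF] GB GFb; have /op_isometry[FB Fn] := FI.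
have GF := op_unique bL bd GB FB GFb; split.
  apply/op_isometry; split => // f fL.
  by rewrite -(Fn f fL); apply: nrm_ae; [exact: op_L2|exact: op_L2|exact: GF].
move=> f fL; have Gf := op_L2 GB fL; have Ff := op_L2 FB fL.
have GJ := L2_comp mneg neg_mu Gf; have FJ := L2_comp mneg neg_mu Ff.
have h1 := GF _ GJ.
have h2 := op_ae FB GJ FJ (ae_comp mneg neg_mu (GF _ fL)).
by move: h1 h2 (FF _ fL); apply: filterS3 => x e1 e2 e3 Dx; rewrite e1// e2// e3.
Qed.

End transfer.

Section fourier_R_properties.
Variable R : realType.
Local Notation leb := (@lebesgue_measure R).
Local Notation TR := (measurableTypeR R).

Definition schwartz_fun : Type := {phi : TR -> R[i] | schwartz (phi : R -> R[i])}.

(** Indicators of segments are dense, and each is a limit of bumps of steepness [n + 1], dominated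
    by a multiple of [expR (- |x|)]; the limit fails at most at the two endpoints, a null set. *)
Lemma schwartz_dense : L2_dense leb (fun phi : schwartz_fun => sval phi).
Proof.
have segL i : L2 leb (indC R (seg_set i : set TR)).
  exact: (L2_indC (measurable_seg i) (leb_seg_lty i)).
have sL (phi : schwartz_fun) : L2 leb (sval phi).
  by apply: schwartz_L2; exact: (svalP phi).
have segd : L2_dense leb (fun i => indC R (seg_set i : set TR)).
  exact: (L2_dense_indC (@measurable_seg R) (@leb_seg_lty R) (@seg_setI R)
    (@measurable_seg_gen R) (@seg_exhaust_nd R) (@seg_exhaustT R)).
apply: (L2_dense_trans segL sL segd) => -[[a b] /= ab].
pose s n : TR -> R[i] := fun x => (bump a b n.+1%:R x)%:C%C.
have sS n : schwartz (s n : R -> R[i]).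
  by apply: schwartz_bump; rewrite ler1n.
have vi : leb.-integrable setT (EFin \o (fun x : TR => (expR (- a) + expR b) * expR (- `|x : R|))).
  by have := integrableZl measurableT (expR (- a) + expR b) (@integrable_expR_norm R); exact: eq_integrable.
apply: (L2_closure_cvg sL (s := s) _ _ _ vi).
- by move=> n; exact: schwartz_L2.
- move=> n; exact: (L2_closure_gen leb (fun phi : schwartz_fun => sval phi)
    (exist (fun phi : TR -> R[i] => schwartz (phi : R -> R[i])) (s n) (sS n))).
- by apply: Cmeasurable_indC; exact: measurable_itv.
- by move=> x; rewrite normsq_indC; exact: indic_le_expR.
- move=> n x; have n1 : 1 <= n.+1%:R :> R by rewrite ler1n.
  apply: le_trans (bump_le a b x n1).
  by rewrite normsq_real expr2 ler_piMr ?bump_ge0 ?bump_le1.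
exists [set a; b]; split.
- by apply: measurableU; exact: measurable_set1.
- apply: countable_lebesgue_measure0; exact: finite_set_countable.
move=> x /= H; apply: contrapT => /not_orP[/eqP xa /eqP xb]; apply: H.
rewrite (_ : (fun n => _) = (fun n => (bump a b n.+1%:R x - \1_`]a, b]%classic x) ^+ 2)).
  exact: cvg_bump.
by apply/funext => n; rewrite /s /indC -rmorphB normsq_real.
Qed.

Lemma fourier_R_inversion : @L2_fourier_inversion _ TR R leb -%R (@fourier_R R).
Proof.
have [F [FI Fhat FF]] := @kernelR_transform R.
have /op_isometry[FB Fn] := FI.
(* The constructed isometry is a member of this set, so [xget] returns a member and not its
   default. *)
have [GB Gs] : [set F | L2_extension leb (@schwartz R)
    (fun phi xi => Cintegral leb (fun x => phi x * chi_infty (xi * x))) F] (@fourier_R R).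
  rewrite /fourier_R; apply: xgetPex; exists F; split => // phi sphi.
  by apply: Fhat; [exact: schwartz_Cintegrable|exact: schwartz_L2].
have sL (phi : schwartz_fun) : L2 leb (sval phi).
  by apply: schwartz_L2; exact: (svalP phi).
apply: (fourier_inversion_unique (@measurable_neg R) (@leb_neg R) sL schwartz_dense
  (conj FI FF) GB) => phi.
have h1 := Gs _ (svalP phi).
have h2 := Fhat _ (schwartz_Cintegrable (svalP phi)) (sL phi).
by move: h1 h2; apply: filterS2 => x e1 e2 Dx; rewrite e1// e2.
Qed.

End fourier_R_properties.

(** * The finite adeles *)

Section padic_rational.
Variable p : prime_nat.
Local Notation abs := (padic_abs (sval p)).

Let p_prime : prime (sval p). Proof. exact: (valP p). Qed.
Let p0 : (sval p)%:R != 0 :> rat. Proof. by rewrite pnatr_eq0 -lt0n prime_gt0. Qed.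

Lemma padic_abs_int (m : int) : abs m%:~R <= 1.
Proof.
have [->|m0] := eqVneq m 0; first by rewrite padic_abs0.
have := @padic_abs_frac p m 1 m0 isT; rewrite divr1 => ->.
by rewrite logn1 expr0 div1r invf_le1 ?exprn_gt0 ?exprn_ege1 ?ltr0n ?ler1n ?prime_gt0.
Qed.

Lemma padic_abs_nat (m : nat) : abs m%:R <= 1.
Proof. exact: (padic_abs_int m). Qed.

Lemma padic_abs_expV (k : nat) : abs ((sval p)%:R ^- k) = (sval p)%:R ^+ k.
Proof.
have := @padic_abs_frac p 1 ((sval p ^ k)%N : int) isT.
rewrite div1r logn1 expr0 divr1 -pmulrn natrX pfactorK// => -> //.
by rewrite -lt0n expn_gt0 prime_gt0.
Qed.

Lemma padic_abs_dvd (m n : int) : n != 0 -> (n %| m)%Z -> abs (m%:~R / n%:~R) <= 1.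
Proof.
by move=> n0 /dvdzP[k ->]; rewrite intrM mulfK ?intr_eq0// padic_abs_int.
Qed.

Lemma padic_abs_inv x : x != 0 -> abs x^-1 = (abs x)^-1.
Proof.
move=> x0; have := padic_absM p x x^-1; rewrite mulfV// padic_abs1 => h.
have a0 : abs x != 0 by apply: contra_eq_neq h => ->; rewrite mul0r oner_eq0.
by apply: (mulfI a0); rewrite -h mulfV.
Qed.

Lemma padic_abs_denq_coprime (q : rat) : abs q <= 1 -> coprime (sval p) `|denq q|.
Proof.
move=> q1; rewrite prime_coprime//; apply/negP => pd.
have q0 : q != 0.
  apply/eqP => q0; move: pd; rewrite q0 (_ : denq 0 = 1)// dvdn1 => /eqP e.
  by move: p_prime; rewrite e.
move: q1; rewrite /padic_abs (negPf q0) [logn _ `|numq q|]logn_coprime; last first.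
  by have := coprime_num_den q; rewrite coprime_sym; exact: coprime_dvdl.
rewrite expr0 divr1 leNgt; apply/negP; rewrite negbK -natrX ltr1n -{1}(expn0 (sval p)).
by rewrite ltn_exp2l ?prime_gt1// logn_gt0 mem_primes p_prime absz_gt0 denq_neq0.
Qed.

(* Bezout for [p] and the denominator of [q] *)
Lemma padic_abs_approx (q : rat) : abs q <= 1 -> exists k : int,
  abs ((q - k%:~R) / (sval p)%:R) <= 1.
Proof.
move=> q1; have cop := padic_abs_denq_coprime q1.
have [[u v] /= uv] := coprimezP (sval p : int) (denq q) cop.
exists (numq q * v).
have e : q - (numq q * v)%:~R = q * u%:~R * (sval p)%:R.
  have h : u%:~R * (sval p)%:R + v%:~R * (denq q)%:~R = 1 :> rat.
    by rewrite pmulrn -!intrM -intrD uv.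
  transitivity (q * (u%:~R * (sval p)%:R + v%:~R * (denq q)%:~R) - q * (denq q)%:~R * v%:~R).
    by rewrite h mulr1 intrM numqE.
  ring.
by rewrite e mulfK// padic_absM mulr_ile1 ?padic_abs_ge0// padic_abs_int.
Qed.

End padic_rational.

Section Qp_rational.
Local Open Scope quotient_scope.
Local Notation Zp := Defs.Zp.
Variable p : prime_nat.
Local Notation abs := (padic_abs (sval p)).
Implicit Types (x y : Qp p) (q r : rat).

Lemma Qp_of_ratB q r : Qp_of_rat p (q - r) = Qp_of_rat p q - Qp_of_rat p r.
Proof. by rewrite /Qp_of_rat -Qp_piB; congr (\pi_(Qp p) _); exact: val_inj. Qed.

Lemma Qp_of_ratM q r : Qp_of_rat p (q * r) = Qp_of_rat p q * Qp_of_rat p r.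
Proof. by rewrite /Qp_of_rat -Qp_piM; congr (\pi_(Qp p) _); exact: val_inj. Qed.

Lemma Qp_of_rat1 : Qp_of_rat p 1 = 1.
Proof. by rewrite /Qp_of_rat -Qp_pi1; congr (\pi_(Qp p) _); exact: val_inj. Qed.

Lemma Zp_rat q : Zp (Qp_of_rat p q) <-> abs q <= 1.
Proof.
split=> [/Qp_abs_pi_le[]// N /(_ N (leqnn N))//|q1].
by apply/Qp_abs_pi_le => //; exists 0%N.
Qed.

(** This turns integrality in the completion into rational inequalities along a representing Cauchy
    sequence. *)
Lemma Zp_mul_rat x q : Zp (x * Qp_of_rat p q) <->
  exists N, forall i, (N <= i)%N -> abs ((repr x : cauchy_seq p) i * q) <= 1.
Proof.
rewrite -[x in X in X <-> _](reprK x) /Qp_of_rat -Qp_piM.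
by split=> [/Qp_abs_pi_le[]// N h|[N h]]; [exists N|apply/Qp_abs_pi_le => //; exists N].
Qed.

Lemma Zp_subr_mul_rat x r q : Zp ((x - Qp_of_rat p r) * Qp_of_rat p q) <->
  exists N, forall i, (N <= i)%N -> abs (((repr x : cauchy_seq p) i - r) * q) <= 1.
Proof.
rewrite -[x in X in X <-> _](reprK x) /Qp_of_rat -Qp_piB -Qp_piM.
by split=> [/Qp_abs_pi_le[]// N h|[N h]]; [exists N|apply/Qp_abs_pi_le => //; exists N].
Qed.

End Qp_rational.

(** * Rational approximation of finite adeles *)

Section Af_algebra.
Local Notation Zp := Defs.Zp.
Local Notation iota := Af_of_rat.
Implicit Types (x y z : Af) (p : prime_nat) (q r : rat) (n m : nat).

Lemma Af_eqP x y : (forall p, Af_val x p = Af_val y p) -> x = y.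
Proof. by move=> e; apply: val_inj; apply: functional_extensionality_dep. Qed.

Lemma Af_valB x y p : Af_val (x - y) p = Af_val x p - Af_val y p.
Proof. by []. Qed.

Lemma Af_valM x y p : Af_val (x * y) p = Af_val x p * Af_val y p.
Proof. by []. Qed.

Lemma Af_of_ratB q r : iota (q - r) = iota q - iota r.
Proof. by apply: Af_eqP => p; exact: Qp_of_ratB. Qed.

Lemma Af_of_ratM q r : iota (q * r) = iota q * iota r.
Proof. by apply: Af_eqP => p; exact: Qp_of_ratM. Qed.

Lemma Af_of_rat1 : iota 1 = 1.
Proof. by apply: Af_eqP => p; exact: Qp_of_rat1. Qed.

Lemma Af_of_rat0 : iota 0 = 0.
Proof. by rewrite -(subrr 0) Af_of_ratB subrr. Qed.

Lemma Af_of_ratN q : iota (- q) = - iota q.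
Proof. by rewrite -sub0r Af_of_ratB Af_of_rat0 sub0r. Qed.

Lemma Af_of_ratD q r : iota (q + r) = iota q + iota r.
Proof. by rewrite -{1}(opprK r) Af_of_ratB Af_of_ratN opprK. Qed.

Lemma Af_of_ratV q : q != 0 -> iota q * iota q^-1 = 1.
Proof. by move=> q0; rewrite -Af_of_ratM mulfV// Af_of_rat1. Qed.

Lemma Zhat1 : Zhat 1. Proof. by move=> p; exact: Defs.Zp1. Qed.

Lemma ZhatB x y : Zhat x -> Zhat y -> Zhat (x - y).
Proof. by move=> xZ yZ p; exact: ZpB. Qed.

Lemma ZhatM x y : Zhat x -> Zhat y -> Zhat (x * y).
Proof. by move=> xZ yZ p; exact: ZpM. Qed.

Lemma Zhat0 : Zhat 0. Proof. by rewrite -(subrr 1); apply: ZhatB; exact: Zhat1. Qed.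

Lemma ZhatN x : Zhat x -> Zhat (- x).
Proof. by move=> xZ; rewrite -sub0r; apply: ZhatB => //; exact: Zhat0. Qed.

Lemma ZhatD x y : Zhat x -> Zhat y -> Zhat (x + y).
Proof. by move=> xZ yZ; rewrite -(opprK y); apply: ZhatB => //; exact: ZhatN. Qed.

Lemma Zhat_int (m : int) : Zhat (iota m%:~R).
Proof. by move=> p; apply/Zp_rat; exact: padic_abs_int. Qed.

Lemma Zhat_nat n : Zhat (iota n%:R).
Proof. exact: (Zhat_int n). Qed.

(** A prime divisor of the denominator would contradict integrality at that prime. *)
Lemma Zhat_rat q : Zhat (iota q) -> exists m : int, q = m%:~R.
Proof.
move=> qZ; exists (numq q).
suff d1 : denq q = 1 by rewrite -{1}(divq_num_den q) d1 divr1.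
apply/eqP; rewrite -absz_denq; apply/eqP; congr Posz.
apply/eqP; apply: contraT => d1.
have p_pr : prime (pdiv `|denq q|).
  by rewrite pdiv_prime// ltn_neqAle eq_sym d1 absz_gt0 denq_neq0.
have := qZ (exist (fun k : nat => prime k) _ p_pr) => /Zp_rat/padic_abs_denq_coprime /=.
by rewrite prime_coprime// pdiv_dvd.
Qed.

(** At the prime [n] itself, a late term of the Cauchy sequence is a rational close to the
    component, and [padic_abs_approx] finds an integer congruent to it. At every other prime [n] is
    a unit. *)
Lemma Zhat_prime_step x (n : nat) : prime n -> Zhat x ->
  exists k : int, Zhat ((x - iota k%:~R) * iota n%:R^-1).
Proof.
move=> n_pr xZ; pose p : prime_nat := exist (fun k : nat => prime k) n n_pr.
have n0 : n%:R != 0 :> rat by rewrite pnatr_eq0 -lt0n prime_gt0.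
have /(Qp_abs_le _ ltr01)[N hN] := xZ p.
have n1 : 0 < n%:R^-1 :> rat by rewrite invr_gt0 ltr0n prime_gt0.
have [M hM] := asboolP _ (cauchy_valP (repr (Af_val x p))) _ n1.
set u : nat -> rat := repr (Af_val x p) in hN hM.
have [k hk] := padic_abs_approx (hN (maxn N M) (leq_maxl _ _)).
exists k => l; rewrite Af_valM Af_valB; have [lp|lp] := eqVneq l p; last first.
  apply: ZpM; first by apply: ZpB; [exact: xZ|apply/Zp_rat; exact: padic_abs_int].
  apply/Zp_rat; have := @padic_abs_frac l 1 n isT; rewrite div1r => ->.
    rewrite logn1 expr0 divr1 logn_prime// (_ : (_ == _) = false) ?expr0//.
    apply/negbTE; apply: contraNneq lp => lp; apply/eqP; exact: val_inj.
  by rewrite -lt0n prime_gt0.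
rewrite {l}lp; apply/Zp_subr_mul_rat; exists (maxn N M) => i; rewrite geq_max => /andP[Ni Mi].
rewrite -/u (_ : (u i - k%:~R) / n%:R = (u i - u (maxn N M)) / n%:R +
  (u (maxn N M) - k%:~R) / n%:R); last by field.
apply: padic_absD_le => //; rewrite padic_absM.
have -> : padic_abs (sval p) n%:R^-1 = n%:R by have := padic_abs_expV p 1; rewrite !expr1.
by rewrite -ler_pdivlMr ?ltr0n ?prime_gt0// div1r ltW// hM// leq_maxr.
Qed.

(** Strong induction on [n] in place of the Chinese remainder theorem: with [l] the least prime
    factor, [k] is a residue modulo [l], [j] a residue of the quotient modulo [n / l], and
    [k + l * j] is the residue modulo [n]. *)
Lemma Zhat_mod x n : (0 < n)%N -> Zhat x ->
  exists k : int, Zhat ((x - iota k%:~R) * iota n%:R^-1).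
Proof.
elim/ltn_ind: n x => n IH x n0 xZ.
have [n1|n1] := leqP n 1.
  have -> : n = 1%N by apply/eqP; rewrite eqn_leq n1.
  by exists 0; rewrite invr1 Af_of_rat1 mulr1 Af_of_rat0 subr0.
have p_pr := pdiv_prime n1; set l := pdiv n in p_pr.
have [k hk] := Zhat_prime_step p_pr xZ.
have m0 : (0 < n %/ l)%N by rewrite divn_gt0 ?prime_gt0// dvdn_leq// pdiv_dvd.
have [|j hj] := IH (n %/ l)%N _ _ m0 hk.
  by rewrite ltn_Pdiv// prime_gt1.
exists (k + l%:Z * j).
have nl : (n%:R : rat) = l%:R * (n %/ l)%:R by rewrite -natrM mulnC divnK// pdiv_dvd.
have l0 : l%:R != 0 :> rat by rewrite pnatr_eq0 -lt0n prime_gt0.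
have d0 : (n %/ l)%:R != 0 :> rat by rewrite pnatr_eq0 -lt0n.
move: hj; congr Zhat; rewrite nl invfM Af_of_ratM intrD intrM /= -pmulrn Af_of_ratD Af_of_ratM.
have := Af_of_ratV l0.
move: (iota l%:R) (iota l%:R^-1) (iota j%:~R) (iota k%:~R) (iota (n %/ l)%:R^-1).
move=> a a' jj kk dd aa; transitivity ((x - kk) * a' * dd - a * a' * jj * dd).
  by rewrite aa mul1r; ring.
ring.
Qed.

(** A Cauchy sequence is bounded, and a large power of [p] outweighs the bound. *)
Lemma Zp_bounded x p : exists n, (0 < n)%N /\ Zp (Af_val x p * Qp_of_rat p n%:R).
Proof.
have [M [M0 [N hN]]] := padic_cauchy_bounded (cauchy_valP (repr (Af_val x p))).
pose k := Num.bound M; exists (sval p ^ k)%N; split.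
  by rewrite expn_gt0 prime_gt0// (valP p).
apply/Zp_mul_rat; exists N => i /hN/ltW hi; rewrite padic_absM.
have pk : (sval p ^ k)%:R != 0 :> rat by rewrite pnatr_eq0 -lt0n expn_gt0 prime_gt0// (valP p).
have -> : padic_abs (sval p) (sval p ^ k)%:R = ((sval p ^ k)%:R)^-1.
  by rewrite -[X in padic_abs _ X]invrK padic_abs_inv ?invr_eq0// natrX padic_abs_expV.
rewrite ler_pdivrMr ?mul1r ?ltr0n ?expn_gt0 ?prime_gt0 ?(valP p)//.
rewrite (le_trans hi)// ltW// (lt_le_trans (archi_boundP (ltW M0)))//.
by rewrite ler_nat ltnW// ltn_expl// prime_gt1// (valP p).
Qed.

Lemma Zp_natM (p : prime_nat) (w : Qp p) n : Zp w -> Zp (w * Qp_of_rat p n%:R).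
Proof. by move=> wZ; apply: ZpM => //; apply/Zp_rat; exact: padic_abs_nat. Qed.

(** The local solutions at the finitely many primes of [A] are multiplied together. It serves both
    for the denominators of an adele and for the radii of a neighbourhood. *)
Lemma uniform_denominator (P : prime_nat -> nat -> Prop) (A : set prime_nat) :
  finite_set A -> (forall p, exists n, (0 < n)%N /\ P p n) ->
  (forall p m n, (0 < n)%N -> P p m -> P p (m * n)%N) ->
  (forall p n, ~ A p -> (0 < n)%N -> P p n) ->
  exists n, (0 < n)%N /\ forall p, P p n.
Proof.
move=> /finite_seqP[s ->] ex mul triv.
have /choice[k hk] := ex.
pose n := \prod_(p <- s) k p.
have n0 : (0 < n)%N by rewrite prodn_gt0// => p; have [] := hk p.
exists n; split => // p; have [ps|ps] := boolP (p \in s); last first.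
  by apply: triv => //= ps'; rewrite ps' in ps.
rewrite /n (big_rem p ps)/=; apply: mul; last by have [] := hk p.
by rewrite prodn_gt0// => q; have [] := hk q.
Qed.

Lemma Af_denominator x : exists n, (0 < n)%N /\ Zhat (x * iota n%:R).
Proof.
have /asboolP xf := Af_valP x.
apply: (uniform_denominator (P := fun p n => Zp (Af_val x p * Qp_of_rat p n%:R)) xf).
- exact: Zp_bounded.
- by move=> p m n _ h; rewrite natrM Qp_of_ratM mulrA; exact: Zp_natM.
- by move=> p n /contrapT h _; exact: Zp_natM.
Qed.

(** Strong approximation: clear the denominator [m] of [x], take an integer residue modulo [m * n],
    and divide by [m]. *)
Lemma Af_approx x n : (0 < n)%N -> exists q, Zhat ((x - iota q) * iota n%:R^-1).
Proof.
move=> n0; have [m [m0 xm]] := Af_denominator x.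
have [|k hk] := @Zhat_mod _ (m * n) _ xm; first by rewrite muln_gt0 m0.
exists (k%:~R / m%:R); move: hk; congr Zhat.
have mn0 : m%:R != 0 :> rat by rewrite pnatr_eq0 -lt0n.
rewrite natrM invfM !Af_of_ratM.
have := Af_of_ratV mn0.
move: (iota m%:R) (iota m%:R^-1) (iota k%:~R) (iota n%:R^-1) => a a' kk nn aa.
transitivity (a * a' * x * nn - kk * a' * nn); first ring.
by rewrite aa mul1r; ring.
Qed.

(* The coset of [q Zhat] through [x]; meaningful for [q != 0] only. *)
Definition Af_ball x q : set Af := [set y | Zhat ((y - x) * iota q^-1)].

Lemma Af_ball_refl x q : Af_ball x q x.
Proof. by rewrite /Af_ball/= subrr mul0r; exact: Zhat0. Qed.

Lemma Af_ball_sym x y q : Af_ball x q y -> Af_ball y q x.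
Proof. by rewrite /Af_ball/= -opprB mulNr => /ZhatN; rewrite opprK. Qed.

Lemma Af_ball_trans x y z q : Af_ball x q y -> Af_ball y q z -> Af_ball x q z.
Proof.
rewrite /Af_ball/= => h1 h2.
have -> : (z - x) * iota q^-1 = (y - x) * iota q^-1 + (z - y) * iota q^-1.
  by rewrite -mulrDl (addrC (y - x)) addrA subrK.
exact: (ZhatD h1 h2).
Qed.

Lemma Af_ball_eq x y q : Af_ball x q y -> Af_ball x q = Af_ball y q.
Proof.
move=> xy; apply/seteqP; split => z.
  exact: Af_ball_trans (Af_ball_sym xy).
exact: Af_ball_trans xy.
Qed.

Lemma Af_ball_mul x q n : (0 < n)%N -> Af_ball x (q * n%:R) `<=` Af_ball x q.
Proof.
move=> n0 y; rewrite /Af_ball/= => h.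
have nn0 : n%:R != 0 :> rat by rewrite pnatr_eq0 -lt0n.
have -> : (y - x) * iota q^-1 = (y - x) * iota (q * n%:R)^-1 * iota n%:R.
  by rewrite -mulrA -Af_of_ratM invfM -mulrA mulVf// mulr1.
by apply: ZhatM => //; exact: Zhat_nat.
Qed.

Lemma Af_ball_dvd x n m : (0 < m)%N -> (n %| m)%N ->
  Af_ball x m%:R `<=` Af_ball x n%:R.
Proof.
move=> m0 /dvdnP[k mk]; have k0 : (0 < k)%N by move: m0; rewrite mk muln_gt0 => /andP[].
by rewrite mk mulnC natrM; exact: Af_ball_mul.
Qed.

End Af_algebra.

(** * Balls and the topology of the finite adeles *)

Section Af_topology.
Local Notation Zp := Defs.Zp.
Implicit Types (p : prime_nat) (q r : rat) (n m : nat).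

Lemma ZpD p (x y : Qp p) : Zp x -> Zp y -> Zp (x + y).
Proof.
move=> xZ yZ; rewrite -(opprK y); apply: ZpB => //; rewrite -sub0r; apply: ZpB => //.
by rewrite -(subrr 1); apply: ZpB; exact: Defs.Zp1.
Qed.

Lemma Qp_open_ball p (V : set (Qp p)) (x : Qp p) : open V -> V x ->
  exists n, (0 < n)%N /\ forall y, Zp ((y - x) * Qp_of_rat p n%:R^-1) -> V y.
Proof.
move=> Vo /Vo[e e0 eV].
have p0 : (0 < sval p)%N by rewrite prime_gt0// (valP p).
pose k := Num.bound e^-1; exists (sval p ^ k)%N; split; first by rewrite expn_gt0 p0.
move=> y /Zp_mul_rat[N hN]; apply: eV.
have pk0 : 0 < (sval p)%:R ^- k :> rat by rewrite invr_gt0 exprn_gt0// ltr0n.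
apply: (@le_lt_trans _ _ ((sval p)%:R ^- k)).
  apply/(Qp_abs_le _ pk0); exists N => i /hN; rewrite padic_absM natrX padic_abs_expV.
  by rewrite -ler_pdivlMr ?exprn_gt0 ?ltr0n// div1r.
rewrite -[ltRHS]invrK ltf_pV2 ?posrE ?invr_gt0 ?exprn_gt0 ?ltr0n//.
have ei0 : 0 <= e^-1 by rewrite invr_ge0 ltW.
rewrite (lt_le_trans (archi_boundP ei0))// -natrX ler_nat ltnW// ltn_expl//.
by rewrite prime_gt1// (valP p).
Qed.

Lemma Qp_ball_open p (x : Qp p) n : (0 < n)%N ->
  open [set y | Zp ((y - x) * Qp_of_rat p n%:R^-1)].
Proof.
move=> n0; suff : Qp_open [set y | Zp ((y - x) * Qp_of_rat p n%:R^-1)] by [].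
move=> y /= xy; have nn0 : n%:R != 0 :> rat by rewrite pnatr_eq0 -lt0n.
have a0 : 0 < padic_abs (sval p) n%:R^-1.
  rewrite lt0r padic_abs_ge0 andbT; apply/eqP => a0.
  have := padic_absM p n%:R n%:R^-1; rewrite a0 mulr0 mulfV// padic_abs1 => /eqP.
  by rewrite oner_eq0.
exists (padic_abs (sval p) n%:R^-1)^-1; first by rewrite invr_gt0.
move=> z /ltW; rewrite Qp_abs_le ?invr_gt0// => -[N hN].
rewrite (_ : z - x = (z - y) + (y - x)); last by rewrite addrA subrK.
rewrite mulrDl; apply: ZpD => //; apply/Zp_mul_rat; exists N => i /hN h.
by rewrite padic_absM -ler_pdivlMr// div1r.
Qed.

(** Balls of integer radius form neighbourhood bases. The local radii of a basic open set differ
    from 1 at finitely many primes and merge into one integer; conversely a ball of radius [n] is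
    [Zp] in each component where [x] is integral and [p] exceeds [n]. *)
Lemma Af_open_ballP (U : set Af) : open U <->
  forall x, U x -> exists n, (0 < n)%N /\ Af_ball x n%:R `<=` U.
Proof.
split=> [Uo x Ux|H].
  have [V [Vo Vf Vx VU]] := Uo x Ux.
  have [||||n [n0 nV]] := uniform_denominator (A := [set p | V p <> @Zp p] `|` [set p | ~ Zp (Af_val x p)])
      (P := fun p n => forall y : Qp p, Zp ((y - Af_val x p) * Qp_of_rat p n%:R^-1) -> V p y).
  - by apply: finite_setU2 => //; have /asboolP := Af_valP x.
  - by move=> p; exact: Qp_open_ball.
  - move=> p m n n0 h y hy; apply: h.
    have nn0 : n%:R != 0 :> rat by rewrite pnatr_eq0 -lt0n.
    have -> : (y - Af_val x p) * Qp_of_rat p m%:R^-1 =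
        (y - Af_val x p) * Qp_of_rat p (m * n)%:R^-1 * Qp_of_rat p n%:R.
      by rewrite -mulrA -Qp_of_ratM natrM invfM -mulrA mulVf// mulr1.
    exact: Zp_natM.
  - move=> p n /not_orP[/contrapT -> /contrapT xZ] n0 y yZ.
    have nn0 : n%:R != 0 :> rat by rewrite pnatr_eq0 -lt0n.
    rewrite -(subrK (Af_val x p) y); apply: ZpD => //.
    by have := Zp_natM n yZ; rewrite -mulrA -Qp_of_ratM mulVf// Qp_of_rat1 mulr1.
  exists n; split => // y xy; apply: VU => p; apply: nV; exact: (xy p).
suff : Af_open U by [].
move=> x /H[n [n0 nU]].
exists (fun p => [set y | Zp ((y - Af_val x p) * Qp_of_rat p n%:R^-1)]).
have nn0 : n%:R != 0 :> rat by rewrite pnatr_eq0 -lt0n.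
split.
- by move=> p; exact: Qp_ball_open.
- have /asboolP xf := Af_valP x.
  have nf : finite_set ((fun p : prime_nat => sval p) @^-1` `I_n.+1).
    by apply: finite_preimage; [move=> p p' _ _; exact: val_inj|exact: finite_II].
  apply: sub_finite_set (finite_setU2 xf nf) => p /= ne; apply: contrapT.
  move=> /not_orP[/contrapT xZ /= np]; apply: ne.
  have nV : Zp (Qp_of_rat p n%:R^-1).
    apply/Zp_rat; have := @padic_abs_frac p 1 n isT; rewrite div1r => ->.
      rewrite logn1 expr0 divr1 logn_coprime ?expr0// prime_coprime ?(valP p)//.
      by apply/negP => /dvdn_leq => /(_ n0) h; apply: np; rewrite ltnS.
    by rewrite -lt0n.
  apply/seteqP; split => y /= yZ.
    rewrite -(subrK (Af_val x p) y); apply: ZpD => //.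
    by have := Zp_natM n yZ; rewrite -mulrA -Qp_of_ratM mulVf// Qp_of_rat1 mulr1.
  by apply: ZpM => //; exact: ZpB.
- move=> p /=; rewrite subrr mul0r.
  by rewrite -(subrr 1); apply: ZpB; exact: Defs.Zp1.
- by move=> y yV; apply: nU => p; exact: yV.
Qed.

Lemma Af_ball_int_sub (x : Af) q : q != 0 ->
  exists n, (0 < n)%N /\ Af_ball x n%:R `<=` Af_ball x q.
Proof.
move=> q0; exists `|numq q|%N; split; first by rewrite absz_gt0 numq_eq0.
have d0 : (0 < `|denq q|)%N by rewrite absz_gt0 denq_neq0.
apply: subset_trans (Af_ball_mul (n := `|denq q|%N) d0).
have -> : q * `|denq q|%N%:R = (numq q)%:~R by rewrite pmulrn absz_denq numqE.
case: (numq q) => n y; first by rewrite absz_nat.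
rewrite NegzE abszN absz_nat mulrNz -pmulrn /Af_ball/= invrN Af_of_ratN mulrN => yZ.
exact: ZhatN.
Qed.

Lemma open_Af_ball (x : Af) q : q != 0 -> open (Af_ball x q).
Proof.
move=> q0; apply/Af_open_ballP => y xy; rewrite (Af_ball_eq xy).
exact: Af_ball_int_sub.
Qed.

Lemma closed_Af_ball (x : Af) q : q != 0 -> closed (Af_ball x q).
Proof.
move=> q0; rewrite -openC; apply/Af_open_ballP => y xy.
have [n [n0 nq]] := Af_ball_int_sub y q0; exists n; split; first exact: n0.
move=> z /nq yz xz.
exact: xy (Af_ball_trans xz (Af_ball_sym yz)).
Qed.

Lemma nbhs_Af_ball (x : Af) (A : set Af) : nbhs x A <->
  exists n, (0 < n)%N /\ Af_ball x n%:R `<=` A.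
Proof.
rewrite nbhsE; split=> [[U [Uo Ux] UA]|[n [n0 nA]]].
  have /Af_open_ballP/(_ x Ux)[n [n0 nU]] := Uo.
  by exists n; split => // y /nU/UA.
exists (Af_ball x n%:R) => //; split; last exact: Af_ball_refl.
by apply: open_Af_ball; rewrite pnatr_eq0 -lt0n.
Qed.

Lemma Af_ball_fact (x : Af) n : (0 < n)%N -> Af_ball x n`!%:R `<=` Af_ball x n%:R.
Proof. by move=> n0; apply: Af_ball_dvd; rewrite ?fact_gt0// dvdn_fact// n0 /=. Qed.

End Af_topology.

(** * Compactness of balls *)

Section Af_compact.
Local Notation Zp := Defs.Zp.
Local Notation iota := Af_of_rat.
Implicit Types (p : prime_nat) (q r : rat) (n m : nat).

Lemma ultra_finite_union (T : Type) (F : set_system T) (A : nat -> set T) m :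
  UltraFilter F -> F [set x | exists k, (k < m)%N /\ A k x] -> exists k, F (A k).
Proof.
move=> FU; elim: m => [|m IH] Fm.
  have FP := ultra_proper (F := F).
  by have [x [k []]] := filter_ex Fm.
have FP := ultra_proper (F := F).
have [FA|FA] := in_ultra_setVsetC (A m) FU; first by exists m.
apply: IH; apply: filterS2 Fm FA => x [k [km Ak]] nA.
exists k; split => //; move: km; rewrite ltnS leq_eqVlt => /predU1P[km|//].
by exfalso; apply: nA; rewrite -km.
Qed.

Lemma Af_ball_int_dvd (k j : int) n : (0 < n)%N ->
  Af_ball (iota k%:~R) n%:R (iota j%:~R) <-> (n %| j - k)%Z.
Proof.
move=> n0; have nn0 : n%:R != 0 :> rat by rewrite pnatr_eq0 -lt0n.
rewrite /Af_ball/= -Af_of_ratB -Af_of_ratM -intrB; split.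
  move=> /Zhat_rat[m e]; apply/dvdzP; exists m.
  apply: (@intr_inj rat); rewrite intrM -e /= -pmulrn; field.
  exact: nn0.
by move=> /dvdzP[m ->]; rewrite intrM /= -pmulrn mulfK//; exact: Zhat_int.
Qed.

Lemma Zhat_residue x n : (0 < n)%N -> Zhat x -> exists k : nat, (k < n)%N /\
  Af_ball (iota k%:R) n%:R x.
Proof.
move=> n0 xZ; have [k hk] := Zhat_mod n0 xZ.
have nz0 : (n : int) != 0 by rewrite eqz_nat -lt0n.
exists `|(k %% n)%Z|%N; split.
  by rewrite -ltz_nat gez0_abs ?modz_ge0// ltz_pmod.
have h : Af_ball (iota `|(k %% n)%Z|%N%:R) n%:R (iota k%:~R).
  rewrite pmulrn gez0_abs; last exact: modz_ge0.
  apply/(Af_ball_int_dvd _ _ n0).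
  by rewrite -(eqz_mod_dvd) modz_mod.
exact: Af_ball_trans h hk.
Qed.

Lemma fact_dvd_fact n m : (n <= m)%N -> (n`! %| m`!)%N.
Proof. by move=> nm; rewrite -(bin_fact nm) dvdn_mull// dvdn_mulr. Qed.

Section limit.
Variable k : nat -> int.
Hypothesis k_coherent : forall n m, (n <= m)%N -> (n`! %| k m - k n)%Z.

(** Since [p ^ K] divides its own factorial, coherence modulo all factorials makes the sequence
    Cauchy at every prime at once. *)
Lemma coherent_cauchy p : (fun i => (k i)%:~R) \in padic_cauchy p.
Proof.
have p0 : (0 < sval p)%N by rewrite prime_gt0// (valP p).
apply/asboolP => e e0; pose K := Num.bound e^-1; pose M := (sval p ^ K)%N.
have M0 : (0 < M)%N by rewrite expn_gt0 p0.
have Me : (M%:R)^-1 < e :> rat.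
  rewrite -[ltRHS]invrK ltf_pV2 ?posrE ?invr_gt0 ?ltr0n//.
  have ei0 : 0 <= e^-1 by rewrite invr_ge0 ltW.
  rewrite (lt_le_trans (archi_boundP ei0))// ler_nat ltnW// ltn_expl//.
  by rewrite prime_gt1// (valP p).
exists M => i j Mi Mj; apply: le_lt_trans Me.
have : (M %| k i - k j)%Z.
  have Mf : (M%:Z %| M`!%:Z)%Z by rewrite dvdzE/= dvdn_fact// M0 /=.
  have := rpredB (dvdz_trans Mf (k_coherent Mi)) (dvdz_trans Mf (k_coherent Mj)).
  by rewrite opprB addrA subrK.
move=> /dvdzP[m e']; rewrite -intrB e' intrM padic_absM.
have -> : padic_abs (sval p) (M : int)%:~R = M%:R^-1.
  have M1 : M%:R != 0 :> rat by rewrite pnatr_eq0 -lt0n.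
  rewrite -[X in padic_abs _ X]invrK padic_abs_inv ?invr_eq0 -?pmulrn//.
  by rewrite /M natrX padic_abs_expV.
by rewrite ler_piMl ?invr_ge0// padic_abs_int.
Qed.

Definition coherent_Qp p : Qp p := (\pi_(Qp p) (CauchySeq (coherent_cauchy p)))%qT.

Lemma coherent_Qp_Zp p : Zp (coherent_Qp p).
Proof. by apply/Qp_abs_pi_le => //; exists 0%N => i _; exact: padic_abs_int. Qed.

Lemma coherent_restricted : coherent_Qp \in restricted.
Proof.
apply/asboolP; rewrite (_ : [set _ | _] = set0)//.
by rewrite -subset0 => p /=; apply; exact: coherent_Qp_Zp.
Qed.

Definition coherent_limit : Af := MkAf coherent_restricted.

Lemma coherent_limit_ball n : Af_ball (iota (k n)%:~R) n`!%:R coherent_limit.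
Proof.
move=> p; rewrite Af_valM Af_valB /= /coherent_Qp /Qp_of_rat -Qp_piB -Qp_piM.
apply/Qp_abs_pi_le => //; exists n => i ni.
apply: (@le_trans _ _ (padic_abs (sval p) ((k i - k n)%:~R / (n`! : int)%:~R))).
  by rewrite intrB.
by apply: padic_abs_dvd; [rewrite eqz_nat -lt0n fact_gt0|exact: k_coherent].
Qed.

End limit.

Lemma compact_Zhat : compact Zhat.
Proof.
(* An ultrafilter on Zhat picks a residue modulo each n!; these converge. *)
rewrite compact_ultra => F FU FZ; have FP := ultra_proper (F := F).
have /choice[k hk] : forall n, exists k : nat, F (Af_ball (iota k%:R) n`!%:R).
  move=> n; apply: (@ultra_finite_union _ F (fun k => Af_ball (iota k%:R) n`!%:R) n`! FU).
  by apply: filterS FZ => x /(Zhat_residue (fact_gt0 n)).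
have kc n m : (n <= m)%N -> (n`! %| (k m : int) - (k n : int))%Z.
  move=> nm; apply/(Af_ball_int_dvd _ _ (fact_gt0 n)).
  have [y [yn ym]] := filter_ex (filterI (hk n) (hk m)).
  apply: Af_ball_trans yn _; apply: Af_ball_sym.
  by apply: Af_ball_dvd ym; rewrite ?fact_gt0// fact_dvd_fact.
pose x := coherent_limit kc; exists x; split.
  by move=> p; exact: coherent_Qp_Zp.
move=> A /nbhs_Af_ball[n [n0 nA]]; apply: filterS (hk n).
apply: subset_trans nA; rewrite (Af_ball_eq (coherent_limit_ball kc n)).
exact: Af_ball_fact.
Qed.

(** The ball is the image of [Zhat] under [y |-> x + y * q]; in the modulus of continuity of this
    map the denominator of [q] appears. *)
Lemma compact_Af_ball x q : q != 0 -> compact (Af_ball x q).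
Proof.
move=> q0; have -> : Af_ball x q = (fun y => x + y * iota q) @` Zhat.
  apply/seteqP; split => [y xy|_ [y yZ <-]].
    exists ((y - x) * iota q^-1) => //.
    by rewrite -mulrA -Af_of_ratM mulVf// Af_of_rat1 mulr1 addrC subrK.
  by rewrite /Af_ball/= addrC addKr -mulrA Af_of_ratV// mulr1.
apply: continuous_compact; last exact: compact_Zhat.
apply: continuous_subspaceT => y A /nbhs_Af_ball[m [m0 mA]].
have d0 : (0 < `|denq q|)%N by rewrite absz_gt0 denq_neq0.
have d1 : (denq q)%:~R != 0 :> rat by rewrite intr_eq0 denq_neq0.
apply/nbhs_Af_ball; exists (m * `|denq q|)%N; split; first by rewrite muln_gt0 m0.
move=> z yz; apply: mA; rewrite /Af_ball/= opprD addrACA subrr add0r -mulrBl.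
have -> : (z - y) * iota q * iota m%:R^-1 =
    (z - y) * iota (m * `|denq q|)%:R^-1 * iota (numq q)%:~R.
  rewrite -!mulrA -!Af_of_ratM; congr (_ * iota _).
  by rewrite natrM invfM numqE (pmulrn _ `|denq q|) absz_denq; field; rewrite d1 pnatr_eq0 -lt0n.
by apply: ZhatM => //; exact: Zhat_int.
Qed.

End Af_compact.

(** * The canonical character *)

Section character.
Variable R : realType.
Local Notation iota := Af_of_rat.
Implicit Types (x y : Af) (q r : rat).

Lemma expiD (s t : R) : expi (s + t) = expi s * expi t.
Proof. by apply: eq_ReIm; rewrite !ReImE/= ?cosD ?sinD//; ring. Qed.

Lemma expiN (s : R) : expi (- s) = conjc (expi s).
Proof. by rewrite /expi cosN sinN. Qed.

Lemma normsq_expi (s : R) : normsq (expi s) = 1.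
Proof. by rewrite /normsq /= cos2Dsin2. Qed.

Lemma expi_nat (n : nat) : expi (2 * pi * n%:R) = 1 :> R[i].
Proof.
elim: n => [|n IH]; first by rewrite mulr0 /expi cos0 sin0.
have -> : 2 * pi * n.+1%:R = 2 * pi * n%:R + 2 * pi :> R by rewrite -natr1; ring.
by rewrite expiD IH mul1r /expi mulr_natl cos2pi sin2pi.
Qed.

Lemma expi_int (m : int) : expi (2 * pi * m%:~R) = 1 :> R[i].
Proof.
case: m => n; first exact: expi_nat.
by rewrite NegzE mulrNz mulrN expiN -pmulrn expi_nat conjc1.
Qed.

(** Existence only: a rational congruent to [x] modulo [Zhat], minus its floor. *)
Lemma Af_fracP x : 0 <= Af_frac x < 1 /\ Zhat (x - iota (Af_frac x)).
Proof.
rewrite /Af_frac; apply: (@xgetPex _ 0 [set r | 0 <= r < 1 /\ Zhat (x - iota r)]).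
have [q hq] := Af_approx x (isT : (0 < 1)%N).
exists (q - (Num.floor q)%:~R); split.
  have /andP[f1 f2] := floor_itv q.
  by rewrite subr_ge0 f1 ltrBlDl -[X in _ < _ + X]/(1%:~R) -intrD.
rewrite Af_of_ratB opprB addrA addrAC; apply: ZhatD; last exact: Zhat_int.
by move: hq; rewrite invr1 Af_of_rat1 mulr1.
Qed.

(* The fractional part may be replaced by any rational congruent to [x]. *)
Lemma chi_fE x r : Zhat (x - iota r) -> chi_f R x = expi (2 * pi * ratr r).
Proof.
move=> xr; have [_ xf] := Af_fracP x.
have [m e] : exists m : int, Af_frac x - r = m%:~R.
  apply: Zhat_rat; rewrite Af_of_ratB -(subrKA x) -opprB addrC.
  by apply: ZhatB.
rewrite /chi_f -[Af_frac x](subrK r) e rmorphD/= ratr_int mulrDr expiD expi_int.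
by rewrite mul1r.
Qed.

Lemma chi_fD x y : chi_f R (x + y) = chi_f R x * chi_f R y.
Proof.
have [_ xf] := Af_fracP x; have [_ yf] := Af_fracP y.
have xyf : Zhat (x + y - iota (Af_frac x + Af_frac y)).
  have := ZhatD xf yf; congr Zhat.
  by rewrite (Af_of_ratD (Af_frac x)) (opprD (iota _)) addrACA.
rewrite /chi_f -expiD -mulrDr -(rmorphD (@ratr R)); exact: chi_fE.
Qed.

Lemma chi_f_Zhat x : Zhat x -> chi_f R x = 1.
Proof.
move=> xZ; have x0 : Zhat (x - iota 0) by rewrite Af_of_rat0 subr0.
by rewrite (chi_fE x0) rmorph0 mulr0 /expi cos0 sin0.
Qed.

Lemma chi_fN x : chi_f R (- x) = conjc (chi_f R x).
Proof.
have [_ xf] := Af_fracP x.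
have xNf : Zhat (- x - iota (- Af_frac x)).
  by rewrite Af_of_ratN -opprD; exact: ZhatN.
by rewrite (chi_fE xNf) rmorphN mulrN expiN.
Qed.

Lemma normsq_chi_f x : normsq (chi_f R x) = 1.
Proof. exact: normsq_expi. Qed.

(** With [t] the fractional part, [cos (2 pi t) = 1 - 2 sin (pi t) ^+ 2], and [sin (pi t) > 0] for
    [0 < t < 1]. That the kernel of the character is exactly [Zhat] makes its integral vanish over
    the balls where it is not trivial. *)
Lemma chi_f_eq1 x : chi_f R x = 1 -> Zhat x.
Proof.
have [/andP[f0 f1] xf] := Af_fracP x; rewrite /chi_f => -[c1 _].
suff e0 : Af_frac x = 0 by move: xf; rewrite e0 Af_of_rat0 subr0.
apply/eqP; rewrite eq_le f0 andbT leNgt; apply/negP => fpos.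
set t := ratr (Af_frac x) : R; have t0 : 0 < t by rewrite ltr0q.
have t1 : t < 1.
  have : t < ratr 1 by rewrite /t ltr_rat.
  by rewrite (rmorph1 (@ratr R)).
move: c1; rewrite -/t (_ : 2 * pi * t = pi * t + pi * t); last by ring.
rewrite cosD => c1.
have := cos2Dsin2 (pi * t) => cs.
have s0 : 0 < sin (pi * t).
  by apply: sin_gt0_pi; rewrite mulr_gt0 ?pi_gt0//= gtr_pMr ?pi_gt0.
have : 0 < sin (pi * t) ^+ 2 by rewrite exprn_gt0.
by move: c1 cs; rewrite !expr2; lra.
Qed.

End character.

(** * A countable family of balls and the Borel sets *)

Section Af_measure.
Local Notation iota := Af_of_rat.
Implicit Types (x y : Af) (q r : rat) (n m : nat).

(* The radii n! and 1/n! form a chain for divisibility, so that two balls with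
   such radii are nested or disjoint. *)
Definition scale (s : bool * nat) : rat :=
  if s.1 then s.2`!%:R else s.2`!%:R^-1.

Lemma scale_gt0 s : 0 < scale s.
Proof. by rewrite /scale; case: s.1; rewrite ?invr_gt0 ltr0n fact_gt0. Qed.

Lemma scale_neq0 s : scale s != 0.
Proof. by rewrite gt_eqF// scale_gt0. Qed.

Lemma scale_chain s t : exists n, (0 < n)%N /\
  (scale t = scale s * n%:R \/ scale s = scale t * n%:R).
Proof.
have f0 n : n`!%:R != 0 :> rat by rewrite pnatr_eq0 -lt0n fact_gt0.
have quot n m : (n <= m)%N -> exists k, (0 < k)%N /\ m`!%:R = n`!%:R * k%:R :> rat.
  move=> /fact_dvd_fact/dvdnP[k e]; exists k; split.
    by have := fact_gt0 m; rewrite e muln_gt0 => /andP[].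
  by rewrite e natrM mulrC.
have cross n m : exists k, (0 < k)%N /\ m`!%:R = n`!%:R^-1 * k%:R :> rat.
  exists (n`! * m`!)%N; split; first by rewrite muln_gt0 !fact_gt0.
  by rewrite natrM mulrA mulVf// mul1r.
have inv n m : (n <= m)%N -> exists k, (0 < k)%N /\ n`!%:R^-1 = m`!%:R^-1 * k%:R :> rat.
  move=> /quot[k [k0 e]]; exists k; split => //; rewrite e invfM -mulrA mulVf ?mulr1//.
  by rewrite pnatr_eq0 -lt0n.
case: s t => -[] n [[] m]; rewrite /scale/=.
- have [/quot|/ltnW/quot] := leqP n m => -[k [k0 e]]; exists k; split => //; [by left|by right].
- by have [k [k0 e]] := cross m n; exists k; split => //; right.
- by have [k [k0 e]] := cross n m; exists k; split => //; left.
- have [/inv|/ltnW/inv] := leqP n m => -[k [k0 e]]; exists k; split => //; [by right|by left].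
Qed.

(** Rational centres and factorial scales leave a countable family, so that every open set is a
    countable union of discs. *)
Definition Af_disc (i : rat * (bool * nat)) : set Af := Af_ball (iota i.1) (scale i.2).

Lemma measurable_Af_open (U : set Af) : open U -> measurable U.
Proof. by move=> Uo; apply: sub_gen_smallest. Qed.

Lemma measurable_Af_ball x q : q != 0 -> measurable (Af_ball x q).
Proof. by move=> q0; apply: measurable_Af_open; exact: open_Af_ball. Qed.

Lemma measurable_Af_disc i : measurable (Af_disc i).
Proof. by apply: measurable_Af_ball; exact: scale_neq0. Qed.

Lemma Af_ball_setI x y q n : (0 < n)%N -> Af_ball x q y ->
  Af_ball x q `&` Af_ball y (q * n%:R) = Af_ball y (q * n%:R).
Proof.
move=> n0 /Af_ball_eq ->; apply: setIidr; exact: Af_ball_mul.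
Qed.

Lemma Af_ball_disjoint x y q n : (0 < n)%N -> ~ Af_ball x q y ->
  Af_ball x q `&` Af_ball y (q * n%:R) = set0.
Proof.
move=> n0 xy; apply/seteqP; split => // z [xz /(Af_ball_mul n0) yz]; apply: xy.
exact: Af_ball_trans xz (Af_ball_sym yz).
Qed.

Lemma Af_disc_setI i j : Af_disc i `&` Af_disc j = set0 \/
  exists k, Af_disc i `&` Af_disc j = Af_disc k.
Proof.
have key i' j' n : (0 < n)%N -> scale j'.2 = scale i'.2 * n%:R ->
    Af_disc i' `&` Af_disc j' = set0 \/ Af_disc i' `&` Af_disc j' = Af_disc j'.
  move=> n0 e; rewrite /Af_disc e.
  have [h|h] := pselect (Af_ball (iota i'.1) (scale i'.2) (iota j'.1)).
    by right; exact: Af_ball_setI.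
  by left; exact: Af_ball_disjoint.
have [n [n0 [e|e]]] := scale_chain i.2 j.2.
  by have [->|->] := key i j n n0 e; [left|right; exists j].
by rewrite setIC; have [->|->] := key j i n n0 e; [left|right; exists i].
Qed.

Lemma Af_disc_nbhs x n : (0 < n)%N -> exists i, Af_disc i x /\ Af_disc i `<=` Af_ball x n%:R.
Proof.
move=> n0; have [q hq] := Af_approx x (fact_gt0 n).
exists (q, (true, n)); split => //; rewrite /Af_disc/=.
rewrite (Af_ball_eq (hq : Af_ball (iota q) n`!%:R x)).
exact: Af_ball_fact.
Qed.

Lemma measurable_Af_gen (A : set Af) : measurable A -> <<s range Af_disc >> A.
Proof.
apply: smallest_sub; first exact: smallest_sigma_algebra.
move=> U /Af_open_ballP Uo.
pose F i := if `[< Af_disc i `<=` U >] then Af_disc i else set0.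
have -> : U = \bigcup_i F i.
  apply/seteqP; split=> [x /Uo[n [n0 nU]]|x [i _]].
    have [i [ix iU]] := Af_disc_nbhs x n0; exists i => //; rewrite /F asboolT//.
    exact: subset_trans nU.
  by rewrite /F; case: asboolP => // iU /iU.
apply: (@countable_bigcupT_measurable _ (g_sigma_algebraType (range Af_disc))) => [|i].
  exact: countableP.
rewrite /F; case: asboolP => _; last exact: measurable0.
by apply: sub_gen_smallest; exists i.
Qed.

Definition Af_exhaust n : rat * (bool * nat) := (0, (false, n)).

Lemma Af_exhaust_nd n m : (n <= m)%N -> Af_disc (Af_exhaust n) `<=` Af_disc (Af_exhaust m).
Proof.
move=> /fact_dvd_fact/dvdnP[k e]; rewrite /Af_disc/= /scale/= Af_of_rat0.
have k0 : (0 < k)%N by have := fact_gt0 m; rewrite e muln_gt0 => /andP[].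
have -> : n`!%:R^-1 = m`!%:R^-1 * k%:R :> rat.
  by rewrite e natrM invfM mulrAC mulVf ?mul1r// pnatr_eq0 -lt0n.
exact: Af_ball_mul.
Qed.

Lemma Af_exhaustT : \bigcup_n Af_disc (Af_exhaust n) = setT.
Proof.
rewrite -subTset => x _; have [n [n0 xn]] := Af_denominator x; exists n => //.
rewrite /Af_disc/= /scale/= Af_of_rat0 /Af_ball/= subr0 invrK.
have /dvdnP[k ->] : (n %| n`!)%N by rewrite dvdn_fact// n0 /=.
rewrite mulnC natrM Af_of_ratM mulrA; apply: ZhatM => //; exact: Zhat_nat.
Qed.

Lemma measurable_Af_fun (f : Af -> Af) :
  (forall x n, (0 < n)%N -> exists m, (0 < m)%N /\
     forall y, Af_ball x m%:R y -> Af_ball (f x) n%:R (f y)) ->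
  measurable_fun setT f.
Proof.
move=> fc; apply: (@measurability _ _ _ _ _ _ (@open Af)) => //.
move=> _ [U Uo <-]; rewrite setTI; apply: measurable_Af_open.
apply/Af_open_ballP => x /= Ufx.
have [n [n0 nU]] := (Af_open_ballP U).1 Uo _ Ufx; have [m [m0 h]] := fc x n n0.
by exists m; split => // y /h/nU.
Qed.

Lemma measurable_Af_shift a : measurable_fun setT (fun x : Af => x + a).
Proof.
apply: measurable_Af_fun => x n n0; exists n; split; first exact: n0.
move=> y.
by rewrite /Af_ball/= opprD addrACA subrr addr0.
Qed.

Lemma measurable_Af_opp : measurable_fun setT (-%R : Af -> Af).
Proof.
apply: measurable_Af_fun => x n n0; exists n; split; first exact: n0.
move=> y.
by rewrite /Af_ball/= -opprD mulNr => /ZhatN.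
Qed.

Lemma Af_ball_shift x y q : [set x + z | z in Af_ball y q] = Af_ball (x + y) q.
Proof.
apply/seteqP; split=> [_ [z yz <-]|z xz].
  by move: yz; rewrite /Af_ball/= opprD addrACA subrr add0r.
by exists (z - x); [move: xz; rewrite /Af_ball/= opprD addrA|rewrite addrC subrK].
Qed.

Lemma Af_ball_opp x q : -%R @^-1` Af_ball x q = Af_ball (- x) q.
Proof.
apply/seteqP; split => y; rewrite /Af_ball/= => /ZhatN; rewrite -mulNr opprB.
  by rewrite !opprK addrC.
by rewrite addrC.
Qed.

(** The pieces are indexed by the residue of [(y - x) / q] modulo [n]. *)
Lemma Af_ball_split x q n : q != 0 -> (0 < n)%N ->
  Af_ball x q = \bigcup_(k in `I_n) Af_ball (x + iota (k%:R * q)) (q * n%:R).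
Proof.
move=> q0 n0; apply/seteqP; split => y.
  move=> /(Zhat_residue n0)[k [kn hk]]; exists k => //.
  move: hk; rewrite /Af_ball/=; congr Zhat.
  rewrite invfM (mulrC k%:R) !Af_of_ratM; have := Af_of_ratV q0.
  move: (iota q) (iota q^-1) (iota k%:R) (iota n%:R^-1) => a a' k' n' aa.
  transitivity ((y - x) * a' * n' - (a * a') * k' * n'); [rewrite aa|]; ring.
move=> [k /= kn] /(Af_ball_mul n0); apply: Af_ball_trans.
rewrite /Af_ball/= addrC addKr -Af_of_ratM mulfK//; exact: Zhat_nat.
Qed.

Lemma Af_ball_split_trivIset x q n : q != 0 -> (0 < n)%N ->
  trivIset `I_n (fun k => Af_ball (x + iota (k%:R * q)) (q * n%:R)).
Proof.
move=> q0 n0 i j /= ni nj [y [yi yj]].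
have := Af_ball_trans yi (Af_ball_sym yj).
have -> : Af_ball (x + iota (i%:R * q)) (q * n%:R) (x + iota (j%:R * q)) <->
    Af_ball (iota (i : int)%:~R) n%:R (iota (j : int)%:~R).
  rewrite /Af_ball/= opprD addrACA subrr add0r -!Af_of_ratB -!Af_of_ratM -mulrBl invfM.
  by rewrite !mulrA mulfK//.
move=> /(Af_ball_int_dvd _ _ n0); rewrite -eqz_mod_dvd => /eqP.
by rewrite !modz_nat => -[]; rewrite !modn_small.
Qed.

End Af_measure.

(** Uniqueness of measures: [mu] and its pushforward agree on a generating family that is stable
    under intersection and contains sets of finite measure covering the space. *)
Lemma measure_preserving_gen d (T : measurableType d) (R : realType)
    (mu : {measure set T -> \bar R}) (h : T -> T) (G : set (set T)) (g : nat -> set T) :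
  measurable_fun setT h -> G `<=` measurable -> (forall A, measurable A -> <<s G >> A) ->
  setI_closed G -> (forall n, G (g n)) -> \bigcup_n g n = setT ->
  (forall n, mu (g n) < +oo)%E -> (forall A, G A -> mu (h @^-1` A) = mu A) ->
  forall A, measurable A -> mu (h @^-1` A) = mu A.
Proof.
move=> mh Gm sG GI Gg gT goo Gh A mA; apply/esym.
apply: (g_sigma_algebra_measure_unique G _ g _ _ mu (pushforward mu h)) => //.
  by move=> B /Gh.
exact: sG.
Qed.

(** * Haar measure of balls *)

Section haar_measure.
Implicit Types (x y : Af) (q r : rat) (n m : nat).
Variables (R : realType) (mu : {measure set Af -> \bar R}).
Hypothesis mu_haar : haar_Af mu.

Lemma haar_shift a (A : set Af) : measurable A -> mu ((fun x => x + a) @^-1` A) = mu A.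
Proof.
case: mu_haar => muT _ mA; rewrite -(muT (- a) _ mA); congr (mu _).
apply/seteqP; split=> [x xA|_ [y yA <-]]; last by rewrite /= addrC addrA subrr add0r.
by exists (x + a) => //; rewrite addrC addrK.
Qed.

Lemma haar_ball_center x q : q != 0 -> mu (Af_ball x q) = mu (Af_ball 0 q).
Proof.
move=> q0; have [muT _] := mu_haar; have := muT x _ (measurable_Af_ball 0 q0).
by rewrite Af_ball_shift addr0.
Qed.

Lemma haar_ball_split q n : q != 0 -> (0 < n)%N ->
  mu (Af_ball 0 q) = (n%:R%:E * mu (Af_ball 0%R (q * n%:R)%R))%E.
Proof.
move=> q0 n0; have qn0 : q * n%:R != 0 by rewrite mulf_neq0// pnatr_eq0 -lt0n.
rewrite (Af_ball_split 0 q0 n0) measure_fin_bigcup//; last first.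
- by move=> k _; exact: measurable_Af_ball.
- exact: Af_ball_split_trivIset.
rewrite -fsbig_ord; transitivity (\sum_(k < n) 1%:E * mu (Af_ball 0%R (q * n%:R)%R))%E.
  by apply: eq_bigr => k _; rewrite mul1e; exact: haar_ball_center.
by rewrite -ge0_sume_distrl// sumEFin sumr_const card_ord.
Qed.

(** Write [q = m / n]. Splitting the ball of radius [1 / n] into [n] translates of [Zhat] gives it
    measure [n]; splitting it into [m] balls of radius [q] gives each of them [n / m]. *)
Lemma haar_ball x q : 0 < q -> mu (Af_ball x q) = (ratr q^-1)%:E.
Proof.
move=> q0; have qn0 : q != 0 by rewrite gt_eqF.
rewrite haar_ball_center//.
have mu1 : mu (Af_ball 0 1) = 1%E.
  case: mu_haar => _ <-; congr (mu _); apply/seteqP; split => y;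
    by rewrite /Af_ball/= subr0 invr1 Af_of_rat1 mulr1.
pose m := `|numq q|%N; pose n := `|denq q|%N.
have m0 : (0 < m)%N by rewrite absz_gt0 numq_eq0.
have n0 : (0 < n)%N by rewrite absz_gt0 denq_neq0.
have nn : n%:R != 0 :> rat by rewrite pnatr_eq0 -lt0n.
have mn : m%:R != 0 :> rat by rewrite pnatr_eq0 -lt0n.
have qE : q = n%:R^-1 * m%:R.
  rewrite mulrC -{1}(divq_num_den q) /n /m !pmulrn absz_denq gez0_abs//.
  by rewrite numq_ge0 ltW.
have h1 : mu (Af_ball 0 n%:R^-1) = n%:R%:E.
  by rewrite (haar_ball_split (n := n)) ?invr_eq0// mulVf// mu1 mule1.
have h2 := haar_ball_split (q := n%:R^-1) (n := m) _ m0.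
move: h2; rewrite h1 -qE invr_eq0 => /(_ nn) h2.
have mR : m%:R != 0 :> R by rewrite pnatr_eq0 -lt0n.
transitivity (m%:R^-1%:E * (m%:R%:E * mu (Af_ball 0%R q)))%E.
  by rewrite muleA -EFinM mulVf// mul1e.
rewrite -h2 -EFinM qE invfM invrK; congr EFin.
by rewrite (rmorphM (@ratr R)) (fmorphV (@ratr R)) !(rmorph_nat (@ratr R)) mulrC.
Qed.

Lemma haar_disc i : mu (Af_disc i) = (ratr (scale i.2)^-1)%:E.
Proof. by rewrite /Af_disc haar_ball// scale_gt0. Qed.

Lemma haar_disc_lty i : (mu (Af_disc i) < +oo)%E.
Proof. by rewrite haar_disc ltry. Qed.

Lemma haar_opp (A : set Af) : measurable A -> mu (-%R @^-1` A) = mu A.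
Proof.
pose G := [set A | A = set0 \/ exists i, A = Af_disc i].
apply: (measure_preserving_gen (G := G) (g := Af_disc \o Af_exhaust)).
- exact: measurable_Af_opp.
- by move=> _ [->|[i ->]]; [exact: measurable0|exact: measurable_Af_disc].
- move=> B /measurable_Af_gen; apply: smallest_sub; first exact: smallest_sigma_algebra.
  by move=> _ [i _ <-]; apply: sub_gen_smallest; right; exists i.
- move=> B C [->|[i ->]]; first by left; rewrite set0I.
  move=> [->|[j ->]]; first by left; rewrite setI0.
  by have [->|[k ->]] := Af_disc_setI i j; [left|right; exists k].
- by move=> n; right; exists (Af_exhaust n).
- exact: Af_exhaustT.
- by move=> n; exact: haar_disc_lty.
- move=> B [->|[i ->]]; first by rewrite preimage_set0.
  rewrite /Af_disc Af_ball_opp.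
  exact: etrans (haar_ball _ (scale_gt0 _)) (esym (haar_ball _ (scale_gt0 _))).
Qed.

End haar_measure.

Lemma Cintegral_comp d (T : measurableType d) (R : realType) (mu : {measure set T -> \bar R})
    (h : T -> T) (f : T -> R[i]) : measurable_fun setT h ->
  (forall A, measurable A -> mu (h @^-1` A) = mu A) -> Cmeasurable f ->
  Cintegral mu (fun x => f (h x)) = Cintegral mu f.
Proof.
move=> mh hmu [f1 f2].
have key (u : T -> R) : measurable_fun setT u -> \int[mu]_x u (h x) = \int[mu]_x u x.
  move=> /measurable_EFinP mu'; rewrite /Rintegral; congr fine.
  rewrite integralE [RHS]integralE; congr (_ - _)%E.
    rewrite -(ge0_integral_comp mh hmu (measurable_funepos mu')); last exact: funepos_ge0.
    by apply: eq_integral => x _; rewrite !funeposE.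
  rewrite -(ge0_integral_comp mh hmu (measurable_funeneg mu')); last exact: funeneg_ge0.
  by apply: eq_integral => x _; rewrite !funenegE.
by rewrite /Cintegral; apply: eq_ReIm => /=; exact: (key _).
Qed.

Lemma indC_iff d (T : measurableType d) (R : realType) (A B : set T) x y :
  (A x <-> B y) -> indC R A x = indC R B y.
Proof.
move=> AB; rewrite /indC !indicE (_ : (x \in A) = (y \in B))//.
by apply/idP/idP; rewrite !inE => /AB.
Qed.

Lemma Cintegrable_indC d (T : measurableType d) (R : realType)
    (mu : {measure set T -> \bar R}) (A : set T) : measurable A -> (mu A < +oo)%E ->
  Cintegrable mu (indC R A).
Proof.
by move=> mA Aoo; split; [exact: integrable_indic_fin|exact: integrable0].
Qed.

(** * Transforms of balls *)

Section Af_kernel.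
Local Notation iota := Af_of_rat.
Implicit Types (x y c xi : Af) (q r : rat) (n m : nat).
Variables (R : realType) (mu : {sigma_finite_measure set Af -> \bar R}).
Hypothesis mu_haar : haar_Af mu.

(** The preimage of any set whatsoever is open. *)
Lemma locally_constant_Cmeasurable (phi : Af -> R[i]) :
  (forall x, \forall y \near x, phi y = phi x) -> Cmeasurable phi.
Proof.
move=> phic.
have key (u : Af -> R) : (forall x, \forall y \near x, u y = u x) -> measurable_fun setT u.
  move=> uc _ B _; rewrite setTI; apply: measurable_Af_open; apply/Af_open_ballP => x Bx.
  have /nbhs_Af_ball[n [n0 nu]] := uc x; exists n; split => // y /nu /= e.
  by rewrite /preimage/= e.
by split; apply: key => x; apply: filterS (phic x) => y ->.
Qed.

Lemma chi_f_congr x y : Zhat (x - y) -> chi_f R x = chi_f R y.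
Proof. by move=> xy; rewrite -(subrK y x) chi_fD chi_f_Zhat ?mul1r. Qed.

Lemma Cmeasurable_chi_f c : Cmeasurable (fun x => chi_f R (c * x)).
Proof.
apply: locally_constant_Cmeasurable => x; apply/nbhs_Af_ball.
have [n [n0 cn]] := Af_denominator c; exists n; split; first exact: n0.
move=> y xy.
have nn : n%:R != 0 :> rat by rewrite pnatr_eq0 -lt0n.
suff e : chi_f R (c * y) = chi_f R (c * x) by exact: e.
apply: chi_f_congr; rewrite -mulrBr.
have -> : c * (y - x) = (c * iota n%:R) * ((y - x) * iota n%:R^-1).
  by rewrite mulrACA Af_of_ratV// mulr1.
exact: (ZhatM cn xy).
Qed.

(** Such a set is a countable union of products of discs, hence measurable for the product
    sigma-algebra. *)
Lemma measurable_Af_prod (U : set (Af * Af)) :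
  (forall x y, U (x, y) -> exists n, (0 < n)%N /\ forall x' y',
     Af_ball x n%:R x' -> Af_ball y n%:R y' -> U (x', y')) -> measurable U.
Proof.
move=> Uo; pose F (i : (rat * (bool * nat)) * (rat * (bool * nat))) :=
  if `[< Af_disc i.1 `*` Af_disc i.2 `<=` U >] then Af_disc i.1 `*` Af_disc i.2 else set0.
have -> : U = \bigcup_i F i.
  apply/seteqP; split=> [[x y] /Uo[n [n0 nU]]|z [i _]].
    have [i [ix iU]] := Af_disc_nbhs x n0; have [j [jy jU]] := Af_disc_nbhs y n0.
    exists (i, j) => //; rewrite /F asboolT//= => -[x' y'] /= [/iU ? /jU ?].
    exact: nU.
  by rewrite /F; case: asboolP => // iU /iU.
apply: countable_bigcupT_measurable => [|i]; first exact: countableP.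
rewrite /F; case: asboolP => _ //.
by apply: measurableX; exact: measurable_Af_disc.
Qed.

Definition kernel_Af x xi : R[i] := chi_f R (xi * x).

Lemma kernel_Af_sym x y : kernel_Af x y = kernel_Af y x.
Proof. by rewrite /kernel_Af mulrC. Qed.

Lemma kernel_Af_opp x xi : kernel_Af x (- xi) = conjc (kernel_Af x xi).
Proof. by rewrite /kernel_Af mulNr chi_fN. Qed.

Lemma Cmeasurable_kernel_Af : Cmeasurable (fun z : Af * Af => kernel_Af z.1 z.2).
Proof.
have cst x y : exists n, (0 < n)%N /\ forall x' y',
    Af_ball x n%:R x' -> Af_ball y n%:R y' -> kernel_Af x' y' = kernel_Af x y.
  have [n [n0 xn]] := Af_denominator x; have [m [m0 ym]] := Af_denominator y.
  exists (n * m)%N; split; first by rewrite muln_gt0 n0.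
  have nn : n%:R != 0 :> rat by rewrite pnatr_eq0 -lt0n.
  have mm : m%:R != 0 :> rat by rewrite pnatr_eq0 -lt0n.
  move=> x' y'; rewrite /Af_ball/= natrM => hx hy; apply: chi_f_congr.
  set w := iota (n%:R * m%:R)^-1 in hx hy.
  have W : w * (iota n%:R * iota m%:R) = 1.
    by rewrite -Af_of_ratM -Af_of_ratM mulVf ?mulf_neq0// Af_of_rat1.
  (* This is [(x' - x) (y' - y) + x (y' - y) + (x' - x) y] with copies of the unit [w * (n * m)]
     inserted, so that every factor can be grouped into [Zhat]. *)
  have -> : y' * x' - y * x = (x' - x) * w * ((y' - y) * w) * (iota n%:R * iota m%:R * (iota n%:R * iota m%:R)) +
     (x * iota n%:R) * ((y' - y) * w) * iota m%:R + (x' - x) * w * (y * iota m%:R) * iota n%:R.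
    transitivity ((x' - x) * (y' - y) * (w * (iota n%:R * iota m%:R)) * (w * (iota n%:R * iota m%:R)) +
      x * (y' - y) * (w * (iota n%:R * iota m%:R)) + (x' - x) * y * (w * (iota n%:R * iota m%:R))).
      by rewrite W !mulr1; ring.
    by move: w (iota n%:R) (iota m%:R) {hx hy W xn ym} => w a b; ring.
  have NZ := Zhat_nat n; have MZ := Zhat_nat m; have NMZ := ZhatM NZ MZ.
  apply: ZhatD; first apply: ZhatD.
  - exact: (ZhatM (ZhatM hx hy) (ZhatM NMZ NMZ)).
  - exact: (ZhatM (ZhatM xn hy) MZ).
  - exact: (ZhatM (ZhatM hx ym) NZ).
have key (u : R[i] -> R) : measurable_fun setT (fun z : Af * Af => u (kernel_Af z.1 z.2)).
  move=> _ B _; rewrite setTI; apply: measurable_Af_prod => x y Bxy.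
  have [n [n0 h]] := cst x y; exists n; split; first exact: n0.
  by move=> x' y' hx hy; rewrite /preimage/= (h _ _ hx hy).
by split; exact: key.
Qed.

Lemma haar_ball_lty x q : 0 < q -> (mu (Af_ball x q) < +oo)%E.
Proof. by move=> q0; rewrite (haar_ball mu_haar)// ltry. Qed.

Lemma Cintegrable_ball x q c : 0 < q ->
  Cintegrable mu (fun y => indC R (Af_ball x q) y * chi_f R (c * y)).
Proof.
move=> q0; apply: Cintegrable_bounded_mul.
- apply: Cintegrable_indC; last exact: haar_ball_lty.
  by apply: measurable_Af_ball; rewrite gt_eqF.
- exact: Cmeasurable_chi_f.
- by move=> y; rewrite normsq_chi_f.
Qed.

Lemma Cintegral_ball q c : 0 < q ->
  Cintegral mu (fun x => indC R (Af_ball 0 q) x * chi_f R (c * x)) =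
  (ratr q^-1)%:C%C * indC R (Af_ball 0 q^-1) c.
Proof.
move=> q0; have qn0 : q != 0 by rewrite gt_eqF.
have mB : measurable (Af_ball 0 q) by exact: measurable_Af_ball.
(* In the first case the character is trivial on the ball, and the integral is the measure of the
   ball. *)
have [cq|cq] := pselect (Zhat (c * iota q)).
  have cB : Af_ball 0 q^-1 c by rewrite /Af_ball/= subr0 invrK.
  rewrite {2}/indC indicE mem_set// mulr1.
  transitivity (ip mu (indC R (Af_ball 0 q)) (indC R (Af_ball 0 q))); last first.
    by rewrite ip_indC// setIid (haar_ball mu_haar)// ltry.
  apply: eq_Cintegral => x; rewrite conj_indC -!indCI setIid.
  have [xB|xB] := pselect (Af_ball 0 q x); last first.
    by rewrite /indC indicE memNset// mul0r.
  rewrite chi_f_Zhat ?mulr1//.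
  have -> : c * x = (c * iota q) * (x * iota q^-1) by rewrite mulrACA Af_of_ratV// mulr1.
  by apply: ZhatM cq _; move: xB; rewrite /Af_ball/= subr0.
have cB : ~ Af_ball 0 q^-1 c by rewrite /Af_ball/= subr0 invrK.
rewrite {2}/indC indicE memNset// mulr0.
set f := fun x => _; set J := Cintegral mu f.
have mf : Cmeasurable f by apply: CmeasurableM (Cmeasurable_chi_f c); exact: Cmeasurable_indC.
(* The ball is stable under translation by [q], which multiplies the integrand
   by a constant different from 1. *)
have JE : chi_f R (c * iota q) * J = J.
  rewrite -[RHS](Cintegral_comp (measurable_Af_shift (iota q)) (haar_shift mu_haar (iota q)) mf).
  rewrite /J -CintegralZ; last exact: Cintegrable_ball.
  apply: eq_Cintegral => x; rewrite /f mulrDr chi_fD.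
  have -> : indC R (Af_ball 0 q) (x + iota q) = indC R (Af_ball 0 q) x.
    have qx : Af_ball (x + iota q) q x.
      rewrite /Af_ball/= opprD addrA subrr sub0r mulNr Af_of_ratV//.
      by apply: ZhatN; exact: Zhat1.
    apply: indC_iff; split => h; first exact: (Af_ball_trans h qx).
    exact: (Af_ball_trans h (Af_ball_sym qx)).
  by move: (chi_f R (c * x)) (chi_f R (c * iota q)) => u v; ring.
apply/eqP; apply: contra_notT cq => J0; apply: (@chi_f_eq1 R).
by apply: (mulIf J0); rewrite mul1r.
Qed.

Lemma kernel_hat_ball x q xi : 0 < q ->
  kernel_hat mu kernel_Af (indC R (Af_ball x q)) xi =
  (ratr q^-1)%:C%C * (chi_f R (x * xi) * indC R (Af_ball 0 q^-1) xi).
Proof.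
move=> q0; rewrite [x * xi]mulrC; have qn0 : q != 0 by rewrite gt_eqF.
have mB : measurable (Af_ball x q) by exact: measurable_Af_ball.
rewrite mulrCA -Cintegral_ball// /kernel_hat.
have mf : Cmeasurable (fun y => indC R (Af_ball x q) y * kernel_Af y xi).
  by apply: CmeasurableM (Cmeasurable_chi_f xi); exact: Cmeasurable_indC.
apply: (etrans (esym (Cintegral_comp (measurable_Af_shift x) (haar_shift mu_haar x) mf))).
rewrite -CintegralZ; last exact: Cintegrable_ball.
apply: eq_Cintegral => y; rewrite /kernel_Af mulrDr chi_fD.
have e : indC R (Af_ball x q) (y + x) = indC R (Af_ball 0 q) y.
  by apply: indC_iff; rewrite /Af_ball/= addrK subr0.
by rewrite [X in X * _ = _]e; move: (chi_f R (xi * y)) (chi_f R (xi * x)) => u v; ring.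
Qed.

Lemma L2_kernel_hat_ball x q : 0 < q ->
  L2 mu (kernel_hat mu kernel_Af (indC R (Af_ball x q))).
Proof.
move=> q0; have qn0 : q^-1 != 0 by rewrite invr_eq0 gt_eqF.
have -> : kernel_hat mu kernel_Af (indC R (Af_ball x q)) =
    (fun xi => (ratr q^-1)%:C%C * (chi_f R (x * xi) * indC R (Af_ball 0 q^-1) xi)).
  by apply/funext => xi; exact: kernel_hat_ball.
have mB := measurable_Af_ball 0 qn0.
apply: L2Z; apply: (L2_dom _ _ _ (integrable_indic_fin mB (_ : (mu _ < +oo)%E))).
- by apply: CmeasurableM; [exact: Cmeasurable_chi_f|exact: Cmeasurable_indC].
- by move=> xi; rewrite normsqM normsq_chi_f mul1r normsq_indC.
- by apply: haar_ball_lty; rewrite invr_gt0.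
Qed.

(** The dual ball of the first contains no more than that of the second, so the product of the
    transforms is a character of [x - y] on the smaller dual ball. By [Cintegral_ball] its integral
    detects whether [x - y] lies in the ball of radius [q], that is, whether the two balls meet. *)
Lemma ip_kernel_hat_ball x y q n : 0 < q -> (0 < n)%N ->
  ip mu (kernel_hat mu kernel_Af (indC R (Af_ball x q)))
        (kernel_hat mu kernel_Af (indC R (Af_ball y (q * n%:R)))) =
  ip mu (indC R (Af_ball x q)) (indC R (Af_ball y (q * n%:R))).
Proof.
move=> q0 n0; have n1 : 0 < n%:R :> rat by rewrite ltr0n.
have qn : 0 < q * n%:R by rewrite mulr_gt0.
have qi0 : 0 < q^-1 by rewrite invr_gt0.
have [q1 q2] : q != 0 /\ q * n%:R != 0 by rewrite !gt_eqF.
rewrite ip_indC; [|exact: measurable_Af_ball|exact: measurable_Af_ball|]; last first.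
  apply: (@le_lt_trans _ _ (mu (Af_ball x q))).
    apply: le_measure; rewrite ?inE; last exact: subIsetl.
      by apply: measurableI; exact: measurable_Af_ball.
    exact: measurable_Af_ball.
  exact: haar_ball_lty.
transitivity ((ratr (q * n%:R)^-1)%:C%C * indC R (Af_ball 0 q) (x - y)); last first.
  have [xy|xy] := pselect (Af_ball x q y).
    have xy' : Af_ball 0 q (x - y).
      by move: (Af_ball_sym xy); rewrite /Af_ball/= subr0.
    by rewrite (Af_ball_setI n0 xy) (haar_ball mu_haar y qn) /indC indicE (mem_set xy') mulr1.
  have xy' : ~ Af_ball 0 q (x - y).
    by move=> h; apply: xy; apply: Af_ball_sym; move: h; rewrite /Af_ball/= subr0.
  by rewrite (Af_ball_disjoint n0 xy) measure0 /indC indicE (memNset xy') mulr0.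
have := Cintegral_ball (x - y) qi0; rewrite invrK => JE.
transitivity ((ratr q^-1)%:C%C * (ratr (q * n%:R)^-1)%:C%C * ((ratr q)%:C%C * indC R (Af_ball 0 q) (x - y))).
  rewrite -JE -CintegralZ; last exact: Cintegrable_ball.
  apply: eq_Cintegral => xi; rewrite (kernel_hat_ball _ _ q0) (kernel_hat_ball _ _ qn) !conjcM conj_indC conjc_real.
  rewrite -chi_fN mulrBl chi_fD.
  have sub : Af_ball 0 q^-1 `<=` Af_ball 0 (q * n%:R)^-1.
    have -> : q^-1 = (q * n%:R)^-1 * n%:R.
      by rewrite invfM -mulrA mulVf ?mulr1// pnatr_eq0 -lt0n.
    exact: Af_ball_mul.
  rewrite [in RHS](_ : indC R (Af_ball 0 q^-1) xi =
      indC R (Af_ball 0 q^-1) xi * indC R (Af_ball 0 (q * n%:R)^-1) xi); last first.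
    by rewrite -indCI (setIidl sub).
  move: (chi_f R (x * xi)) (chi_f R (- (y * xi))) (indC _ _ _) (indC _ _ _) => u v i j; ring.
rewrite mulrCA !mulrA -rmorphM -rmorphM/= -(rmorphM (@ratr R)) mulfV//.
by rewrite (rmorph1 (@ratr R)) mul1r.
Qed.

End Af_kernel.

(** * The transform on the finite adeles *)

Section Af_transform.
Variables (R : realType) (mu : {sigma_finite_measure set Af -> \bar R}).
Hypothesis mu_haar : haar_Af mu.

Lemma L2_disc i : L2 mu (indC R (Af_disc i)).
Proof. by apply: L2_indC; [exact: measurable_Af_disc|exact: haar_disc_lty]. Qed.

Lemma L2_kernel_hat_disc i : L2 mu (kernel_hat mu (@kernel_Af R) (indC R (Af_disc i))).
Proof. by apply: L2_kernel_hat_ball => //; exact: scale_gt0. Qed.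

(** One of the two scales is an integer multiple of the other; the case not covered by
    [ip_kernel_hat_ball] follows by conjugation. *)
Lemma ip_kernel_hat_disc i j :
  ip mu (kernel_hat mu (@kernel_Af R) (indC R (Af_disc i)))
        (kernel_hat mu (@kernel_Af R) (indC R (Af_disc j))) =
  ip mu (indC R (Af_disc i)) (indC R (Af_disc j)).
Proof.
have key i' j' n : (0 < n)%N -> scale j'.2 = scale i'.2 * n%:R ->
    ip mu (kernel_hat mu (@kernel_Af R) (indC R (Af_disc i')))
          (kernel_hat mu (@kernel_Af R) (indC R (Af_disc j'))) =
    ip mu (indC R (Af_disc i')) (indC R (Af_disc j')).
  move=> n0 e; rewrite /Af_disc e; apply: ip_kernel_hat_ball => //.
  exact: scale_gt0.
have [n [n0 [e|e]]] := scale_chain i.2 j.2; first exact: key e.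
rewrite (ip_conj (L2_kernel_hat_disc j) (L2_kernel_hat_disc i)) (key _ _ _ n0 e).
by rewrite -(ip_conj (L2_disc j) (L2_disc i)).
Qed.

Lemma kernel_Af_transform : exists F : (Af -> R[i]) -> (Af -> R[i]), [/\ L2_isometry mu F,
  forall f, Cintegrable mu f -> L2 mu f -> F f = kernel_hat mu (@kernel_Af R) f %[ae mu] &
  forall f, L2 mu f -> F (fun xi => F f (- xi)) = f %[ae mu]].
Proof.
apply: (kernel_transform (@Cmeasurable_kernel_Af R) _ (@kernel_Af_sym R) measurable_Af_opp
  (haar_opp mu_haar) (@kernel_Af_opp R) measurable_Af_disc (haar_disc_lty mu_haar)
  Af_disc_setI measurable_Af_gen Af_exhaust_nd Af_exhaustT L2_kernel_hat_disc
  ip_kernel_hat_disc) => x y.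
by rewrite normsq_chi_f.
Qed.

(** The sets [W n] are open because [phi] is locally constant, and they increase to the whole space;
    finitely many of them, hence a single one, cover the compact support. *)
Lemma test_Af_dom (phi : Af -> R[i]) : test_Af phi -> exists (N : R) i,
  forall x, norm1 (phi x) <= N * \1_(Af_disc i) x.
Proof.
move=> [phic phiK].
pose W n := Af_disc (Af_exhaust n) `&` [set x | norm1 (phi x) <= n%:R].
have Wo n : open (W n).
  apply: openI; first by apply: open_Af_ball; exact: scale_neq0.
  apply/Af_open_ballP => x /= xn; have /nbhs_Af_ball[m [m0 h]] := phic x.
  by exists m; split; [exact: m0|move=> y /h /= ->].
have Wnd n m : (n <= m)%N -> W n `<=` W m.
  move=> nm x [xn /= h]; split; first exact: (Af_exhaust_nd nm).
  by rewrite /= (le_trans h)// ler_nat.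
have WT x : exists n, W n x.
  have : setT x by []; rewrite -Af_exhaustT => -[n _ xn].
  pose k := Num.bound (norm1 (phi x)); exists (maxn n k); split.
    by apply: Af_exhaust_nd xn; exact: leq_maxl.
  rewrite /= (le_trans (ltW (archi_boundP (norm1_ge0 _))))// ler_nat.
  exact: leq_maxr.
move: phiK; rewrite compact_cover => /(_ nat setT W).
case=> [n _|x _|D _ DK]; first exact: Wo.
  by have [n xn] := WT x; exists n.
pose N := \max_(n <- finmap.enum_fset D) n; exists N%:R, (Af_exhaust N) => x.
have [p0|p0] := eqVneq (phi x) 0.
  by rewrite p0 /norm1/= normr0 addr0 mulr_ge0.
have [|n /= nD xn] := DK x; first exact: subset_closure.
have nN : (n <= N)%N by exact: leq_bigmax_seq.
by have [xN /= h] := Wnd _ _ nN _ xn; rewrite indicE (mem_set xN) mulr1.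
Qed.

Lemma test_Af_Cmeasurable (phi : Af -> R[i]) : test_Af phi -> Cmeasurable phi.
Proof. by move=> [phic _]; exact: locally_constant_Cmeasurable. Qed.

Lemma test_Af_Cintegrable (phi : Af -> R[i]) : test_Af phi -> Cintegrable mu phi.
Proof.
move=> tphi; have [N [i le]] := test_Af_dom tphi.
apply: (Cintegrable_dom (fun x => N * \1_(Af_disc i) x)).
- exact: test_Af_Cmeasurable.
- by move=> x; exact: le_trans (Re_norm1 _) (le x).
- by move=> x; exact: le_trans (Im_norm1 _) (le x).
- have := integrableZl measurableT N
    (integrable_indic_fin (measurable_Af_disc i) (haar_disc_lty mu_haar i)).
  exact: eq_integrable.
Qed.

Lemma test_Af_L2 (phi : Af -> R[i]) : test_Af phi -> L2 mu phi.
Proof.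
move=> tphi; have [N [i le]] := test_Af_dom tphi.
apply: (L2_dom (fun x => N ^+ 2 * \1_(Af_disc i) x)).
- exact: test_Af_Cmeasurable.
- move=> x; apply: (@le_trans _ _ (norm1 (phi x) ^+ 2)).
    rewrite /normsq /norm1 -(real_normK (num_real (complex.Re _))).
    rewrite -(real_normK (num_real (complex.Im _))).
    have := normr_ge0 (complex.Re (phi x)); have := normr_ge0 (complex.Im (phi x)).
    by move: `|_| `|_| => p q *; nra.
  have -> : N ^+ 2 * \1_(Af_disc i) x = (N * \1_(Af_disc i) x) ^+ 2.
    by rewrite exprMn indicE; case: (_ \in _); rewrite ?expr1n ?expr0n.
  by rewrite lerXn2r// ?nnegrE ?norm1_ge0// (le_trans _ (le x)) ?norm1_ge0.
- have := integrableZl measurableT (N ^+ 2)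
    (integrable_indic_fin (measurable_Af_disc i) (haar_disc_lty mu_haar i)).
  exact: eq_integrable.
Qed.

Lemma test_Af_disc i : test_Af (indC R (Af_disc i)).
Proof.
have s0 := scale_neq0 i.2; split => [x|].
  have xo := open_Af_ball (x := x) s0.
  apply: (filterS _ (open_nbhs_nbhs (conj xo (Af_ball_refl x (scale i.2))))) => y xy.
  apply: indC_iff; split => h; first exact: (Af_ball_trans h (Af_ball_sym xy)).
  exact: (Af_ball_trans h xy).
have -> : [set x | indC R (Af_disc i) x != 0] = Af_disc i.
  apply/seteqP; split => x /=.
    by rewrite /indC indicE; case: (boolP (x \in _)) => [/set_mem|_]//; rewrite eqxx.
  by move=> xi; rewrite /indC indicE (mem_set xi) oner_eq0.
rewrite -(closure_id _).1; first exact: compact_Af_ball.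
exact: closed_Af_ball.
Qed.

Lemma fourier_Af_inversion : L2_fourier_inversion mu -%R (fourier_Af mu).
Proof.
have [F [FI Fhat FF]] := kernel_Af_transform.
have /op_isometry[FB Fn] := FI.
have [GB Gs] : [set F | L2_extension mu (@test_Af R)
    (fun phi xi => Cintegral mu (fun x => phi x * chi_f R (xi * x))) F] (fourier_Af mu).
  rewrite /fourier_Af; apply: xgetPex; exists F; split => // phi tphi.
  by apply: Fhat; [exact: test_Af_Cintegrable|exact: test_Af_L2].
have bd : L2_dense mu (fun i => indC R (Af_disc i)).
  exact: (L2_dense_indC measurable_Af_disc (haar_disc_lty mu_haar) Af_disc_setI
    measurable_Af_gen Af_exhaust_nd Af_exhaustT).
apply: (fourier_inversion_unique measurable_Af_opp (haar_opp mu_haar) L2_disc bd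
  (conj FI FF) GB) => i.
have h1 := Gs _ (test_Af_disc i).
have h2 := Fhat _ (test_Af_Cintegrable (test_Af_disc i)) (L2_disc i).
by move: h1 h2; apply: filterS2 => x e1 e2 Dx; rewrite e1// e2.
Qed.

End Af_transform.

(** * Tensor products *)

Section tensor_products.
Context d1 d2 (T1 : measurableType d1) (T2 : measurableType d2) (R : realType).
Context (m1 : {sigma_finite_measure set T1 -> \bar R}).
Context (m2 : {sigma_finite_measure set T2 -> \bar R}).
Local Notation nu := (m1 \x m2)%E.
Implicit Types (f : T1 -> R[i]) (g : T2 -> R[i]).

Definition tens f g (z : T1 * T2) : R[i] := f z.1 * g z.2.

Lemma Cmeasurable_tens f g : Cmeasurable f -> Cmeasurable g -> Cmeasurable (tens f g).
Proof. by move=> mf mg; apply: CmeasurableM; [exact: Cmeasurable_fst|exact: Cmeasurable_snd]. Qed.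

Lemma L2_tens f g : L2 m1 f -> L2 m2 g -> L2 nu (tens f g).
Proof.
move=> /L2P[mf fi] /L2P[mg gi]; apply/L2P; split; first exact: Cmeasurable_tens.
by have := integrable_prod fi gi; apply: eq_integrable => // z _ /=; rewrite /tens normsqM.
Qed.

Lemma ip_tens f f' g g' : L2 m1 f -> L2 m1 f' -> L2 m2 g -> L2 m2 g' ->
  ip nu (tens f g) (tens f' g') = ip m1 f f' * ip m2 g g'.
Proof.
move=> fL fL' gL gL'; have fi := Cintegrable_ip fL fL'; have gi := Cintegrable_ip gL gL'.
have [e _] := C_fubini1 (Cintegrable_tensor fi gi).
transitivity (Cintegral nu (fun z => f z.1 * conjc (f' z.1) * (g z.2 * conjc (g' z.2)))).
  by apply: eq_Cintegral => z; rewrite /tens conjcM mulrACA.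
rewrite e mulrC /ip -CintegralZ//; apply: eq_Cintegral => x /=.
by rewrite CintegralZ// mulrC.
Qed.

(** A null set times the whole other factor is null even if that factor has infinite measure, as
    [0 * +oo = 0]. *)
Lemma tens_ae f f' g g' : f = f' %[ae m1] -> g = g' %[ae m2] ->
  tens f g = tens f' g' %[ae nu].
Proof.
move=> [N1 [mN1 N10 s1]] [N2 [mN2 N20 s2]].
have a1 : {ae nu, forall z, f z.1 = f' z.1}.
  exists (N1 `*` setT); split; first exact: measurableX.
    by rewrite product_measure1E// [X in (X * _)%E](_ : _ = 0%E) ?mul0e.
  move=> z /= H; split => //; apply: s1 => /= H'; apply: H; exact: H'.
have a2 : {ae nu, forall z, g z.2 = g' z.2}.
  exists (setT `*` N2); split; first exact: measurableX.
    by rewrite product_measure1E// [X in (_ * X)%E](_ : _ = 0%E) ?mule0.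
  move=> z /= H; split => //; apply: s2 => /= H'; apply: H; exact: H'.
by move: a1 a2; apply: filterS2 => z e1 e2 _; rewrite /tens e1 e2.
Qed.

(** Sides of finite measure make the indicator of a rectangle a tensor of two [L2] functions. *)
Definition rectangle : Type := {AB : set T1 * set T2 |
  [/\ measurable AB.1, measurable AB.2, (m1 AB.1 < +oo)%E & (m2 AB.2 < +oo)%E]}.

Definition rect_set (r : rectangle) : set (T1 * T2) := (sval r).1 `*` (sval r).2.

Lemma measurable_rect r : measurable (rect_set r).
Proof. by case: (svalP r) => mA mB _ _; exact: measurableX. Qed.

Lemma rect_lty r : (nu (rect_set r) < +oo)%E.
Proof.
have [mA mB Aoo Boo] := svalP r; rewrite /rect_set product_measure1E//.
by apply: lte_mul_pinfty => //; rewrite ge0_fin_numE.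
Qed.

Lemma setX_rect A B r : measurable A -> measurable B ->
  exists t, A `*` B `&` rect_set r = rect_set t.
Proof.
move=> mA mB; have [] := svalP r; rewrite /rect_set.
move: (sval r).1 (sval r).2 => A' B' mA' mB' Aoo Boo.
have H : [/\ measurable (A `&` A'), measurable (B `&` B'),
    (m1 (A `&` A') < +oo)%E & (m2 (B `&` B') < +oo)%E].
  split; [exact: measurableI|exact: measurableI| |].
    by apply: le_lt_trans Aoo; apply: le_measure; rewrite ?inE//; exact: measurableI.
  by apply: le_lt_trans Boo; apply: le_measure; rewrite ?inE//; exact: measurableI.
by exists (exist _ (A `&` A', B `&` B') H); rewrite /rect_set/= setXI.
Qed.

Lemma rect_setI r s : exists t, rect_set r `&` rect_set s = rect_set t.
Proof. by have [mA mB _ _] := svalP r; exact: setX_rect. Qed.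

Lemma rect_exhaust : exists E : nat -> rectangle,
  (forall n m, (n <= m)%N -> rect_set (E n) `<=` rect_set (E m)) /\
  \bigcup_n rect_set (E n) = setT.
Proof.
have /sigma_finiteP[F [FT Fnd Fm]] := sigma_finiteT m1.
have /sigma_finiteP[G [GT Gnd Gm]] := sigma_finiteT m2.
have H n : [/\ measurable (F n), measurable (G n), (m1 (F n) < +oo)%E & (m2 (G n) < +oo)%E].
  by have [? ?] := Fm n; have [? ?] := Gm n.
exists (fun n => exist _ (F n, G n) (H n)); split.
  move=> n m nm z [/= zF zG]; split => /=.
    by have /subsetPset := Fnd _ _ nm; exact.
  by have /subsetPset := Gnd _ _ nm; exact.
rewrite -subTset => -[x y] _.
have : setT x by []; rewrite {1}FT => -[n _ xn].
have : setT y by []; rewrite {1}GT => -[m _ ym].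
exists (maxn n m) => //; split => /=.
  by have /subsetPset := Fnd _ _ (leq_maxl n m); exact.
by have /subsetPset := Gnd _ _ (leq_maxr n m); exact.
Qed.

(** A measurable rectangle may have sides of infinite measure; sigma-finiteness writes it as a
    countable union of rectangles of finite measure. *)
Lemma measurable_rect_gen (C : set (T1 * T2)) : measurable C -> <<s range rect_set >> C.
Proof.
have [E [_ ET]] := rect_exhaust.
rewrite measurable_prod_measurableType; apply: smallest_sub; first exact: smallest_sigma_algebra.
move=> _ [A mA [B mB <-]].
have -> : A `*` B = \bigcup_n (A `*` B `&` rect_set (E n)).
  by rewrite -setI_bigcupr ET setIT.
apply: (@countable_bigcupT_measurable _ (g_sigma_algebraType (range rect_set))) => [|n].
  exact: countableP.
by have [t ->] := setX_rect (E n) mA mB; apply: sub_gen_smallest; exists t.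
Qed.

Definition L2_pair : Type :=
  {p : (T1 -> R[i]) * (T2 -> R[i]) | L2 m1 p.1 /\ L2 m2 p.2}.

Definition pair_tens (p : L2_pair) : T1 * T2 -> R[i] := tens (sval p).1 (sval p).2.

Lemma L2_pair_tens p : L2 nu (pair_tens p).
Proof. by case: p => p [p1 p2]; exact: L2_tens. Qed.

Lemma pair_tens_dense : L2_dense nu pair_tens.
Proof.
have [E [End ET]] := rect_exhaust.
have rL r : L2 nu (indC R (rect_set r)).
  by apply: L2_indC; [exact: measurable_rect|exact: rect_lty].
have rd : L2_dense nu (fun r => indC R (rect_set r)).
  apply: (L2_dense_indC measurable_rect rect_lty _ measurable_rect_gen End ET) => r s.
  by right; exact: rect_setI.
apply: (L2_dense_trans rL L2_pair_tens rd) => -[[A B] [/= mA mB Aoo Boo]].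
have H : L2 m1 (indC R A) /\ L2 m2 (indC R B) by split; exact: L2_indC.
have := L2_closure_gen nu pair_tens (exist _ (indC R A, indC R B) H).
congr L2_closure; apply/funext => -[x y]; rewrite /pair_tens/= /tens/= /rect_set/=.
by rewrite /indC !indicE in_setX/= -mulnb natrM rmorphM.
Qed.

End tensor_products.

(** * Products of measure-preserving maps and of transforms *)

Section product_measure_preserving.
Context d1 d2 (T1 : measurableType d1) (T2 : measurableType d2) (R : realType).
Context (m1 : {sigma_finite_measure set T1 -> \bar R}).
Context (m2 : {sigma_finite_measure set T2 -> \bar R}).
Local Notation nu := (m1 \x m2)%E.
Variables (h1 : T1 -> T1) (h2 : T2 -> T2).
Hypothesis mh1 : measurable_fun setT h1.
Hypothesis mh2 : measurable_fun setT h2.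
Hypothesis h1_mu : forall A, measurable A -> m1 (h1 @^-1` A) = m1 A.
Hypothesis h2_mu : forall A, measurable A -> m2 (h2 @^-1` A) = m2 A.

Definition prod_map (z : T1 * T2) : T1 * T2 := (h1 z.1, h2 z.2).

Lemma measurable_prod_map : measurable_fun setT prod_map.
Proof.
apply: measurable_fun_pair.
  exact: (measurableT_comp mh1).
exact: (measurableT_comp mh2).
Qed.

Lemma prod_map_preserving A : measurable A -> nu (prod_map @^-1` A) = nu A.
Proof.
have [E [End ET]] := rect_exhaust m1 m2.
apply: (measure_preserving_gen measurable_prod_map (G := range (rect_set (m1 := m1) (m2 := m2)))
  (g := fun n => rect_set (E n))).
- by move=> _ [r _ <-]; exact: measurable_rect.
- exact: measurable_rect_gen.
- by move=> _ _ [r _ <-] [s _ <-]; have [t ->] := rect_setI r s; exists t.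
- by move=> n; exists (E n).
- exact: ET.
- by move=> n; exact: rect_lty.
move=> _ [r _ <-]; have [mA mB _ _] := svalP r; rewrite /rect_set.
move: (sval r).1 (sval r).2 mA mB => A1 A2 mA mB.
have -> : prod_map @^-1` (A1 `*` A2) = (h1 @^-1` A1) `*` (h2 @^-1` A2) by [].
have mA' : measurable (h1 @^-1` A1) by rewrite -[X in measurable X]setTI; exact: mh1.
have mB' : measurable (h2 @^-1` A2) by rewrite -[X in measurable X]setTI; exact: mh2.
apply: (etrans (product_measure1E m1 m2 mA' mB')).
apply: (etrans _ (esym (product_measure1E m1 m2 mA mB))).
by congr (_ * _)%E; [exact: h1_mu|exact: h2_mu].
Qed.

Lemma tensor_fourier_inversion F1 F2 : L2_fourier_inversion m1 h1 F1 ->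
  L2_fourier_inversion m2 h2 F2 ->
  exists F, L2_fourier_inversion nu prod_map F /\
    forall f g, L2 m1 f -> L2 m2 g -> F (tens f g) = tens (F1 f) (F2 g) %[ae nu].
Proof.
move=> [I1 inv1] [I2 inv2].
have /op_isometry[B1 _] := I1; have /op_isometry[B2 _] := I2.
pose B (p : L2_pair m1 m2) := tens (F1 (sval p).1) (F2 (sval p).2).
have BL p : L2 nu (B p).
  by have [? ?] := svalP p; apply: L2_tens; exact: op_L2.
have Bip p q : ip nu (B p) (B q) = ip nu (pair_tens p) (pair_tens q).
  have [p1 p2] := svalP p; have [q1 q2] := svalP q.
  rewrite /B /pair_tens !ip_tens//; try exact: op_L2.
  by rewrite (isometry_ip I1 p1 q1) (isometry_ip I2 p2 q2).
have [F [FI FB]] := L2_extend (@L2_pair_tens _ _ _ _ _ m1 m2) BL Bip (@pair_tens_dense _ _ _ _ _ m1 m2).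
have FT f g : L2 m1 f -> L2 m2 g -> F (tens f g) = tens (F1 f) (F2 g) %[ae nu].
  by move=> fL gL; exact: (FB (exist _ (f, g) (conj fL gL))).
exists F; split => //; split => //.
have /op_isometry[FBd _] := FI.
have mJ := measurable_prod_map; have Jnu := prod_map_preserving.
have JB := L2_bounded_neg mJ Jnu.
apply: (op_unique (@L2_pair_tens _ _ _ _ _ m1 m2) (@pair_tens_dense _ _ _ _ _ m1 m2)
  (L2_bounded_comp FBd (L2_bounded_comp JB FBd)) (L2_bounded_id nu)) => p.
have [p1 p2] := svalP p; have pL := L2_pair_tens p.
have L1 := op_L2 B1 p1; have L2' := op_L2 B2 p2.
have N1 := L2_comp mh1 h1_mu L1; have N2 := L2_comp mh2 h2_mu L2'.
(* On a tensor: [e1] and [e2] replace the inner transform by the tensor of transforms, [e3]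
   transforms its reflection, which is again a tensor, and [e4] is inversion in each factor. *)
have e1 := ae_comp mJ Jnu (FB p).
have e2 := op_ae FBd (L2_comp mJ Jnu (op_L2 FBd pL)) (L2_comp mJ Jnu (BL p)) e1.
have e3 := FT _ _ N1 N2.
have e4 := tens_ae (inv1 _ p1) (inv2 _ p2).
by move: e2 e3 e4; apply: filterS3 => z h h' h'' Dz; rewrite (h Dz) (h' Dz) (h'' Dz).
Qed.

End product_measure_preserving.

Theorem theorem5p5 (R : realType) (mu : {sigma_finite_measure set Af -> \bar R})
    (mu_haar : haar_Af mu) :
  [/\ L2_isometry (adele_measure mu) (fourier_A mu),
      forall f : R * Af -> R[i], L2 (adele_measure mu) f ->
        f = fourier_A mu (fun xi => fourier_A mu f (- xi))
          %[ae adele_measure mu] &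
      forall f g : R * Af -> R[i],
        L2 (adele_measure mu) f -> L2 (adele_measure mu) g ->
        Cintegral (adele_measure mu) (fun x => f x * conjc (g x)) =
        Cintegral (adele_measure mu)
          (fun xi => fourier_A mu f xi * conjc (fourier_A mu g xi))].
Proof.
have invR := fourier_R_inversion R; have invAf := fourier_Af_inversion mu_haar.
have [F [[FI Finv] FT]] := tensor_fourier_inversion (@measurable_neg R) measurable_Af_opp
  (@leb_neg R) (haar_opp mu_haar) invR invAf.
have /op_isometry[FB _] := FI.
(* The isometry [F] built from tensors lies in this set, so [fourier_A] has the defining properties;
   nothing more is known of it directly. *)
have [GB GT] : [set F | L2_bounded_operator (adele_measure mu) F /\
    forall phi psi, L2 lebesgue_measure phi -> L2 mu psi ->
      F (tensor phi psi) = tensor (fourier_R phi) (fourier_Af mu psi)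
        %[ae adele_measure mu]] (fourier_A mu).
  by rewrite /fourier_A; apply: xgetPex; exists F; split.
(* Negation on [R * Af] acts componentwise, so it is [prod_map] of the two negations up to
   conversion. *)
have [GI Ginv] : L2_fourier_inversion (adele_measure mu) -%R (fourier_A mu).
  apply: (fourier_inversion_unique
    (measurable_prod_map (@measurable_neg R) measurable_Af_opp)
    (prod_map_preserving (@measurable_neg R) measurable_Af_opp (@leb_neg R) (haar_opp mu_haar))
    (@L2_pair_tens _ _ _ _ _ lebesgue_measure mu) (@pair_tens_dense _ _ _ _ _ lebesgue_measure mu)
    (conj FI Finv) GB) => p.
  have [p1 p2] := svalP p.
  by move: (GT _ _ p1 p2) (FT _ _ p1 p2); apply: filterS2 => z e1 e2 Dz; rewrite (e1 Dz) (e2 Dz).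
split => // [f fL|f g fL gL].
  by apply: filterS (Ginv f fL) => x e Dx; rewrite e.
exact: esym (isometry_ip GI fL gL).
Qed.
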